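(* For $\gamma\in[0,\pi)\setminus\{\pi/2\}$, $\operatorname{dom}(S_\gamma)$ is the set of all functions of the form $$g(z)=h(z)+b\,S_{\pi/2}R_{\pi/2}(-i)\hat{R}_{\pi/2}(i)s_0(z)$$ with $h\in\operatorname{dom}(S_{\pi/2})$ and $b\in\mathbb{C}$ satisfying $$\langle s_0,h\rangle_2=\pi b\left(\tan\gamma+\operatorname{Re}\frac{s_0(i)}{s_{\pi/2}(i)}\right).$$
   Context: Inner products are conjugate linear in the left argument. For an entire function $f$, $f^\#(z):=\overline{f(\overline z)}$. A Hilbert space of entire functions is a de Branges (dB) space if it has a reproducing kernel and is isometrically invariant under $f\mapsto f^\#$ and under $f(z)\mapsto \frac{z-\overline w}{z-w}f(z)$ whenever $w$ is a non-real zero of $f$. The Hermite-Biehler class consists of entire $e$ with $|e(z)|>|e(\overline z)|$ for all $z$ with $\operatorname{Im} z>0$; for such $e$, $\mathcal{B}(e)$ is the space of entire $f$ with $f/e,\,f^\#/e\in H^2(\mathbb{C}_+)$ (Hardy space of the upper half plane), with inner product $\langle f,g\rangle=\int_{\mathbb{R}}\frac{\overline{f(x)}g(x)}{|e(x)|^2}dx$. Every nonzero dB space equals some $\mathcal{B}(e)$ isometrically. Fix a nonzero dB space $\mathcal{B}=\mathcal{B}(e)$ with $e$ in the Hermite-Biehler class and without real zeros (standing assumption), with reproducing kernel $k(z,w)$, $f(w)=\langle k(\cdot,w),f\rangle$. The set $\operatorname{assoc}\mathcal{B}$ of associated functions is $z\mathcal{B}+\mathcal{B}$. Put $s_\gamma(z)=\frac{i}{2}[e^{i\gamma}e(z)-e^{-i\gamma}e^\#(z)]$,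 $\gamma\in[0,\pi)$; then $s_\gamma\in\operatorname{assoc}\mathcal{B}$. $S$ is the operator of multiplication by the independent variable on its maximal domain in $\mathcal{B}$; it is assumed throughout that $\operatorname{dom}(S)$ is dense. One has $k(\cdot,w)\in\ker(S^*-\overline wI)$. The canonical selfadjoint extensions of $S$ are $S_\gamma$, $\gamma\in[0,\pi)$: with any $w\in\mathbb{C}\setminus\mathbb{R}$ (the result does not depend on $w$), $$\operatorname{dom}(S_\gamma)=\left\{g(z)=\frac{f(z)-\frac{s_\gamma(z)}{s_\gamma(w)}f(w)}{z-w}: f\in\mathcal{B}\right\},\qquad S_\gamma g(z)=zg(z)+f(w)\frac{s_\gamma(z)}{s_\gamma(w)}.$$ $\mathcal{B}_{+2}^{(\pi/2)}$ is $\operatorname{dom}(S_{\pi/2})$ with inner product $\langle f,g\rangle_{+2}:=\langle S_{\pi/2}f,S_{\pi/2}g\rangle+\langle f,g\rangle$; $\mathcal{B}_{-2}^{(\pi/2)}$ is its dual, realized as the completion of $\mathcal{B}$ under the norm of $\langle f,g\rangle_{-2}:=\langle f,(S_{\pi/2}^2+I)^{-1}g\rangle$. For $w\notin\operatorname{spec}(S_{\pi/2})$, $R_{\pi/2}(w):=(S_{\pi/2}-wI)^{-1}$ has a unique bounded extension $\hat{R}_{\pi/2}(w):\mathcal{B}_{-2}^{(\pi/2)}\to\mathcal{B}$. The pairing $\langle\cdot,\cdot\rangle_2:\mathcal{B}_{-2}^{(\pi/2)}\times\mathcal{B}_{+2}^{(\pi/2)}\to\mathbb{C}$ is $\langle\varphi,g\rangle_2=\langle\hat{R}_{\pi/2}(-i)\varphi,(S_{\pi/2}-iI)g\rangle$,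 which extends the inner product of $\mathcal{B}$. $\mathcal{F}_{+1}$ is $\operatorname{dom}(S^* )$ with the graph inner product $\langle S^*f,S^*g\rangle+\langle f,g\rangle$; its dual $\mathcal{F}_{-1}$ is the completion of $\mathcal{B}$ in the dual norm, and $\langle\cdot,\cdot\rangle_{\mathcal{F}}:\mathcal{F}_{-1}\times\mathcal{F}_{+1}\to\mathbb{C}$ is the continuous extension of the inner product of $\mathcal{B}$, with $\langle f,\phi\rangle_{\mathcal{F}}:=\overline{\langle\phi,f\rangle_{\mathcal{F}}}$ for $f\in\mathcal{F}_{+1},\phi\in\mathcal{F}_{-1}$. The map sending $\psi\in\mathcal{F}_{-1}$ to $f(z)=\langle k(\cdot,z),\psi\rangle_{\mathcal{F}}$ is a bijection onto $\operatorname{assoc}\mathcal{B}$, by which $\mathcal{F}_{-1}$ and $\operatorname{assoc}\mathcal{B}$ are identified. An element $f\in\operatorname{assoc}\mathcal{B}$ (in particular $s_0$), corresponding to $\psi\in\mathcal{F}_{-1}$, is regarded as the element of $\mathcal{B}_{-2}^{(\pi/2)}$ given by $\langle f,h\rangle_2:=\langle\psi,h\rangle_{\mathcal{F}}$, $h\in\operatorname{dom}(S_{\pi/2})$. *)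

(* Defs.v *)
From HB Require Import structures.
From mathcomp Require Import all_boot all_order all_algebra.
From mathcomp Require Import all_classical all_reals all_analysis.
From mathcomp Require Import complex.

Set Implicit Arguments.
Unset Strict Implicit.
Unset Printing Implicit Defensive.

Import Order.TTheory GRing.Theory Num.Theory.
Import numFieldNormedType.Exports.

Local Open Scope classical_set_scope.
Local Open Scope ring_scope.
Local Open Scope complex_scope.

(* R[i] is a normed module over itself only through the alias ^o. *)
Notation CC R := (R[i]^o).

Section EntireFunctions.
Variable R : realType.
Implicit Types (f g e F : CC R -> CC R) (z : CC R).

Definition entire f := forall z, derivable f z 1.

Definition sharp f : CC R -> CC R := fun z => (f z^*)^*.

Definition complex_integral (h : R -> CC R) : CC R :=
  (\int[lebesgue_measure]_x complex.Re (h x)) +i*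
  (\int[lebesgue_measure]_x complex.Im (h x)).

(* The Hardy space H^2 of the upper half plane. *)
Definition hardy2 F :=
  (forall z, 0 < complex.Im z -> derivable F z 1) /\
  exists M : R, forall y : R, 0 < y ->
    (\int[lebesgue_measure]_x ((complex.Re `|F (x +i* y)| ^+ 2)%:E) <= M%:E)%E.

Definition hermite_biehler e :=
  entire e /\ forall z, 0 < complex.Im z -> `|e z^*| < `|e z|.

(* The space B(e): membership, then inner product. *)
Definition in_deBranges e f :=
  [/\ entire f, hardy2 (fun z => f z / e z) & hardy2 (fun z => sharp f z / e z)].

Definition ip_deBranges e f g : CC R :=
  complex_integral (fun x => (f x%:C)^* * g x%:C / `|e x%:C| ^+ 2).

Definition s_fun e (gamma : R) : CC R -> CC R := fun z =>
  'i%C / 2 * ((cos gamma +i* sin gamma) * e z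
            - (cos gamma -i* sin gamma) * sharp e z).

End EntireFunctions.

(* A de Branges space: a Hilbert space [dB_space] whose vectors are identified,
   through the injective evaluation map [dB_ev], with entire functions.
   The inner product is conjugate linear in its left argument. *)
Record dBSpace (R : realType) := DBSpace {
  dB_space :> completeNormedModType R[i];
  dB_ip : dB_space -> dB_space -> CC R;
  dB_ip_linear : forall f, linear (dB_ip f);
  dB_ip_conj : forall f g, dB_ip g f = (dB_ip f g)^*;
  dB_ip_norm : forall f, dB_ip f f = `|f| ^+ 2;
  dB_ev : dB_space -> CC R -> CC R;
  dB_ev_linear : forall (a : R[i]) f g z,
    dB_ev (a *: f + g) z = a * dB_ev f z + dB_ev g z;
  dB_ev_inj : injective dB_ev;
  dB_ev_entire : forall f, entire (dB_ev f);
  dB_kernel : CC R -> dB_space;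
  dB_reproducing : forall f w, dB_ev f w = dB_ip (dB_kernel w) f;
  dB_sharp : forall f, exists g, dB_ev g = sharp (dB_ev f) /\ `|g| = `|f|;
  (* g is entire, so its value at the removable singularity w is determined. *)
  dB_move_zero : forall f w, complex.Im w != 0 -> dB_ev f w = 0 ->
    exists g, (forall z, z != w ->
                 dB_ev g z = (z - w^*) / (z - w) * dB_ev f z) /\ `|g| = `|f|
}.

Definition isometric_to_deBranges (R : realType) (B : dBSpace R)
    (e : CC R -> CC R) :=
  range (@dB_ev R B) = [set f | in_deBranges e f] /\
  forall f g : B, dB_ip f g = ip_deBranges e (dB_ev f) (dB_ev g).

(* Operators in B are represented by their graphs; the domain of A is A.`1. *)
Section Operators.
Variables (R : realType) (B : dBSpace R).
Implicit Types (A : set (B * B)) (f g h : B) (w : CC R).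

(* The value A f, for f in the domain of A (and 0 elsewhere). *)
Definition app A f : B := xget 0 [set g | A (f, g)].

Definition adjoint A : set (B * B) :=
  [set p | forall q, A q -> dB_ip p.1 q.2 = dB_ip p.2 q.1].

(* (A - w I)^-1 *)
Definition resolvent A w : B -> B :=
  app [set p | A (p.2, p.1 + w *: p.2)].

(* (A^2 + I)^-1 *)
Definition inv_sqr_add1 A : B -> B :=
  app [set p | exists g, A (p.2, g) /\ A (g, p.1 - p.2)].

Definition mul_op : set (B * B) :=
  [set p | forall z, dB_ev p.2 z = z * dB_ev p.1 z].

(* The canonical selfadjoint extension S_gamma, defined at the base point w.
   The elements of B are entire, so the value of p.1 at w is determined by the
   values at the other points. *)
Definition can_ext (e : CC R -> CC R) w (gamma : R) : set (B * B) :=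
  [set p | exists f,
    (forall z, z != w ->
       dB_ev p.1 z =
       (dB_ev f z - s_fun e gamma z / s_fun e gamma w * dB_ev f w) / (z - w)) /\
    (forall z,
       dB_ev p.2 z =
       z * dB_ev p.1 z + dB_ev f w * (s_fun e gamma z / s_fun e gamma w))].

(* V is a realization, through j, of the completion of B under the norm N. *)
Definition is_completion (N : B -> R[i]) (V : completeNormedModType R[i])
    (j : B -> V) :=
  [/\ linear j, forall f, `|j f| = N f & dense (range j)].

Section Minus2.
Variables (A : set (B * B)) (V : completeNormedModType R[i]) (j : B -> V).

Definition norm_m2 f : R[i] := sqrtC (dB_ip f (inv_sqr_add1 A f)).

(* The bounded extension of (A - w I)^-1 to the completion V; it is unique
   because range j is dense. *)
Definition resolvent_hat w : V -> B :=
  xget (fun=> 0) [set T : V -> B | [/\ linear T, continuous T &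
    forall f, T (j f) = resolvent A w f]].

Definition pairing2 (phi : V) g : CC R :=
  dB_ip (resolvent_hat (- 'i%C) phi) (app A g - 'i%C *: g).

End Minus2.

Definition S_adj := adjoint mul_op.

Definition ip_F1 f g : CC R :=
  dB_ip (app S_adj f) (app S_adj g) + dB_ip f g.

(* The dual norm: the norm of <f, .> as a functional on F_{+1}. *)
Definition norm_Fm1 f : R[i] :=
  (sup [set complex.Re `|dB_ip f h| | h in
          [set h | S_adj.`1 h /\ ip_F1 h h <= 1]])%:C.

Section Assoc.
Variables (V1 : completeNormedModType R[i]) (j1 : B -> V1).

(* The continuous extension of the inner product to F_{-1} x F_{+1}: for each h
   in dom(S^* ), the unique continuous map on F_{-1} that extends <., h>. *)
Definition pairingF (psi : V1) h : CC R :=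
  xget (fun=> 0) [set T : V1 -> CC R | continuous T /\
    forall f, T (j1 f) = dB_ip f h] psi.

(* The element psi of F_{-1} identified with an associated function f, where
   f(z) = <k(.,z), psi>_F = conj <psi, k(.,z)>_F. *)
Definition assoc_elt (f : CC R -> CC R) : V1 :=
  xget 0 [set psi | forall z, f z = (pairingF psi (dB_kernel B z))^*].

Variables (A : set (B * B)) (V2 : completeNormedModType R[i]) (j2 : B -> V2).

(* An associated function regarded as an element of B_{-2}. *)
Definition assoc_m2 (f : CC R -> CC R) : V2 :=
  xget 0 [set phi | forall h, A.`1 h ->
    pairing2 A j2 phi h = pairingF (assoc_elt f) h].

End Assoc.
End Operators.

(* Main.v *)
Require Import Defs.
From HB Require Import structures.
From mathcomp Require Import all_boot all_order all_algebra.
From mathcomp Require Import all_classical all_reals all_analysis.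
From mathcomp Require Import measurable_realfun complex ring lra.

Set Implicit Arguments.
Unset Strict Implicit.
Unset Printing Implicit Defensive.

Import Order.TTheory GRing.Theory Num.Theory.
Import numFieldNormedType.Exports.

Local Open Scope classical_set_scope.
Local Open Scope ring_scope.
Local Open Scope complex_scope.

(** Write [a] for [s_fun e (pi / 2)] and [s] for [s_fun e 0]: both are real on the
real line, and [s_gamma = cos gamma * s + sin gamma * a].

The domain of each canonical extension has a description without base point:
[g] belongs to the domain of [S_gamma] exactly when some [k] in [B] satisfies
[k(z) - z g(z) = d s_gamma(z)] for a constant [d] ([can_extP]).  The vector
[m = S_(pi/2) R(-i) R^(i) s] of the theorem satisfies an equation of the same
kind, [m'(z) - z m(z) = rho a(z) - s(z)] with [rho = Re (s(i) / a(i))]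
([deficiency_eq]), and when [h'(z) - z h(z) = c a(z)], that is, [h] is in the
domain of [S_(pi/2)], the pairing of [s] with [h] is [- pi c] ([pairing2_s]).  So
for [g = h + b m] and [k = h' + b m'] one has [k - z g = (c + b rho) a - b s],
which is a multiple of [s_gamma] exactly when [c + b rho = - b tan gamma]; this
is the boundary condition.

Both facts about [s] follow from the explicit reproducing kernel
    [pi (z - conj w) k_w(z) = a(z) conj (s(w)) - s(z) conj (a(w))]
([kernel_formula]).  It shows that the resolvent of [S_(pi/2)] maps kernels to
combinations of two kernels ([S_pihalf_kernel]), whence [S_(pi/2)] is symmetric
([S_pihalf_sym]), and lies between multiplication by [z] and the adjoint of this
multiplication.  The dual norm and the minus-two norm both dominate the norm of
[R(-i) f], so [R(-i)] extends to the two completions, and testing against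
kernels gives the image of [s]: it is [- (pi / conj (a(i))) k_i]
([pairingF_s_resolvent], [resolvent_hat_s]).  Applying resolvents to [k_i] and
[k_(-i)] then gives [m] ([app_resolvent_s]).  That [s] has a counterpart in the
dual space at all is seen from [s = u + z v] with [u], [v] combinations of [k_i]
and [k_(-i)] ([s_sin_assoc], [pairingF_adjoint_ex]).

The kernel formula is a statement of complex analysis.  With
[theta = sharp e / e], bounded by 1 on the upper half plane, the function [K_w]
that solves the formula lies in B(e) because difference quotients of [theta] are
again holomorphic and decay like [1 / z] ([theta_taylor], [kernel_aux]).  It
reproduces because the integral of [conj (K_w) f / |e|^2] over the real line is a
combination of the Cauchy integral of [f / e] at [w], a multiple of
[f(w) / e(w)], and of the conjugate of the Cauchy integral of [sharp f / e] at
[conj w], which vanishes ([hardy_cauchy], [hardy_cauchy_lower], [deBranges_kernel]).  These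
Cauchy formulas for the Hardy space come from Cauchy's theorem on rectangles
([goursat_except]): a bound for the integrals over horizontal lines makes it
possible to choose the vertical sides with a small contribution
([exists_good_side]), and the decay of the integrals over high lines removes
the upper side ([boundary_cint_eq0]). *)

(** * Moduli and complex differentiability *)

Notation nm := ComplexField.Normc.normc.

Section Modulus.
Variable R : realType.
Local Notation Re z := (@complex.Re (Real.sort R) z).
Local Notation Im z := (@complex.Im (Real.sort R) z).
Implicit Types (z u v : CC R) (G : CC R -> CC R).

Lemma normE z : `|z| = (nm z)%:C. Proof. by []. Qed.

Lemma nm_ge0 z : 0 <= nm z. Proof. by case: z => a b; exact: sqrtr_ge0. Qed.

Lemma nm0 : nm (0 : CC R) = 0. Proof. exact: Normc.normc0. Qed.

Lemma nmM u v : nm (u * v) = nm u * nm v. Proof. exact: Normc.normcM. Qed.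

Lemma nmV u : nm u^-1 = (nm u)^-1. Proof. exact: Normc.normcV. Qed.

Lemma nmN u : nm (- u) = nm u. Proof. exact: normcN. Qed.

Lemma nmD u v : nm (u + v) <= nm u + nm v. Proof. exact: le_normcD. Qed.

Lemma nmB u v : nm (u - v) <= nm u + nm v.
Proof. by rewrite -(nmN v); exact: nmD. Qed.

Lemma nmBC u v : nm (u - v) = nm (v - u).
Proof. by rewrite -nmN opprB. Qed.

Lemma nm_dist u v : `|nm u - nm v| <= nm (u - v).
Proof.
rewrite ler_norml; apply/andP; split.
  by rewrite lerNl opprB lerBlDr nmBC; have := nmD (v - u) u; rewrite subrK.
by rewrite lerBlDr; have := nmD (u - v) v; rewrite subrK.
Qed.

Lemma nmJ z : nm z^* = nm z.
Proof. by case: z => a b /=; rewrite sqrrN. Qed.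

Lemma nm_eq0 z : (nm z == 0) = (z == 0).
Proof.
apply/eqP/eqP => [|->]; last exact: nm0.
exact: Normc.eq0_normc.
Qed.

Lemma nm_gt0 z : (0 < nm z) = (z != 0).
Proof. by rewrite lt_def nm_ge0 andbT nm_eq0. Qed.

Lemma nm_real (x : R) : nm x%:C = `|x|.
Proof. by rewrite /= expr0n addr0 sqrtr_sqr. Qed.

Lemma nm_sqr z : nm z ^+ 2 = Re z ^+ 2 + Im z ^+ 2.
Proof. by case: z => a b /=; rewrite sqr_sqrtr // addr_ge0 // sqr_ge0. Qed.

Lemma nmi : nm ('i : CC R) = 1.
Proof. by rewrite /= expr0n add0r expr1n sqrtr1. Qed.

Lemma Re_nm z : `|Re z| <= nm z.
Proof.
rewrite -(@ler_pXn2r _ 2) ?nnegrE ?nm_ge0 // nm_sqr real_normK ?num_real //.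
by rewrite lerDl sqr_ge0.
Qed.

Lemma Im_nm z : `|Im z| <= nm z.
Proof.
rewrite -(@ler_pXn2r _ 2) ?nnegrE ?nm_ge0 // nm_sqr real_normK ?num_real //.
by rewrite lerDr sqr_ge0.
Qed.

Lemma nm_ReIm z : nm z <= `|Re z| + `|Im z|.
Proof.
rewrite -(@ler_pXn2r _ 2) ?nnegrE ?nm_ge0 ?addr_ge0 // nm_sqr.
rewrite sqrrD !real_normK ?num_real //.
by rewrite -addrA (addrC (_ *+ 2)) addrA lerDl mulrn_wge0 // mulr_ge0.
Qed.

Lemma cReB u v : Re (u - v) = Re u - Re v.
Proof. by case: u v => [a b] [c d]. Qed.
Lemma cImB u v : Im (u - v) = Im u - Im v.
Proof. by case: u v => [a b] [c d]. Qed.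
Lemma cReD u v : Re (u + v) = Re u + Re v.
Proof. by case: u v => [a b] [c d]. Qed.
Lemma cImD u v : Im (u + v) = Im u + Im v.
Proof. by case: u v => [a b] [c d]. Qed.
Lemma cReM u v : Re (u * v) =
  Re u * Re v - Im u * Im v.
Proof. by case: u v => [a b] [c d]. Qed.
Lemma cImM u v : Im (u * v) =
  Re u * Im v + Im u * Re v.
Proof. by case: u v => [a b] [c d]. Qed.

(** Conjugation appears in two convertible forms, [Num.conj] and [conjc], according
to the scope of the surrounding term; the rules below are for [conjc]. *)
Lemma numconjE z : @Num.conj R[i] z = conjc z. Proof. by []. Qed.
Lemma cconjK z : conjc (conjc z) = z. Proof. exact: conjcK. Qed.
Lemma cconjM u v : conjc (u * v) = conjc u * conjc v. Proof. exact: rmorphM. Qed.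
Lemma cconjB u v : conjc (u - v) = conjc u - conjc v. Proof. exact: rmorphB. Qed.
Lemma cconjD u v : conjc (u + v) = conjc u + conjc v. Proof. exact: rmorphD. Qed.
Lemma cconjN u : conjc (- u) = - conjc u. Proof. exact: rmorphN. Qed.
Lemma cconjV u : conjc (u^-1) = (conjc u)^-1. Proof. exact: fmorphV. Qed.

Lemma nbhs_nm z (P : set (CC R)) :
  (\forall u \near z, P u) <->
  exists2 d : R, 0 < d & forall u, nm (u - z) < d -> P u.
Proof.
split=> [/nbhs_ballP [[d d'] /=]|[d d0 dP]].
  rewrite ltcE /= => /andP[/eqP -> d0 dP].
  exists d => // u ud; apply: dP; rewrite /ball /= distrC normE.
  by rewrite ltcR.
apply/nbhs_ballP; exists d%:C; rewrite /= ?ltcR // => u.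
by rewrite /ball /= distrC normE ltcR; exact: dP.
Qed.

Lemma continuous_nmP G z : {for z, continuous G} <->
  (forall eps : R, 0 < eps -> exists2 d : R, 0 < d &
     forall u, nm (u - z) < d -> nm (G u - G z) < eps).
Proof.
split=> [cG eps e0|H A].
  have /nbhs_nm[d d0 dP] : nbhs z (G @^-1` [set v | nm (v - G z) < eps]).
    by apply: cG; apply/nbhs_nm; exists eps.
  by exists d.
move=> /nbhs_nm[eps e0 eA]; apply/nbhs_nm.
by have [d d0 dP] := H _ e0; exists d => // u /dP /eA.
Qed.

(** The derivative in epsilon-delta form: it can be checked by estimates and, unlike
the difference quotient, does not exclude the base point. *)
Definition cderiv G z (l : CC R) := forall eps : R, 0 < eps ->
  exists2 d : R, 0 < d & forall u, nm (u - z) < d ->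
    nm (G u - G z - l * (u - z)) <= eps * nm (u - z).

Lemma derivable_cderiv G z : derivable G z 1 <-> exists l, cderiv G z l.
Proof.
split=> [dG|[l dG]].
  exists ('D_1 G z) => eps e0.
  have /cvgrPdist_lt/(_ eps%:C) := dG; rewrite ltcR => /(_ e0).
  rewrite /dnbhs /within /= => /nbhs_nm[d d0 dP]; exists d => // u ud.
  have [->|uz] := eqVneq u z; first by rewrite !subrr mulr0 subrr nm0 mulr0.
  have uz0 : u - z != 0 by rewrite subr_eq0.
  have := dP (u - z); rewrite subr0 => /(_ ud uz0) /ltW.
  rewrite normE lecR => H.
  have -> : G u - G z - 'D_1 G z * (u - z) =
    - (u - z) * ('D_1 G z - (u - z)^-1 * (G u - G z)).
    by move: ('D_1 G z : CC R) (G u - G z : CC R) (u - z : CC R) uz0 => a b c c0; field.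
  rewrite nmM nmN mulrC ler_wpM2r ?nm_ge0 //; apply: le_trans H.
  suff -> : G u = (G \o shift z) ((u - z) *: 1) by [].
  by rewrite /= -[_ *: _]/((u - z) * 1) mulr1 subrK.
apply/cvg_ex; exists l; apply/cvgrPdist_le => -[e e'].
rewrite ltcE /= => /andP[/eqP -> e0].
have [d d0 dP] := dG _ e0.
apply/nbhs_nm; exists d => // h; rewrite subr0 => hd h0.
have := dP (z + h); rewrite (addrC z) addrK => /(_ hd).
rewrite normE lecR => H.
have -> : l - h^-1 *: ((G \o shift z) (h *: 1) - G z) =
   - (h^-1 * (G (h + z) - G z - l * h)).
  rewrite /= -[h *: 1]/(h * 1) mulr1 -[X in l - X]/(h^-1 * _).
  by move: (G (h + z) - G z : CC R) (h : CC R) h0 => b c c0; field.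
by rewrite nmN nmM nmV mulrC ler_pdivrMr // nm_gt0.
Qed.

Lemma cderiv_continuous G z l : cderiv G z l -> {for z, continuous G}.
Proof.
move=> dG; apply/continuous_nmP => eps e0.
have [d d0 dP] := dG 1 ltr01.
have l0 : 0 < 1 + nm l by rewrite ltr_pwDl // nm_ge0.
exists (Num.min d (eps / (1 + nm l))) => [|u].
  by rewrite lt_min d0 divr_gt0.
rewrite lt_min => /andP[/dP ud]; rewrite ltr_pdivlMr // => ue.
apply: le_lt_trans ue.
rewrite -[G u - G z](subrK (l * (u - z))) (le_trans (nmD _ _)) //.
rewrite nmM (mulrDr (nm (u - z))) mulr1 (mulrC (nm l)) lerD2r.
by rewrite -[leRHS]mul1r.
Qed.

Lemma derivable_ccontinuous G z : derivable G z 1 -> {for z, continuous G}.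
Proof. by move=> /derivable_cderiv[l /cderiv_continuous]. Qed.

Lemma derivable_sharp G z : derivable G z^* 1 -> derivable (sharp G) z 1.
Proof.
move=> /derivable_cderiv[l dG]; apply/derivable_cderiv; exists l^* => eps e0.
have [d d0 dP] := dG _ e0; exists d => // u ud.
have ud' : nm (u^* - z^*) < d by rewrite -rmorphB nmJ.
have := dP _ ud'; rewrite -rmorphB nmJ => H; apply: le_trans H.
by rewrite /sharp -nmJ !(rmorphB, rmorphM) /= !conjcK.
Qed.

End Modulus.

(** * Integrals of complex functions of a real variable *)

Section ComplexIntegral.
Variable R : realType.
Local Notation Re z := (@complex.Re (Real.sort R) z).
Local Notation Im z := (@complex.Im (Real.sort R) z).
Local Notation mu := (@lebesgue_measure R).
Local Notation measR D := (measurable (D : set (measurableTypeR R))).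
Implicit Types (h k : R -> CC R) (D : set R) (a b c d t x y : R).

Definition cintegrable D h :=
  mu.-integrable D (EFin \o (fun x => Re (h x))) /\
  mu.-integrable D (EFin \o (fun x => Im (h x))).

(** Integrals are taken separately over real and imaginary parts, as in
[complex_integral], but over an arbitrary domain. *)
Definition cint D h : CC R :=
  (\int[mu]_(x in D) Re (h x)) +i* (\int[mu]_(x in D) Im (h x)).

Lemma complex_integralE h : complex_integral h = cint setT h.
Proof. by []. Qed.

Lemma integrableDf D (f g : R -> R) : measR D ->
  mu.-integrable D (EFin \o f) -> mu.-integrable D (EFin \o g) ->
  mu.-integrable D (EFin \o (fun x => f x + g x)).
Proof.
by move=> mD fi gi; apply: eq_integrable (integrableD mD fi gi).
Qed.

Lemma integrableZf D (f : R -> R) r : measR D ->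
  mu.-integrable D (EFin \o f) -> mu.-integrable D (EFin \o (fun x => r * f x)).
Proof. by move=> mD fi; apply: eq_integrable (integrableZl mD r fi). Qed.

Lemma cintegrableD D h k : measR D -> cintegrable D h -> cintegrable D k ->
  cintegrable D (fun x => h x + k x).
Proof.
move=> mD [h1 h2] [k1 k2]; split.
- apply: eq_integrable (integrableDf mD h1 k1) => // x _ /=.
  by rewrite cReD.
- apply: eq_integrable (integrableDf mD h2 k2) => // x _ /=.
  by rewrite cImD.
Qed.

Lemma cintegrableZ D h (r : CC R) : measR D -> cintegrable D h ->
  cintegrable D (fun x => r * h x).
Proof.
move=> mD [h1 h2]; split.
- apply: eq_integrable (integrableDf mD (integrableZf (Re r) mD h1)
    (integrableZf (- Im r) mD h2)) => // x _ /=.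
  by rewrite cReM mulNr.
- apply: eq_integrable (integrableDf mD (integrableZf (Re r) mD h2)
    (integrableZf (Im r) mD h1)) => // x _ /=.
  by rewrite cImM.
Qed.

Lemma cintD D h k : measR D -> cintegrable D h -> cintegrable D k ->
  cint D (fun x => h x + k x) = cint D h + cint D k.
Proof.
move=> mD [h1 h2] [k1 k2]; apply/eqP; rewrite eq_complex /=; apply/andP; split.
- rewrite -RintegralD //; apply/eqP/eq_Rintegral => x _ /=; exact: cReD.
- rewrite -RintegralD //; apply/eqP/eq_Rintegral => x _ /=; exact: cImD.
Qed.

Lemma cintZ D h (r : CC R) : measR D -> cintegrable D h ->
  cint D (fun x => r * h x) = r * cint D h.
Proof.
move=> mD [h1 h2]; apply/eqP; rewrite eq_complex cReM cImM /=.
apply/andP; split.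
- rewrite -!RintegralZl // -RintegralB //; try exact: integrableZf.
  by apply/eqP/eq_Rintegral => x _ /=; exact: cReM.
- rewrite -!RintegralZl // -RintegralD //; try exact: integrableZf.
  by apply/eqP/eq_Rintegral => x _ /=; exact: cImM.
Qed.

Lemma cintegrableN D h : measR D -> cintegrable D h ->
  cintegrable D (fun x => - h x).
Proof.
move=> mD /(cintegrableZ (-1) mD); congr cintegrable.
by apply/funext => x; rewrite mulN1r.
Qed.

Lemma cintN D h : measR D -> cintegrable D h ->
  cint D (fun x => - h x) = - cint D h.
Proof.
move=> mD ih; rewrite -[RHS]mulN1r -cintZ //; congr cint.
by apply/funext => x; rewrite mulN1r.
Qed.

Lemma cintegrableB D h k : measR D -> cintegrable D h -> cintegrable D k ->
  cintegrable D (fun x => h x - k x).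
Proof. by move=> mD ih ik; apply: cintegrableD => //; exact: cintegrableN. Qed.

Lemma cintB D h k : measR D -> cintegrable D h -> cintegrable D k ->
  cint D (fun x => h x - k x) = cint D h - cint D k.
Proof.
by move=> mD ih ik; rewrite cintD // ?cintN //; exact: cintegrableN.
Qed.

Lemma cint_conj D h : measR D -> cintegrable D h ->
  cint D (fun x => (h x)^*) = (cint D h)^*.
Proof.
move=> mD [h1 h2]; apply/eqP; rewrite eq_complex /=; apply/andP; split.
  by apply/eqP/eq_Rintegral => x _; case: (h x).
rewrite -mulN1r -RintegralZl //; apply/eqP/eq_Rintegral => x _.
by rewrite mulN1r; case: (h x).
Qed.

Lemma eq_cint D h k : (forall x, D x -> h x = k x) -> cint D h = cint D k.
Proof.
move=> hk; apply/eqP; rewrite eq_complex /=; apply/andP; split;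
  by apply/eqP/eq_Rintegral => x; rewrite inE => /hk ->.
Qed.

Lemma eq_cintegrable D h k : measR D -> (forall x, D x -> h x = k x) ->
  cintegrable D h -> cintegrable D k.
Proof.
move=> mD hk [h1 h2]; split.
- by apply: eq_integrable h1 => // x; rewrite inE /= => /hk ->.
- by apply: eq_integrable h2 => // x; rewrite inE /= => /hk ->.
Qed.

(** The factor 2 bounds a modulus by the sum of the moduli of the real and
imaginary parts. *)
Lemma cint_le D h (g : R -> R) : measR D -> cintegrable D h ->
  mu.-integrable D (EFin \o g) -> (forall x, D x -> nm (h x) <= g x) ->
  nm (cint D h) <= 2 * \int[mu]_(x in D) g x.
Proof.
move=> mD [h1 h2] gi hg; apply: le_trans (nm_ReIm _) _ => /=.
rewrite mulr2n mulrDl mul1r lerD //.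
- apply: le_trans (le_normr_Rintegral mD h1) _.
  apply: le_Rintegral => //; first exact: (integrable_norm h1).
  by move=> x Dx; exact: le_trans (Re_nm _) (hg _ Dx).
- apply: le_trans (le_normr_Rintegral mD h2) _.
  apply: le_Rintegral => //; first exact: (integrable_norm h2).
  by move=> x Dx; exact: le_trans (Im_nm _) (hg _ Dx).
Qed.

Lemma measurable_itvcc a b : measR `[a, b]%classic.
Proof. exact: measurable_itv. Qed.

Lemma Rintegral_itv_cst a b r : a <= b ->
  \int[mu]_(x in `[a, b]) r = r * (b - a).
Proof.
move=> ab; rewrite Rintegral_cst //= lebesgue_measure_itv /= lte_fin.
case: ltP => [//|ba]; rewrite (_ : b - a = 0) //.
by apply/eqP; rewrite subr_eq0 eq_le ba.
Qed.

Lemma integrable_itv_cst a b r :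
  mu.-integrable `[a, b] (EFin \o (fun=> r : R)).
Proof.
apply: continuous_compact_integrable; first exact: segment_compact.
by apply: continuous_subspaceT => x; exact: cst_continuous.
Qed.

Lemma cintegrable_itv_cst a b (r : CC R) : cintegrable `[a, b] (fun=> r).
Proof. by split; exact: integrable_itv_cst. Qed.

Lemma cint_itv_cst a b (r : CC R) : a <= b ->
  cint `[a, b] (fun=> r) = r * (b - a)%:C.
Proof.
move=> ab; rewrite /cint !Rintegral_itv_cst //; case: r => u v /=.
by apply/eqP; rewrite eq_complex cReM cImM /=; apply/andP; split;
  apply/eqP; ring.
Qed.

Lemma cint_itv_le a b h r : a <= b -> cintegrable `[a, b] h ->
  (forall x, a <= x <= b -> nm (h x) <= r) ->
  nm (cint `[a, b] h) <= 2 * (r * (b - a)).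
Proof.
move=> ab ih hr; rewrite -Rintegral_itv_cst //.
apply: cint_le; [exact: measurable_itvcc|by []|exact: integrable_itv_cst|].
by move=> x /=; rewrite in_itv; exact: hr.
Qed.

Lemma Rintegral_itv_split (f : R -> R) a b c : a <= b -> b <= c ->
  mu.-integrable `[a, c] (EFin \o f) ->
  \int[mu]_(x in `[a, c]) f x =
  \int[mu]_(x in `[a, b]) f x + \int[mu]_(x in `[b, c]) f x.
Proof.
move=> ab bc fi; apply/eqP; rewrite addrC -subr_eq; apply/eqP.
have := @Rintegral_itvB R f (BLeft a) (BRight c) b fi.
rewrite bnd_simp => /(_ ab); rewrite bnd_simp => /(_ bc) ->.
rewrite -Rintegral_itv_obnd_cbnd //.
apply: integrableS fi => //.
by move=> x /=; rewrite !in_itv /= => /andP[/ltW bx ->]; rewrite (le_trans ab).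
Qed.

Lemma cint_itv_split h a b c : a <= b -> b <= c -> cintegrable `[a, c] h ->
  cint `[a, c] h = cint `[a, b] h + cint `[b, c] h.
Proof.
move=> ab bc [h1 h2]; apply/eqP; rewrite eq_complex /=.
by rewrite (Rintegral_itv_split ab bc h1) (Rintegral_itv_split ab bc h2) !eqxx.
Qed.

(** Continuity of a function of a real variable; complex values form a normed space
over the complex numbers only, so real and imaginary parts are continuous in the
usual sense. *)
Definition lcont h t := forall eps : R, 0 < eps -> exists2 del : R, 0 < del &
  forall u, `|u - t| < del -> nm (h u - h t) < eps.

Lemma lcont_Re h t : lcont h t -> {for t, continuous (fun x => Re (h x))}.
Proof.
move=> H; apply/cvgrPdist_lt => eps e0; have [d d0 dP] := H _ e0.
exists d => //= u /=; rewrite distrC => /dP; apply: le_lt_trans.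
by rewrite distrC -cReB Re_nm.
Qed.

Lemma lcont_Im h t : lcont h t -> {for t, continuous (fun x => Im (h x))}.
Proof.
move=> H; apply/cvgrPdist_lt => eps e0; have [d d0 dP] := H _ e0.
exists d => //= u /=; rewrite distrC => /dP; apply: le_lt_trans.
by rewrite distrC -cImB Im_nm.
Qed.

Lemma lcont_nm h t : lcont h t -> {for t, continuous (fun x => nm (h x))}.
Proof.
move=> H; apply/cvgrPdist_lt => eps e0; have [d d0 dP] := H _ e0.
exists d => //= u /=; rewrite distrC => /dP; apply: le_lt_trans.
by rewrite distrC nm_dist.
Qed.

Lemma lcontinuous_integrable h a b : (forall t, a <= t <= b -> lcont h t) ->
  cintegrable `[a, b] h.
Proof.
move=> H; split; apply: continuous_compact_integrable;
  try exact: segment_compact; apply: continuous_in_subspaceT => x;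
  rewrite inE /= in_itv /= => /H.
- exact: lcont_Re.
- exact: lcont_Im.
Qed.

Lemma lcont_line (G : CC R -> CC R) (l : R -> CC R) t :
  (forall u v, nm (l u - l v) = `|u - v|) ->
  {for l t, continuous G} -> lcont (fun x => G (l x)) t.
Proof.
move=> hl /continuous_nmP H eps e0; have [d d0 dP] := H _ e0.
by exists d => // u ud; apply: dP; rewrite hl.
Qed.

Lemma nm_hline y u v : nm ((u +i* y) - (v +i* y) : CC R) = `|u - v|.
Proof.
rewrite (_ : _ - _ = (u - v)%:C) ?nm_real //.
by apply/eqP; rewrite eq_complex /= subrr !eqxx.
Qed.

Lemma nm_vline x u v : nm ((x +i* u) - (x +i* v) : CC R) = `|u - v|.
Proof.
rewrite (_ : _ - _ = 'i * (u - v)%:C) ?nmM ?nmi ?mul1r ?nm_real //.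
by apply/eqP; rewrite eq_complex /= subrr; apply/andP; split; apply/eqP; ring.
Qed.

End ComplexIntegral.

(** * Cauchy's theorem on rectangles *)

Lemma nested_intervals (R : realType) (A B : nat -> R) :
  (forall n, A n <= A n.+1) -> (forall n, B n.+1 <= B n) ->
  (forall n, A n <= B n) -> exists x, forall n, A n <= x <= B n.
Proof.
move=> Au Bd AB.
have Am : {homo A : m n / (m <= n)%N >-> m <= n} by apply/nondecreasing_seqP.
have Bm : {homo B : m n / (m <= n)%N >-> n <= m} by apply/nonincreasing_seqP.
have ABmn m n : A m <= B n.
  apply: le_trans (Am _ _ (leq_maxl m n)) _.
  exact: le_trans (AB _) (Bm _ _ (leq_maxr m n)).
exists (sup (range A)) => n; apply/andP; split.
  by apply: ub_le_sup; [exists (B 0%N) => _ [m _ <-]|exists n].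
by apply: ge_sup; [exists (A 0%N); exists 0%N|move=> _ [m _ <-]].
Qed.

Section Goursat.
Variable R : realType.
Local Notation Re z := (@complex.Re (Real.sort R) z).
Local Notation Im z := (@complex.Im (Real.sort R) z).
Local Notation mu := (@lebesgue_measure R).
Local Notation measR D := (measurable (D : set (measurableTypeR R))).
Variable G : CC R -> CC R.
Implicit Types (a b c d t x y : R).

Definition rect a b c d : set (CC R) :=
  [set z | a <= Re z <= b /\ c <= Im z <= d].

Definition hgap c d x : CC R := G (x +i* c) - G (x +i* d).
Definition vgap a b y : CC R := G (b +i* y) - G (a +i* y).

(** The contour integral of [G] around the rectangle, with horizontal sides paired and
vertical sides paired. *)
Definition rect_int a b c d : CC R :=
  cint `[a, b] (hgap c d) + 'i * cint `[c, d] (vgap a b).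

Definition cont_on (D : set (CC R)) := forall z, D z -> {for z, continuous G}.

Lemma cont_onS (D E : set (CC R)) : E `<=` D -> cont_on D -> cont_on E.
Proof. by move=> ED H z /ED /H. Qed.

Lemma cintegrable_hline a b c d y : c <= y <= d -> cont_on (rect a b c d) ->
  cintegrable `[a, b] (fun x => G (x +i* y)).
Proof.
move=> cy cG; apply: lcontinuous_integrable => t tab.
by apply: (@lcont_line _ G (fun x => x +i* y) _ (nm_hline _)); apply: cG.
Qed.

Lemma cintegrable_vline a b c d x : a <= x <= b -> cont_on (rect a b c d) ->
  cintegrable `[c, d] (fun y => G (x +i* y)).
Proof.
move=> ax cG; apply: lcontinuous_integrable => t tab.
by apply: (@lcont_line _ G (fun y => x +i* y) _ (nm_vline _)); apply: cG.
Qed.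

Lemma cintegrable_hgap a b c d y y' : c <= y <= d -> c <= y' <= d ->
  cont_on (rect a b c d) -> cintegrable `[a, b] (hgap y y').
Proof.
by move=> cy cy' cG; apply: cintegrableB => //; exact: (@cintegrable_hline a b c d).
Qed.

Lemma cintegrable_vgap a b c d x x' : a <= x <= b -> a <= x' <= b ->
  cont_on (rect a b c d) -> cintegrable `[c, d] (vgap x x').
Proof.
by move=> cy cy' cG; apply: cintegrableB => //; exact: (@cintegrable_vline a b c d).
Qed.

Lemma rect_int_splitx a m b c d : a <= m -> m <= b -> c <= d ->
  cont_on (rect a b c d) ->
  rect_int a b c d = rect_int a m c d + rect_int m b c d.
Proof.
move=> am mb cd cG; have ab := le_trans am mb.
rewrite /rect_int (cint_itv_split am mb); last first.
  by apply: (@cintegrable_hgap a b c d) => //; rewrite lexx ?cd.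
have -> : cint `[c, d] (vgap a b) =
    cint `[c, d] (vgap a m) + cint `[c, d] (vgap m b).
  rewrite -cintD //; try apply: (@cintegrable_vgap a b c d) => //;
    rewrite ?lexx ?am ?mb ?ab //.
  by apply: eq_cint => y _; rewrite /vgap [RHS]addrC addrA subrK.
by rewrite mulrDr addrACA.
Qed.

Lemma rect_int_splity a b c m d : c <= m -> m <= d -> a <= b ->
  cont_on (rect a b c d) ->
  rect_int a b c d = rect_int a b c m + rect_int a b m d.
Proof.
move=> cm md ab cG; have cd := le_trans cm md.
rewrite /rect_int (cint_itv_split cm md); last first.
  by apply: (@cintegrable_vgap a b c d) => //; rewrite lexx ?ab.
have -> : cint `[a, b] (hgap c d) =
    cint `[a, b] (hgap c m) + cint `[a, b] (hgap m d).
  rewrite -cintD //; try apply: (@cintegrable_hgap a b c d) => //;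
    rewrite ?lexx ?cm ?md ?cd //.
  by apply: eq_cint => y _; rewrite /hgap addrA subrK.
by rewrite mulrDr addrACA.
Qed.

(** An affine function has a vanishing integral around a rectangle, so only
the deviation of [G] from its linear approximation contributes. *)
Lemma rect_int_near_affine a b c d p q l (eps L : R) : a <= b -> c <= d ->
  cont_on (rect a b c d) ->
  b - a <= L -> d - c <= L -> 0 <= eps ->
  (forall z, rect a b c d z -> nm (G z - q - l * (z - p)) <= eps) ->
  nm (rect_int a b c d) <= 8 * eps * L.
Proof.
move=> ab cd cG bL dL e0 Ge.
have L0 : 0 <= L by apply: le_trans bL; rewrite subr_ge0.
pose r z := G z - q - l * (z - p).
have hh x : hgap c d x = (r (x +i* c) - r (x +i* d)) + l * ('i * (c - d)%:C).
  rewrite /r /hgap.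
  have -> : 'i * (c - d)%:C = (x +i* c) - (x +i* d) :> CC R.
    by apply/eqP; rewrite eq_complex /= subrr; apply/andP; split; apply/eqP; ring.
  by ring.
have vv y : vgap a b y = (r (b +i* y) - r (a +i* y)) + l * (b - a)%:C.
  rewrite /r /vgap.
  have -> : (b - a)%:C = (b +i* y) - (a +i* y) :> CC R.
    by apply/eqP; rewrite eq_complex /= subrr !eqxx.
  by ring.
have ih : cintegrable `[a, b] (fun x => r (x +i* c) - r (x +i* d)).
  apply: (@eq_cintegrable _ _ (fun x => hgap c d x - l * ('i * (c - d)%:C))) => //.
    by move=> x _; rewrite hh addrK.
  apply: cintegrableB => //; last exact: cintegrable_itv_cst.
  by apply: (@cintegrable_hgap a b c d) => //; rewrite lexx ?cd.
have iv : cintegrable `[c, d] (fun y => r (b +i* y) - r (a +i* y)).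
  apply: (@eq_cintegrable _ _ (fun y => vgap a b y - l * (b - a)%:C)) => //.
    by move=> x _; rewrite vv addrK.
  apply: cintegrableB => //; last exact: cintegrable_itv_cst.
  by apply: (@cintegrable_vgap a b c d) => //; rewrite lexx ?ab.
rewrite /rect_int (eq_cint (fun x _ => hh x)) (eq_cint (fun x _ => vv x)).
rewrite (cintD (measurable_itvcc _ _) ih (cintegrable_itv_cst _ _ _)).
rewrite (cintD (measurable_itvcc _ _) iv (cintegrable_itv_cst _ _ _)).
rewrite !cint_itv_cst //.
set A := cint _ _; set B := cint _ _.
have -> : A + l * ('i * (c - d)%:C) * (b - a)%:C +
    'i * (B + l * (b - a)%:C * (d - c)%:C) = A + 'i * B :> CC R.
  by rewrite -(opprB d c) rmorphN /=; ring.
have rb x : a <= x <= b -> nm (r (x +i* c) - r (x +i* d)) <= 2 * eps.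
  move=> xab; apply: le_trans (nmB _ _) _; rewrite mulr2n mulrDl mul1r.
  by apply: lerD; apply: Ge; rewrite /rect /= lexx cd.
have rc y : c <= y <= d -> nm (r (b +i* y) - r (a +i* y)) <= 2 * eps.
  move=> xab; apply: le_trans (nmB _ _) _; rewrite mulr2n mulrDl mul1r.
  by apply: lerD; apply: Ge; rewrite /rect /= lexx ab.
apply: le_trans (nmD _ _) _; rewrite nmM nmi mul1r.
apply: le_trans (lerD (cint_itv_le ab ih rb) (cint_itv_le cd iv rc)) _.
have e1 : eps * (b - a) <= eps * L by rewrite ler_wpM2l.
have e2 : eps * (d - c) <= eps * L by rewrite ler_wpM2l.
rewrite -!mulrA; lra.
Qed.

(** The integrals around the four quarters add up to the integral around the
rectangle, so they cannot all be smaller than a quarter of it. *)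
Lemma rect_int_quarter a b c d : a <= b -> c <= d -> cont_on (rect a b c d) ->
  exists a' b' c' d', [/\ a <= a' <= b', b' <= b, c <= c' <= d', d' <= d &
    [/\ b' - a' = (b - a) / 2, d' - c' = (d - c) / 2 &
        nm (rect_int a b c d) <= 4 * nm (rect_int a' b' c' d')]].
Proof.
move=> ab cd cG; pose m := (a + b) / 2; pose n := (c + d) / 2.
have am : a <= m by rewrite /m; lra.
have mb : m <= b by rewrite /m; lra.
have cn : c <= n by rewrite /n; lra.
have nd : n <= d by rewrite /n; lra.
have E : rect_int a b c d =
   (rect_int a m c n + rect_int m b c n) + (rect_int a m n d + rect_int m b n d).
  rewrite (rect_int_splity cn nd) // (rect_int_splitx am mb) //; last first.
    apply: cont_onS cG => z [/andP[? ?] /andP[? ?]]; split; apply/andP; split=> //.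
    exact: le_trans nd.
  rewrite (rect_int_splitx am mb) //.
  apply: cont_onS cG => z [/andP[? ?] /andP[? ?]]; split; apply/andP; split=> //.
  exact: le_trans cn _.
have [ma bm] : m - a = (b - a) / 2 /\ b - m = (b - a) / 2.
  by rewrite /m; clear; split; lra.
have [nc dn] : n - c = (d - c) / 2 /\ d - n = (d - c) / 2.
  by rewrite /n; clear; split; lra.
have [h1|h1] := leP (nm (rect_int a b c d)) (4 * nm (rect_int a m c n)).
  by exists a, m, c, n; rewrite lexx am mb lexx cn nd.
have [h2|h2] := leP (nm (rect_int a b c d)) (4 * nm (rect_int m b c n)).
  by exists m, b, c, n; rewrite lexx am mb lexx cn nd.
have [h3|h3] := leP (nm (rect_int a b c d)) (4 * nm (rect_int a m n d)).
  by exists a, m, n, d; rewrite lexx am mb lexx cn nd.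
have [h4|h4] := leP (nm (rect_int a b c d)) (4 * nm (rect_int m b n d)).
  by exists m, b, n, d; rewrite lexx am mb lexx cn nd.
have small (x q1 q2 q3 q4 u v : R) : 4 * q1 < x -> 4 * q2 < x -> 4 * q3 < x ->
    4 * q4 < x -> x <= u + v -> u <= q1 + q2 -> v <= q3 + q4 -> False.
  by clear; lra.
have H := nmD (rect_int a m c n + rect_int m b c n)
  (rect_int a m n d + rect_int m b n d); rewrite -E in H.
exfalso; exact: (small _ _ _ _ _ _ _ h1 h2 h3 h4 H (nmD _ _) (nmD _ _)).
Qed.

(** Goursat's bisection: the quarters shrink to a point, near which [G] is
affine up to an error of smaller order than the size of the quarter. *)
Theorem goursat a b c d : a <= b -> c <= d ->
  (forall z, rect a b c d z -> derivable G z 1) -> rect_int a b c d = 0.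
Proof.
move=> ab cd dG.
have cG : cont_on (rect a b c d) by move=> z /dG /derivable_ccontinuous.
pose Q := (R * R * R * R)%type.
pose ok (q : Q) := let: (u, v, s, t) := q in
  [/\ a <= u, u <= v, v <= b, c <= s & s <= t /\ t <= d].
pose step (q q' : Q) := let: (u, v, s, t) := q in let: (u', v', s', t') := q' in
  ok q -> [/\ ok q', u <= u' /\ v' <= v, s <= s' /\ t' <= t &
    [/\ v' - u' = (v - u) / 2, t' - s' = (t - s) / 2 &
        nm (rect_int u v s t) <= 4 * nm (rect_int u' v' s' t')]].
have [F HF] : {F : Q -> Q & forall q, step q (F q)}.
  apply: choice => -[[[u v] s] t].
  have [okq|nok] := pselect (ok (u, v, s, t)); last by exists (u, v, s, t).
  have [au uv vb cs [st td]] := okq.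
  have [|u' [v' [s' [t' [/andP[uu u'v'] v'v /andP[ss s't'] t't [h1 h2 h3]]]]]] :=
    rect_int_quarter uv st.
    apply: cont_onS cG => z [/andP[? ?] /andP[? ?]]; split; apply/andP; split.
    - exact: le_trans au _.
    - exact: le_trans vb.
    - exact: le_trans cs _.
    - exact: le_trans td.
  exists (u', v', s', t') => _; split=> //; split=> //.
  - exact: le_trans au _.
  - exact: le_trans v'v vb.
  - exact: le_trans cs _.
  - by split=> //; exact: le_trans t't td.
pose q n := iter n F (a, b, c, d).
have okq n : ok (q n).
  elim: n => [|n IH]; first by split.
  have := HF (q n); rewrite /q iterS -/(q n); move: IH.
  by case: (q n) => [[[u v] s] t]; case: (F _) => [[[u' v'] s'] t'] IH /(_ IH)[].
pose A n := (q n).1.1.1; pose B n := (q n).1.1.2.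
pose C n := (q n).1.2; pose D n := (q n).2.
have okn n : [/\ a <= A n, A n <= B n, B n <= b, c <= C n & C n <= D n /\ D n <= d].
  by have := okq n; rewrite /A /B /C /D; case: (q n) => [[[u v] s] t].
have stepn n : [/\ A n <= A n.+1 /\ B n.+1 <= B n,
    C n <= C n.+1 /\ D n.+1 <= D n &
    [/\ B n.+1 - A n.+1 = (B n - A n) / 2, D n.+1 - C n.+1 = (D n - C n) / 2 &
    nm (rect_int (A n) (B n) (C n) (D n)) <=
    4 * nm (rect_int (A n.+1) (B n.+1) (C n.+1) (D n.+1))]].
  have qS : q n.+1 = F (q n) by [].
  have := HF (q n); have := okq n; rewrite /A /B /C /D qS.
  by case: (q n) => [[[u v] s] t]; case: (F _) => [[[u' v'] s'] t'] IH /(_ IH)[].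
have [x0 Hx] : exists x, forall n, A n <= x <= B n.
  by apply: nested_intervals => n; have [] := stepn n; have [] := okn n => // ? ? ? ? ? [].
have [y0 Hy] : exists x, forall n, C n <= x <= D n.
  by apply: nested_intervals => n; have [] := stepn n; have [] := okn n => // ? ? ? ? [? ?] ? [].
pose L := (b - a) + (d - c).
have L0 : 0 <= L by rewrite /L; lra.
have BA n : B n - A n = (b - a) / 2 ^+ n.
  elim: n => [|n IH]; first by rewrite expr0 divr1.
  by have [_ _ [-> _ _]] := stepn n; rewrite IH exprSr invfM mulrA.
have DC n : D n - C n = (d - c) / 2 ^+ n.
  elim: n => [|n IH]; first by rewrite expr0 divr1.
  by have [_ _ [_ -> _]] := stepn n; rewrite IH exprSr invfM mulrA.
have P4 n : nm (rect_int a b c d) <= 4 ^+ n * nm (rect_int (A n) (B n) (C n) (D n)).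
  elim: n => [|n IH]; first by rewrite expr0 mul1r.
  apply: le_trans IH _; rewrite exprSr -mulrA ler_wpM2l ?exprn_ge0 //.
  by have [_ _ []] := stepn n.
have rz0 : rect a b c d (x0 +i* y0) by have := Hx 0%N; have := Hy 0%N.
have [l dl] := (derivable_cderiv G (x0 +i* y0)).1 (dG _ rz0).
apply/eqP; rewrite -nm_eq0 eq_le nm_ge0 andbT.
apply/ler_addgt0Pr => eps e0; rewrite add0r.
(* at step n the sum of the side lengths is L / 2 ^ n, so the linear approximation
   has error eps' * L / 2 ^ n on the rectangle and the integral is at most
   8 * eps' * (L / 2 ^ n) ^ 2; the factor 4 ^ n cancels *)
have e1 : 0 < eps / (8 * (1 + L ^+ 2)).
  by rewrite divr_gt0 // mulr_gt0 // ltr_pwDl // sqr_ge0.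
have [del d0 dP] := dl _ e1.
have [n nP] : exists n, L / 2 ^+ n < del.
  have L1 : 0 < L + 1 by lra.
  have := @cvg_geometric R (L + 1) 2^-1.
  rewrite ger0_norm ?invr_ge0 // invf_lt1 // ltr1n => /(_ isT).
  move=> /cvgrPdist_lt/(_ _ d0)[n _ /(_ n (leqnn n))].
  rewrite /geometric /= sub0r normrN exprVn => H; exists n.
  apply: le_lt_trans H; apply: le_trans (ler_norm _).
  by rewrite ler_wpM2r ?invr_ge0 ?exprn_ge0 // lerDl.
have p2 : 0 < 2 ^+ n :> R by rewrite exprn_gt0.
have [aA AB Bb cC [CD Dd]] := okn n.
have sub : rect (A n) (B n) (C n) (D n) `<=` rect a b c d.
  move=> z [/andP[z1 z2] /andP[z3 z4]]; split; apply/andP; split.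
  - exact: le_trans aA z1.
  - exact: le_trans z2 Bb.
  - exact: le_trans cC z3.
  - exact: le_trans z4 Dd.
have dist z : rect (A n) (B n) (C n) (D n) z -> nm (z - (x0 +i* y0)) <= L / 2 ^+ n.
  move=> [/andP[z1 z2] /andP[z3 z4]]; apply: le_trans (nm_ReIm _) _.
  rewrite cReB cImB /= /L mulrDl -BA -DC.
  have /andP[? ?] := Hx n; have /andP[? ?] := Hy n.
  by apply: lerD; rewrite ler_norml; apply/andP; split; lra.
have Ln0 : 0 <= L / 2 ^+ n by rewrite divr_ge0 // ltW.
have Hn : nm (rect_int (A n) (B n) (C n) (D n)) <=
    8 * (eps / (8 * (1 + L ^+ 2)) * (L / 2 ^+ n)) * (L / 2 ^+ n).
  apply: (@rect_int_near_affine _ _ _ _ (x0 +i* y0) (G (x0 +i* y0)) l) => //.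
  - exact: cont_onS sub cG.
  - by rewrite BA ler_wpM2r ?invr_ge0 ?(ltW p2) // /L; lra.
  - by rewrite DC ler_wpM2r ?invr_ge0 ?(ltW p2) // /L; lra.
  - by rewrite mulr_ge0 // ltW.
  - move=> z rz; apply: le_trans (dP _ _) _.
      exact: le_lt_trans (dist _ rz) nP.
    by rewrite ler_wpM2l ?(ltW e1) // dist.
apply: le_trans (P4 n) _.
apply: le_trans (ler_wpM2l _ Hn) _; first by rewrite exprn_ge0.
have -> : 4 ^+ n = 2 ^+ n * 2 ^+ n :> R by rewrite -exprMn; congr (_ ^+ n); lra.
have -> : 2 ^+ n * 2 ^+ n *
  (8 * (eps / (8 * (1 + L ^+ 2)) * (L / 2 ^+ n)) * (L / 2 ^+ n)) =
  eps * (L ^+ 2 / (1 + L ^+ 2)).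
  by field; rewrite ?gt_eqF // ltr_pwDl // sqr_ge0.
rewrite -[leRHS]mulr1 ler_wpM2l ?(ltW e0) // ler_pdivrMr ?mul1r ?lerDr //.
by rewrite ltr_pwDl // sqr_ge0.
Qed.

(** A continuous exceptional point is harmless: it can be enclosed in
arbitrarily small squares, on which the integral is small. *)
Lemma goursat_except a b c d p : a < Re p < b -> c < Im p < d ->
  {for p, continuous G} ->
  (forall z, rect a b c d z -> z != p -> derivable G z 1) ->
  rect_int a b c d = 0.
Proof.
move=> /andP[ap pb] /andP[cp pd] Gp dG.
have cG : cont_on (rect a b c d).
  move=> z rz; have [->//|zp] := eqVneq z p.
  exact: derivable_ccontinuous (dG _ rz zp).
apply/eqP; rewrite -nm_eq0 eq_le nm_ge0 andbT.
apply/ler_addgt0Pr => eps e0; rewrite add0r.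
have [del d0 dP] := (continuous_nmP G p).1 Gp 1 ltr01.
(* the square with centre p and half-side r fits into the rectangle and into the disc
   where [G] differs from [G p] by less than 1 *)
pose r := Num.min (del / 4) (Num.min (eps / 16) (Num.min
  (Num.min (Re p - a) (b - Re p)) (Num.min (Im p - c) (d - Im p)))).
have r0 : 0 < r by rewrite !lt_min !divr_gt0 //= !subr_gt0 ap pb cp pd.
have : r <= r by [].
rewrite {2}/r !le_min => /and3P[rd re /andP[/andP[ra rb] /andP[rc rdd]]].
have [pl pr] : Re p - r <= Re p /\ Re p <= Re p + r by split; lra.
have [ql qr] : Im p - r <= Im p /\ Im p <= Im p + r by split; lra.
have sub a' b' c' d' : a <= a' -> b' <= b -> c <= c' -> d' <= d ->
    rect a' b' c' d' `<=` rect a b c d.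
  move=> ? ? ? ? z [/andP[? ?] /andP[? ?]].
  by split; apply/andP; split; lra.
have G0 a' b' c' d' : a <= a' -> a' <= b' -> b' <= b ->
    c <= c' -> c' <= d' -> d' <= d -> ~ rect a' b' c' d' p ->
    rect_int a' b' c' d' = 0.
  move=> aa ab' bb cc cd' dd np; apply: (goursat ab' cd') => z rz; apply: dG.
    exact: (sub _ _ _ _ aa bb cc dd).
  by apply/eqP => zp; apply: np; rewrite -zp.
rewrite (@rect_int_splitx a (Re p - r)) //; try lra.
rewrite (@G0 a (Re p - r)) ?add0r; try lra; last by move=> [/andP[]]; lra.
rewrite (@rect_int_splitx (Re p - r) (Re p + r)); try lra; last first.
  by apply: cont_onS cG; apply: sub; lra.
rewrite (@G0 (Re p + r) b) ?addr0; try lra; last by move=> [/andP[]]; lra.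
rewrite (@rect_int_splity _ _ c (Im p - r)); try lra; last first.
  by apply: cont_onS cG; apply: sub; lra.
rewrite (@G0 _ _ c (Im p - r)) ?add0r; try lra; last by move=> [? /andP[]]; lra.
rewrite (@rect_int_splity _ _ (Im p - r) (Im p + r)); try lra; last first.
  by apply: cont_onS cG; apply: sub; lra.
rewrite (@G0 _ _ (Im p + r) d) ?addr0; try lra; last by move=> [? /andP[]]; lra.
apply: le_trans (@rect_int_near_affine _ _ _ _ p (G p) 0 1 (2 * r) _ _ _ _ _ _ _) _;
  try lra.
- by apply: cont_onS cG; apply: sub; lra.
- move=> z [/andP[? ?] /andP[? ?]]; rewrite mul0r subr0 ltW // dP //.
  apply: le_lt_trans (nm_ReIm _) _; rewrite cReB cImB.
  have : `|Re z - Re p| <= r by rewrite ler_norml; apply/andP; split; lra.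
  have : `|Im z - Im p| <= r by rewrite ler_norml; apply/andP; split; lra.
  lra.
Qed.

End Goursat.

(** * Integrals along lines of the upper half plane *)

Section JointMeasurability.
Variable R : realType.
Local Notation mu := (@lebesgue_measure R).
Local Notation measR D := (measurable (D : set (measurableTypeR R))).

Definition continuous2 (f : R -> R -> R) := forall x y eps, 0 < eps ->
  exists2 del : R, 0 < del & forall x' y', `|x' - x| < del -> `|y' - y| < del ->
    `|f x' y' - f x y| < eps.

(** The preimage of an open ray is the union of the boxes with rational corners that
it contains, a countable union of measurable rectangles. *)
Lemma continuous2_measurable (f : R -> R -> R) : continuous2 f ->
  measurable_fun [set: measurableTypeR R * measurableTypeR R]
    (fun p => f p.1 p.2 : measurableTypeR R).
Proof.
move=> cf; apply: (measurability _ (RGenOInfty.measurableE R)).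
move=> _ [_ [a ->] <-]; rewrite setTI.
set U := _ @^-1` _.
pose box (q1 q2 q3 q4 : rat) : set (R * R) :=
  [set` `]ratr q1, ratr q2[] `*` [set` `]ratr q3, ratr q4[].
pose V q1 q2 q3 q4 : set (measurableTypeR R * measurableTypeR R) :=
  if `[< box q1 q2 q3 q4 `<=` U >] then box q1 q2 q3 q4 else set0.
have -> : U = \bigcup_q1 \bigcup_q2 \bigcup_q3 \bigcup_q4 V q1 q2 q3 q4.
  apply/seteqP; split; last first.
    move=> p [q1 _ [q2 _ [q3 _ [q4 _]]]]; rewrite /V.
    by case: asboolP => // bU /bU.
  move=> [x y] Uxy; have {}Uxy : a < f x y by move: Uxy; rewrite /U /= in_itv /= andbT.
  have [del d0 dP] := cf x y (f x y - a) ltac:(by rewrite subr_gt0).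
  have xl : x - del < x by rewrite gtrBl.
  have xr : x < x + del by rewrite ltrDl.
  have yl : y - del < y by rewrite gtrBl.
  have yr : y < y + del by rewrite ltrDl.
  have [q1] := rat_in_itvoo xl; have [q2] := rat_in_itvoo xr.
  have [q3] := rat_in_itvoo yl; have [q4] := rat_in_itvoo yr.
  rewrite !in_itv /= => /andP[a1 a2] /andP[a3 a4] /andP[a5 a6] /andP[a7 a8].
  exists q1 => //; exists q2 => //; exists q3 => //; exists q4 => //.
  rewrite /V; case: asboolP => [_|].
    by split => /=; rewrite in_itv /=; apply/andP; split.
  case=> -[x' y'] [/=]; rewrite !in_itv /= => /andP[b1 b2] /andP[b3 b4].
  rewrite /U /= in_itv /= andbT.
  have : `|x' - x| < del by rewrite ltr_norml; apply/andP; split; lra.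
  have : `|y' - y| < del by rewrite ltr_norml; apply/andP; split; lra.
  by move=> hy /dP/(_ hy); rewrite ltr_norml => /andP[]; lra.
do 4 (apply: bigcupT_measurable_rat => ?).
rewrite /V; case: ifP => // _; apply: measurableX; exact: measurable_itv.
Qed.

End JointMeasurability.

Section LineIntegrals.
Variable R : realType.
Local Notation Re z := (@complex.Re (Real.sort R) z).
Local Notation Im z := (@complex.Im (Real.sort R) z).
Local Notation mu := (@lebesgue_measure R).
Local Notation measR D := (measurable (D : set (measurableTypeR R))).
Variable G : CC R -> CC R.
Implicit Types (a b y t eps : R).

Hypothesis cG : forall z, 0 <= Im z -> {for z, continuous G}.

Lemma line_lcont y t : 0 <= y -> lcont (fun x => G (x +i* y)) t.
Proof.
move=> y0; apply: (@lcont_line _ G (fun x => x +i* y) _ (nm_hline _)).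
exact: cG.
Qed.

Lemma vertical_lcont x t : 0 <= t -> lcont (fun y => G (x +i* y)) t.
Proof.
move=> y0; apply: (@lcont_line _ G (fun y => x +i* y) _ (nm_vline _)).
exact: cG.
Qed.

Lemma line_measurable y : 0 <= y ->
  measurable_fun setT (fun x => nm (G (x +i* y)) : measurableTypeR R).
Proof.
move=> y0; apply: continuous_measurable_fun => x.
by apply: lcont_nm; exact: line_lcont.
Qed.

Lemma line_cmeasurable y : 0 <= y ->
  measurable_fun setT (fun x => Re (G (x +i* y)) : measurableTypeR R) /\
  measurable_fun setT (fun x => Im (G (x +i* y)) : measurableTypeR R).
Proof.
move=> y0; split; apply: continuous_measurable_fun => x.
- by apply: lcont_Re; exact: line_lcont.
- by apply: lcont_Im; exact: line_lcont.
Qed.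

Variable M : R.
Hypothesis GM : forall y, 0 < y ->
  (\int[mu]_x (nm (G (x +i* y)))%:E <= M%:E)%E.

(** Fatou's lemma, applied to the lines at height [1 / (n + 1)]. *)
Lemma boundary_integral_le : (\int[mu]_x (nm (G x%:C))%:E <= M%:E)%E.
Proof.
pose f n x : \bar R := (nm (G (x +i* n.+1%:R^-1)))%:E.
have n0 n : 0 < n.+1%:R^-1 :> R by rewrite invr_gt0.
have := @fatou _ _ _ mu setT measurableT f.
have mf n : measurable_fun setT (f n).
  by apply/measurable_EFinP; exact: (line_measurable (ltW (n0 n))).
move=> /(_ mf) /(_ ltac:(by move=> *; rewrite lee_fin nm_ge0)) H.
have E x : limn_einf (f^~ x) = (nm (G x%:C))%:E.
  have cf : f n x @[n --> \oo] --> (nm (G x%:C))%:E.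
    apply/cvg_EFin; first by near=> n.
    apply: (@cvg_comp _ _ _ (fun n => n.+1%:R^-1 : R) (fun y => nm (G (x +i* y)))
      _ (nbhs (0 : R))); first exact: cvg_harmonic.
    exact: (lcont_nm (vertical_lcont x (lexx 0))).
  rewrite is_cvg_limn_einfE; last by apply/cvg_ex; exists (nm (G x%:C))%:E.
  exact/cvg_lim.
have -> : (\int[mu]_x (nm (G x%:C))%:E = \int[mu]_x limn_einf (f^~ x))%E.
  by apply: eq_integral => x _; rewrite E.
apply: le_trans H _.
rewrite limn_einf_lim; apply: lime_le; first exact: is_cvg_einfs.
apply: nearW => n; apply: le_trans (ereal_inf_lbound _) (GM (n0 n)).
by exists n => /=.
Unshelve. all: by end_near.
Qed.

Lemma GM0 y : 0 <= y -> (\int[mu]_x (nm (G (x +i* y)))%:E <= M%:E)%E.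
Proof.
rewrite le_eqVlt => /predU1P[<-|]; last exact: GM.
exact: boundary_integral_le.
Qed.

Lemma line_integrable y : 0 <= y ->
  mu.-integrable setT (EFin \o (fun x => nm (G (x +i* y)))).
Proof.
move=> y0; apply/integrableP; split.
  by apply/measurable_EFinP; exact: line_measurable.
apply: le_lt_trans (ltry M); apply: le_trans (GM0 y0).
rewrite le_eqVlt; apply/orP; left; apply/eqP; apply: eq_integral => x _ /=.
by rewrite ger0_norm // nm_ge0.
Qed.

Lemma line_cintegrable y : 0 <= y -> cintegrable setT (fun x => G (x +i* y)).
Proof.
move=> y0; have [m1 m2] := line_cmeasurable y0; split.
- apply: (@le_integrable _ _ _ mu setT _ _ _ _ _ (line_integrable y0)) => //.
    exact/measurable_EFinP.
  by move=> x _ /=; rewrite lee_fin (ger0_norm (nm_ge0 _)) Re_nm.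
- apply: (@le_integrable _ _ _ mu setT _ _ _ _ _ (line_integrable y0)) => //.
    exact/measurable_EFinP.
  by move=> x _ /=; rewrite lee_fin (ger0_norm (nm_ge0 _)) Im_nm.
Qed.

(** The ordinate is cut off at 0 because [G] is only controlled on the closed upper half
plane, while measurability is wanted on the whole plane. *)
Lemma clamp_continuous2 :
  continuous2 (fun x y => nm (G (x +i* Num.max 0 y))).
Proof.
move=> x y eps e0.
have p0 : 0 <= Im (x +i* Num.max 0 y) by rewrite /= le_max lexx.
have [d d0 dP] := (continuous_nmP _ _).1 (cG p0) _ e0.
have d20 : 0 < d / 2 by rewrite divr_gt0.
exists (d / 2) => // x' y' hx hy; apply: le_lt_trans (nm_dist _ _) _; apply: dP.
apply: le_lt_trans (nm_ReIm _) _; rewrite cReB cImB /=.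
suff : `|Num.max 0 y' - Num.max 0 y| <= `|y' - y| by lra.
have [y0|y0] := leP 0 y; have [y'0|y'0] := leP 0 y'.
- by [].
- by rewrite sub0r normrN ger0_norm // ler0_norm; lra.
- by rewrite subr0 ger0_norm // ger0_norm; lra.
- by rewrite subrr normr0.
Qed.

Local Open Scope ereal_scope.

(** Tonelli's theorem, integrating over horizontal lines first. *)
Lemma strip_integral_le (Y : R) : (0 <= Y)%R ->
  \int[mu]_t \int[mu]_(y in `[0%R, Y]) (nm (G (t +i* y)))%:E <= (M * Y)%:E /\
  measurable_fun [set: measurableTypeR R]
    (fun t => \int[mu]_(y in `[0%R, Y]) (nm (G (t +i* y)))%:E).
Proof.
move=> Y0.
pose I := \1_(`[0%R, Y]%classic : set (measurableTypeR R)) : measurableTypeR R -> R.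
have mI : measurable_fun setT I by exact: measurable_indic.
pose f (p : measurableTypeR R * measurableTypeR R) : \bar R :=
  (nm (G (p.1 +i* Num.max 0 p.2)) * I p.2)%:E.
have mf : measurable_fun setT f.
  apply/measurable_EFinP/measurable_funM.
    exact: (continuous2_measurable clamp_continuous2).
  exact: measurableT_comp mI measurable_snd.
have f0 p : 0%R <= f p.
  by rewrite lee_fin mulr_ge0 ?nm_ge0 // /I indicE ler0n.
have fE t : \int[mu]_y f (t, y) = \int[mu]_(y in `[0%R, Y]) (nm (G (t +i* y)))%:E.
  rewrite [RHS]integral_mkcond; apply: eq_integral => y _.
  rewrite /f /I /= patchE indicE; case: ifPn => [|_]; last by rewrite mulr0.
  by rewrite inE /= in_itv /= => /andP[y0 _]; rewrite mulr1 max_r.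
split; last first.
  apply: eq_measurable_fun (measurable_fun_fubini_tonelli_F (m2 := mu) f mf f0).
  by move=> t _; rewrite /fubini_F fE.
under eq_integral do rewrite -fE.
rewrite (fubini_tonelli (m1 := mu) (m2 := mu) f mf f0).
apply: (@le_trans _ _ (\int[mu]_y (M * I y)%:E)).
  apply: ge0_le_integral => //.
  - by move=> y _; apply: integral_ge0 => x _; exact: f0.
  - exact: (measurable_fun_fubini_tonelli_G (m1 := mu) f mf f0).
  - by apply/measurable_EFinP/measurable_funM.
  move=> y _; rewrite /I indicE; case: (boolP (y \in _)) => [|nI].
    rewrite inE /= in_itv /= => /andP[y0 yY]; rewrite mulr1.
    apply: le_trans (GM0 y0); rewrite le_eqVlt; apply/orP; left; apply/eqP.
    apply: eq_integral => x _; rewrite /f /I /= max_r // indicE mem_set ?mulr1 //=.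
    by rewrite in_itv /= y0.
  rewrite mulr0 le_eqVlt; apply/orP; left; apply/eqP.
  by apply: integral0_eq => x _; rewrite /f /I /= indicE (negbTE nI) mulr0.
rewrite le_eqVlt; apply/orP; left; apply/eqP.
have := @integral_cst _ _ _ mu `[0%R, Y]%classic (measurable_itvcc 0 Y) M%:E.
rewrite /= lebesgue_measure_itv /= lte_fin -EFinB subr0.
have -> : (if (0 < Y)%R then Y%:E else 0%R) = Y%:E.
  by case: ltP => // ?; congr EFin; apply/eqP; rewrite eq_le Y0.
rewrite EFinM => <-; rewrite [RHS]integral_mkcond; apply: eq_integral => y _.
by rewrite /I indicE patchE; case: ifPn; rewrite ?mulr1 ?mulr0.
Qed.

(** Otherwise the integral of [nm G] over the strip above [[a, b]] would exceed
[eps * (b - a)], hence the bound [M * Y] given by horizontal lines. *)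
Lemma exists_good_side (Y eps a b : R) : (0 <= Y)%R -> (0 < eps)%R ->
  (a <= b)%R -> (M * Y < eps * (b - a))%R ->
  exists2 t, (a <= t <= b)%R &
    \int[mu]_(y in `[0%R, Y]) (nm (G (t +i* y)))%:E <= eps%:E.
Proof.
move=> Y0 e0 ab HM; apply: contrapT => noT.
have [I1 mF] := strip_integral_le Y0.
set F := (fun t => _) in mF.
have F0 t : 0 <= F t by apply: integral_ge0 => y _; rewrite lee_fin nm_ge0.
suff : (eps * (b - a))%:E <= (M * Y)%:E by rewrite lee_fin leNgt HM.
apply: le_trans I1; apply: (@le_trans _ _ (\int[mu]_(t in `[a, b]) F t)); last first.
  by apply: ge0_subset_integral => //.
have -> : (eps * (b - a))%:E = \int[mu]_(t in `[a, b]) (cst eps%:E) t.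
  rewrite integral_cst /=; last exact: measurable_itvcc.
  rewrite lebesgue_measure_itv /= lte_fin EFinM EFinB; case: ltP => // ba.
  have -> : b = a by apply/eqP; rewrite eq_le ab ba.
  by rewrite -EFinB subrr.
apply: ge0_le_integral => //.
- by move=> t _; rewrite lee_fin ltW.
- exact: measurable_funTS.
move=> t /=; rewrite in_itv /= => tab; rewrite leNgt; apply/negP => Fe.
by apply: noT; exists t => //; exact: ltW.
Qed.

End LineIntegrals.

(** * Cauchy's theorem on the upper half plane *)

Section Tails.
Variable R : realType.
Local Notation mu := (@lebesgue_measure R).
Local Notation measR D := (measurable (D : set (measurableTypeR R))).
Implicit Types (g : R -> R) (h : R -> CC R).

Lemma itv_large_cvg g : mu.-integrable setT (EFin \o g) -> (forall x, 0 <= g x) ->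
  forall eps : R, 0 < eps -> exists2 N : R, 0 < N &
    \int[mu]_x g x - eps < \int[mu]_(x in `[- N, N]) g x.
Proof.
move=> gi g0 eps e0.
pose F (n : nat) : set (measurableTypeR R) := `[- n%:R, n%:R]%classic.
have mF i : measurable (F i) by exact: measurable_itv.
have [mg _] := integrableP _ _ _ gi.
have H : (\int[mu]_(x in F i) (g x)%:E)%E @[i --> \oo] -->
    (\int[mu]_(x in \bigcup_i F i) (g x)%:E)%E.
  apply: ge0_nondecreasing_set_cvg_integral => //.
  - move=> m n mn; rewrite subsetEset => x; rewrite /F /= !in_itv /= => /andP[xl xr].
    have mn' : m%:R <= n%:R :> R by rewrite ler_nat.
    by rewrite (le_trans xr) // (le_trans _ xl) // lerN2.
  - by move=> i; exact: measurable_funTS.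
  - by move=> i x _; rewrite lee_fin.
have : (\int[mu]_(x in F i) (g x)%:E)%E @[i --> \oo] --> (\int[mu]_x (g x)%:E)%E.
  suff E : \bigcup_i F i = setT by rewrite E in H.
  apply/seteqP; split=> // x _; exists (Num.bound `|x|) => //=.
  by rewrite /F /= in_itv /= -ler_norml ltW // archi_boundP.
have fI : (\int[mu]_x (g x)%:E)%E \is a fin_num by exact: integrable_fin_num.
rewrite -(fineK fI) => /fine_cvgP[_ /cvgrPdist_lt/(_ _ e0)[n _ nP]].
exists n.+1%:R => //; have /= := nP n.+1 (leqnSn n).
rewrite ltr_norml => /andP[_].
by rewrite ltrBlDr -ltrBlDl.
Qed.

Lemma tail_small g : mu.-integrable setT (EFin \o g) -> (forall x, 0 <= g x) ->
  forall eps : R, 0 < eps -> exists2 N : R, 0 < N &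
    forall a b, a <= - N -> N <= b -> \int[mu]_(x in ~` `[a, b]) g x < eps.
Proof.
move=> gi g0 eps e0; have [N N0 HN] := itv_large_cvg gi g0 e0.
exists N => // a b aN Nb.
have mab : measR `[a, b]%classic by exact: measurable_itv.
have mabC : measR (~` `[a, b]%classic) by exact: measurableC.
have giS (D : set R) : measR D -> mu.-integrable D (EFin \o g).
  by move=> mD; apply: integrableS gi.
have E : \int[mu]_x g x = \int[mu]_(x in `[a, b]) g x + \int[mu]_(x in ~` `[a, b]) g x.
  have := @Rintegral_setU _ _ _ mu _ _ g mab mabC; rewrite setUv; apply => //.
  by apply/disj_setPS => x [].
have : \int[mu]_(x in `[- N, N]) g x <= \int[mu]_(x in `[a, b]) g x.
  rewrite /Rintegral fine_le //; try by apply: integrable_fin_num => //; exact: giS.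
  apply: ge0_subset_integral => //.
  - by case/integrableP: (giS _ mab).
  - by move=> x _; rewrite lee_fin.
  move=> x /=; rewrite !in_itv /= => /andP[xl xr].
  by rewrite (le_trans aN xl) (le_trans xr Nb).
move=> Hle; move: E HN Hle.
set I := \int[mu]_x _; set I1 := \int[mu]_(x in _) _.
set I2 := \int[mu]_(x in _) _; set I3 := \int[mu]_(x in _) _.
by move: I I1 I2 I3 => I I1 I2 I3; clear; lra.
Qed.

Lemma cint_tail h (g : R -> R) : cintegrable setT h ->
  mu.-integrable setT (EFin \o g) -> (forall x, nm (h x) <= g x) ->
  forall eps : R, 0 < eps -> exists2 N : R, 0 < N &
    forall a b, a <= - N -> N <= b -> nm (cint setT h - cint `[a, b] h) < eps.
Proof.
move=> hi gi hg eps e0.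
have g0 x : 0 <= g x by apply: le_trans (hg x); exact: nm_ge0.
have e20 : 0 < eps / 2 by rewrite divr_gt0.
have [N N0 HN] := tail_small gi g0 e20; exists N => // a b aN Nb.
have mab : measR `[a, b]%classic by exact: measurable_itv.
have mabC : measR (~` `[a, b]%classic) by exact: measurableC.
have [h1 h2] := hi.
have hiS (D : set R) : measR D -> cintegrable D h.
  by move=> mD; split; [apply: integrableS h1|apply: integrableS h2].
have -> : cint setT h - cint `[a, b] h = cint (~` `[a, b]) h.
  apply/eqP; rewrite subr_eq addrC; apply/eqP.
  have dj : [disjoint `[a, b]%classic & ~` `[a, b]%classic].
    by apply/disj_setPS => x [].
  apply/eqP; rewrite eq_complex /=; apply/andP; split; apply/eqP.
  - have := @Rintegral_setU _ _ _ mu _ _ (fun x => complex.Re (h x)) mab mabC.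
    by rewrite setUv; apply.
  - have := @Rintegral_setU _ _ _ mu _ _ (fun x => complex.Im (h x)) mab mabC.
    by rewrite setUv; apply.
apply: le_lt_trans (cint_le mabC (hiS _ mabC) _ (fun x _ => hg x)) _.
  by apply: integrableS gi.
have := HN _ _ aN Nb; lra.
Qed.

End Tails.

Section HardyContour.
Variable R : realType.
Local Notation Re z := (@complex.Re (Real.sort R) z).
Local Notation Im z := (@complex.Im (Real.sort R) z).
Local Notation mu := (@lebesgue_measure R).
Variables (G : CC R -> CC R) (p : CC R) (M : R).

(** Cauchy's theorem on the upper half plane for functions that are integrable
along horizontal lines.  The vertical sides of the contour are chosen by
Tonelli's theorem, the upper side by the last hypothesis. *)
Theorem boundary_cint_eq0 : 0 < Im p ->
  (forall z, 0 <= Im z -> z != p -> derivable G z 1) -> {for p, continuous G} ->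
  (forall y, 0 < y -> (\int[mu]_x (nm (G (x +i* y)))%:E <= M%:E)%E) ->
  (forall eps, 0 < eps -> exists2 Y, Im p < Y &
     (\int[mu]_x (nm (G (x +i* Y)))%:E <= eps%:E)%E) ->
  cintegrable setT (fun x => G x%:C) /\ cint setT (fun x => G x%:C) = 0.
Proof.
move=> p0 dG Gp GM Gs.
have cG z : 0 <= Im z -> {for z, continuous G}.
  by move=> z0; have [->//|zp] := eqVneq z p; exact: derivable_ccontinuous (dG _ z0 zp).
have M0 : 0 <= M.
  rewrite -lee_fin; apply: le_trans (GM 1 ltr01).
  by apply: integral_ge0 => x _; rewrite lee_fin nm_ge0.
have bi := line_cintegrable cG GM (lexx 0); split; first exact: bi.
apply/eqP; rewrite -nm_eq0 eq_le nm_ge0 andbT.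
apply/ler_addgt0Pr => eps0 e00; rewrite add0r.
(* the upper side contributes at most 2 eps, each vertical side 2 eps and the
   tails of the boundary integral less than eps *)
pose eps := eps0 / 7; have e0 : 0 < eps by rewrite divr_gt0.
have [Y pY HY] := Gs _ e0.
have Y0 : 0 < Y by exact: lt_trans pY.
have [N N0 HN] := cint_tail bi (line_integrable cG GM (lexx 0)) (fun x => lexx _) e0.
pose N' := N + `|Re p| + 1.
pose K := M * Y / eps + 1.
have MY : 0 <= M * Y by rewrite mulr_ge0 // ltW.
have K0 : 0 < K by rewrite /K ltr_pwDr // divr_ge0 // ltW.
have MK : M * Y < eps * K.
  by rewrite /K mulrDr mulr1 mulrCA divff ?mulr1 ?ltrDl // gt_eqF.
have [b /andP[Nb _] Hb] := @exists_good_side _ _ cG _ GM Y eps N' (N' + K)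
  (ltW Y0) e0 ltac:(by rewrite lerDl ltW) ltac:(by rewrite addrC addKr).
have [a /andP[_ aN] Ha] := @exists_good_side _ _ cG _ GM Y eps (- N' - K) (- N')
  (ltW Y0) e0 ltac:(by rewrite gerBl ltW) ltac:(by rewrite opprB addrCA addrN addr0).
have Rp := ler_norm (Re p); have Rp' := ler_norm (- Re p); rewrite normrN in Rp'.
have ab : a <= b by rewrite /N' in Nb aN; lra.
have apb : a < Re p < b by rewrite /N' in Nb aN; apply/andP; split; lra.
have rG z : rect a b 0 Y z -> 0 <= Im z by move=> [_ /andP[]].
have cR : cont_on G (rect a b 0 Y) by move=> z /rG /cG.
have := @goursat_except _ G a b 0 Y p apb ltac:(by rewrite p0 pY) Gp
  (fun z rz zp => dG z (rG z rz) zp).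
rewrite /rect_int.
have ilow : cintegrable `[a, b] (fun x => G (x +i* 0)).
  by apply: (@cintegrable_hline _ G a b 0 Y) => //; rewrite lexx ltW.
have iup : cintegrable `[a, b] (fun x => G (x +i* Y)).
  by apply: (@cintegrable_hline _ G a b 0 Y) => //; rewrite lexx ltW.
have ir : cintegrable `[0, Y] (fun y => G (b +i* y)).
  by apply: (@cintegrable_vline _ G a b 0 Y) => //; rewrite lexx ab.
have il : cintegrable `[0, Y] (fun y => G (a +i* y)).
  by apply: (@cintegrable_vline _ G a b 0 Y) => //; rewrite lexx ab.
rewrite (cintB (measurable_itvcc _ _) ilow iup).
rewrite (cintB (measurable_itvcc _ _) ir il).
set L := cint _ _; set U := cint _ _; set S1 := cint _ _; set S2 := cint _ _.
move=> E.
have EL : L = U - 'i * (S1 - S2).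
  by apply/eqP; rewrite -subr_eq0; apply/eqP; rewrite -[RHS]E; ring.
have nint_le c d (h : R -> CC R) (r : R) : lebesgue_measure.-integrable `[c, d] (EFin \o (fun x => nm (h x))) ->
   cintegrable `[c, d] h ->
   (\int[mu]_(x in `[c, d]) (nm (h x))%:E <= r%:E)%E -> nm (cint `[c, d] h) <= 2 * r.
  move=> i1 i2 i3.
  apply: le_trans (cint_le (measurable_itvcc _ _) i2 i1 (fun x _ => lexx _)) _.
  rewrite ler_wpM2l // -lee_fin /Rintegral fineK //.
  exact: integrable_fin_num.
have HU : nm U <= 2 * eps.
  apply: nint_le => //.
    by apply: integrableS (line_integrable cG GM (ltW Y0)).
  apply: le_trans HY; apply: ge0_subset_integral => //.
    by apply/measurable_EFinP; exact: (line_measurable cG (ltW Y0)).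
  by move=> x _; rewrite lee_fin nm_ge0.
have vi x : lebesgue_measure.-integrable `[0, Y] (EFin \o (fun y => nm (G (x +i* y)))).
  apply: continuous_compact_integrable; first exact: segment_compact.
  apply: continuous_in_subspaceT => y; rewrite inE /= in_itv /= => /andP[y0 _].
  exact: (lcont_nm (vertical_lcont cG x y0)).
have HS1 : nm S1 <= 2 * eps by exact: (nint_le _ _ _ _ (vi b) ir Hb).
have HS2 : nm S2 <= 2 * eps by exact: (nint_le _ _ _ _ (vi a) il Ha).
have HL : nm L <= 6 * eps.
  rewrite EL; apply: le_trans (nmB _ _) _; rewrite nmM nmi mul1r.
  have := nmB S1 S2; lra.
have HT : nm (cint setT (fun x => G x%:C) - L) < eps.
  by apply: HN; rewrite /N' in Nb aN; have := normr_ge0 (Re p); lra.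
have := nmD (cint setT (fun x => G x%:C) - L) L; rewrite subrK.
rewrite /eps in HL HT *; lra.
Qed.

End HardyContour.

(** * A Cauchy theorem with square-integrability *)

Section PoissonKernel.
Variable R : realType.
Local Notation mu := (@lebesgue_measure R).
Implicit Types (u v x t : R).

Lemma integral_oneDsqrV : (\int[mu]_t (oneDsqr t)^-1%:E = (pi : R)%:E)%E.
Proof.
rewrite (@ge0_symfun_integralT _ (fun t => (oneDsqr t)^-1)).
- have -> : [set x : R | 0 <= x] = `[0, +oo[%classic.
    by apply/seteqP; split => x /=; rewrite in_itv /= andbT.
  by rewrite integral0y_oneDsqr -EFinM; congr EFin; field.
- by move=> x; rewrite invr_ge0 (le_trans ler01) // oneDsqr_ge1.
- exact: continuous_oneDsqrV.
- by move=> x; rewrite /= /oneDsqr sqrrN.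
Qed.

(** Up to a factor, the Poisson kernel of the upper half plane: the majorant of all
integrands on lines. *)
Definition pkernel u v x : R := ((x - u) ^+ 2 + v ^+ 2)^-1.

Lemma pkernel_ge0 u v x : 0 <= pkernel u v x.
Proof. by rewrite invr_ge0 addr_ge0 // sqr_ge0. Qed.

Lemma pkernel_denom_gt0 u v x : 0 < v -> 0 < (x - u) ^+ 2 + v ^+ 2.
Proof. by move=> v0; rewrite ltr_wpDl ?sqr_ge0 // exprn_gt0. Qed.

Lemma pkernel_continuous u v : 0 < v -> continuous (pkernel u v).
Proof.
move=> v0 x; apply: cvgV; first by rewrite gt_eqF // pkernel_denom_gt0.
apply: cvgD; last exact: cvg_cst.
apply: (@continuous_comp R R R (fun t => t - u) (fun t => t ^+ 2)).
  by apply: cvgB; [exact: cvg_id|exact: cvg_cst].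
exact: exprn_continuous.
Qed.

Lemma integral_pkernel u v : 0 < v ->
  (\int[mu]_x (pkernel u v x)%:E = (pi / v)%:E)%E.
Proof.
move=> v0.
pose F (x : R^o) : R := (x - u) / v.
have F'E : F^`()%classic = cst v^-1.
  apply/funext => x; rewrite /F derive1E deriveM // deriveD // derive_cst scaler0.
  by rewrite add0r derive_id derive_cst addr0 scaler1.
have vi0 : 0 < v^-1 by rewrite invr_gt0.
have := @increasing_ge0_integration_by_substitutionT R F (fun t => (oneDsqr t)^-1).
rewrite F'E integral_oneDsqrV => H.
have {H} -> : (pi / v)%:E = (v^-1%:E * \int[mu]_x ((((fun t => (oneDsqr t)^-1) \o F) *
     cst v^-1) x)%:E)%E.
  rewrite EFinM muleC -H //.
  - by move=> x y xy; rewrite /F ltr_pM2r // ltrD2r.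
  - by move=> ?; exact: cvg_cst.
  - exact: is_cvg_cst.
  - exact: is_cvg_cst.
  - by apply/gt0_cvgMlNy => //; exact: cvg_addrr_Ny.
  - by apply/gt0_cvgMly => //; exact: cvg_addrr.
  - exact: continuous_oneDsqrV.
rewrite -ge0_integralZl_EFin //; last 3 first.
- by move=> x _; rewrite lee_fin /= mulr_ge0 ?(ltW vi0) // invr_ge0 (le_trans ler01) // oneDsqr_ge1.
- apply/measurable_EFinP; apply: continuous_measurable_fun => x.
  apply: cvgM; last exact: cvg_cst.
  apply: (@continuous_comp R R R F (fun t => (oneDsqr t)^-1)).
    by apply: cvgM; [apply: cvgB; [exact: cvg_id|exact: cvg_cst]|exact: cvg_cst].
  exact: continuous_oneDsqrV.
- by rewrite ltW.
apply: eq_integral => x _ /=; rewrite -EFinM; congr EFin.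
suff -> : pkernel u v x = v^-1 * ((oneDsqr (F x))^-1 * v^-1) by [].
rewrite /pkernel /oneDsqr /F; field.
by rewrite (gt_eqF v0) /= gt_eqF //; have := pkernel_denom_gt0 u x v0; lra.
Qed.

Lemma pkernel_integrable u v : 0 < v ->
  mu.-integrable setT (EFin \o pkernel u v).
Proof.
move=> v0; apply/integrableP; split.
  by apply/measurable_EFinP; apply: continuous_measurable_fun; exact: pkernel_continuous.
under eq_integral do rewrite /= ger0_norm ?pkernel_ge0 //.
by rewrite integral_pkernel // ltry.
Qed.

End PoissonKernel.

Lemma le_pad (R : realType) (a b q : R) : 0 < a -> 0 < b -> q <= a + 1 + q + b.
Proof. lra. Qed.

Section HardyCauchy.
Variable R : realType.
Local Notation Re z := (@complex.Re (Real.sort R) z).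
Local Notation Im z := (@complex.Im (Real.sort R) z).
Local Notation mu := (@lebesgue_measure R).
Implicit Types (z w : CC R).

Lemma near_derivable (f g : CC R -> CC R) z (r : R) : 0 < r ->
  (forall u, nm (u - z) < r -> f u = g u) -> derivable f z 1 -> derivable g z 1.
Proof.
move=> r0 fg /derivable_cderiv[l dl]; apply/derivable_cderiv; exists l => eps e0.
have [d d0 dP] := dl _ e0; exists (Num.min d r) => [|u].
  by rewrite lt_min d0.
rewrite lt_min => /andP[ud ur]; rewrite -!fg ?subrr ?nm0 //; exact: dP.
Qed.

Lemma cIm_conj z : Im z^* = - Im z. Proof. by case: z. Qed.

Lemma Im_gt0_neq z w : Im z != Im w -> z - w != 0.
Proof. by apply: contraNneq => /eqP; rewrite subr_eq0 => /eqP ->. Qed.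

Lemma nm_sub_conj x y w : nm ((x +i* y) - w^* : CC R) ^+ 2 =
  (x - Re w) ^+ 2 + (y + Im w) ^+ 2.
Proof. by rewrite nm_sqr; case: w => a b /=; rewrite opprK. Qed.

Variables (F : CC R -> CC R) (w : CC R) (M : R).
Hypothesis w0 : 0 < Im w.
Hypothesis dF : forall z, 0 <= Im z -> derivable F z 1.
Hypothesis FM : forall y, 0 < y ->
  (\int[mu]_x ((nm (F (x +i* y)) ^+ 2)%:E) <= M%:E)%E.

Let cF z : 0 <= Im z -> {for z, continuous F}.
Proof. by move=> z0; exact: derivable_ccontinuous (dF z0). Qed.

Lemma hardy_bound_ge0 : 0 <= M.
Proof.
rewrite -lee_fin; apply: le_trans (FM ltr01).
by apply: integral_ge0 => x _; rewrite lee_fin sqr_ge0.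
Qed.

Variables (G : CC R -> CC R) (p : CC R) (C : R).
Hypothesis p0 : 0 < Im p.
Hypothesis dG : forall z, 0 <= Im z -> z != p -> derivable G z 1.
Hypothesis Gp : {for p, continuous G}.
Hypothesis C0 : 0 <= C.
Hypothesis GC : forall z, 0 < Im z ->
  nm (G z) <= C * (nm (F z) / nm (z - w^*) + (nm (z - w^*) ^+ 2)^-1).

(** Inequality of arithmetic and geometric means, with a free weight [t] that
is later chosen small on high lines. *)
Lemma weighted_line_le t y : 0 < t -> 0 < y ->
  (\int[mu]_x (nm (G (x +i* y)))%:E <=
   (C * t / 2 * M + C * (t^-1 / 2 + 1) * (pi / (y + Im w)))%:E)%E.
Proof.
move=> t0 y0; have yw : 0 < y + Im w by rewrite addr_gt0.
pose k1 := C * t / 2; pose k2 := C * (t^-1 / 2 + 1).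
have ti0 : 0 < t^-1 by rewrite invr_gt0.
have k10 : 0 <= k1 by rewrite /k1 divr_ge0 // mulr_ge0 // ltW.
have k20 : 0 <= k2 by rewrite /k2 mulr_ge0 // addr_ge0 // divr_ge0 // ltW.
have cG z : 0 <= Im z -> {for z, continuous G}.
  by move=> z0; have [->//|zp] := eqVneq z p; exact: derivable_ccontinuous (dG z0 zp).
have mF : measurable_fun setT (fun x => nm (F (x +i* y)) ^+ 2 : measurableTypeR R).
  by apply: measurable_funX; exact: (line_measurable cF (ltW y0)).
have mk : measurable_fun setT (pkernel (Re w) (y + Im w) : _ -> measurableTypeR R).
  by apply: continuous_measurable_fun; exact: pkernel_continuous.
apply: (@le_trans _ _ (\int[mu]_x (k1%:E * (nm (F (x +i* y)) ^+ 2)%:E +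
    k2%:E * (pkernel (Re w) (y + Im w) x)%:E))%E).
  apply: ge0_le_integral => //.
  - by move=> x _; rewrite lee_fin nm_ge0.
  - by apply/measurable_EFinP; exact: (line_measurable cG (ltW y0)).
  - by apply: emeasurable_funD; apply: measurable_funeM; apply/measurable_EFinP.
  move=> x _; rewrite -!EFinM -EFinD lee_fin.
  have zy : 0 < Im (x +i* y) by [].
  apply: le_trans (GC zy) _.
  have d0 : 0 < nm ((x +i* y) - w^* : CC R).
    by rewrite nm_gt0 Im_gt0_neq // cIm_conj /= gt_eqF //; lra.
  rewrite /k1 /k2 /pkernel -nm_sub_conj.
  set d := nm _ in d0 *; set f := nm _.
  have f0 : 0 <= f by exact: nm_ge0.
  have -> : C * t / 2 * f ^+ 2 + C * (t^-1 / 2 + 1) / d ^+ 2 =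
    C * (f / d + (d ^+ 2)^-1) + C * (t / 2 * (f - (t * d)^-1) ^+ 2).
    by field; rewrite !gt_eqF.
  by rewrite lerDl mulr_ge0 // mulr_ge0 ?sqr_ge0 // divr_ge0 // ltW.
rewrite ge0_integralD //; last 4 first.
- by move=> x _; rewrite -EFinM lee_fin mulr_ge0 // sqr_ge0.
- by apply: measurable_funeM; apply/measurable_EFinP.
- by move=> x _; rewrite -EFinM lee_fin mulr_ge0 // pkernel_ge0.
- by apply: measurable_funeM; apply/measurable_EFinP.
rewrite !ge0_integralZl_EFin //; first last.
- by apply/measurable_EFinP.
- by move=> x _; rewrite lee_fin sqr_ge0.
- by apply/measurable_EFinP.
- by move=> x _; rewrite lee_fin pkernel_ge0.
rewrite integral_pkernel // EFinD; apply: leeD; last by rewrite -EFinM.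
rewrite -/k1 [leRHS]EFinM; apply: (@lee_wpmul2l R k1%:E); first by rewrite lee_fin.
exact: FM.
Qed.

(** The hypothesis on [G] only bounds it by [F(z) / z] and [1 / z^2], and [F] is merely
square-integrable on lines; the weighted mean inequality turns this into bounds
for the integrals over lines that tend to 0 with the height. *)
Lemma weighted_cauchy :
  cintegrable setT (fun x => G x%:C) /\ cint setT (fun x => G x%:C) = 0.
Proof.
have M0 := hardy_bound_ge0.
apply: (@boundary_cint_eq0 _ G p (C / 2 * M + C * (1 / 2 + 1) * (pi / Im w))) => //.
  move=> y y0; apply: le_trans (weighted_line_le ltr01 y0) _.
  rewrite lee_fin invr1 mulr1 lerD2l ler_wpM2l //.
    by rewrite mulr_ge0 // ; lra.
  by rewrite ler_wpM2l ?pi_ge0 // lef_pV2 ?posrE ?addr_gt0 // lerDr ltW.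
move=> eps e0.
(* t makes the first term of the weighted bound small on every line, then Y is
   chosen so large that the second term is small as well *)
pose t := eps / (C * M + 1).
have CM0 : 0 < C * M + 1 by rewrite ltr_wpDl // mulr_ge0.
have t0 : 0 < t by rewrite divr_gt0.
pose K := C * (t^-1 / 2 + 1) * pi.
have K0 : 0 <= K.
  by rewrite /K !mulr_ge0 ?pi_ge0 // addr_ge0 // divr_ge0 // invr_ge0 ltW.
pose Y := Im p + 1 + 2 * K / eps.
have Ke : 0 <= 2 * K / eps by apply: divr_ge0; [exact: mulr_ge0|exact: ltW].
have pY : Im p < Y by rewrite /Y -addrA ltrDl; apply: ltr_wpDr.
have Y0 : 0 < Y by exact: lt_trans pY.
exists Y => //.
apply: le_trans (weighted_line_le t0 Y0) _; rewrite lee_fin.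
have h1 : C * t / 2 * M <= eps / 2.
  rewrite (_ : C * t / 2 * M = eps / 2 * (C * M / (C * M + 1))); last first.
    by rewrite /t; field; rewrite gt_eqF.
  rewrite -[leRHS]mulr1 ler_wpM2l //; first by rewrite divr_ge0 // ltW.
  by rewrite ler_pdivrMr // mul1r lerDl.
have h2 : C * (t^-1 / 2 + 1) * (pi / (Y + Im w)) <= eps / 2.
  have YI : 0 < Y + Im w by exact: (addr_gt0 Y0 w0).
  rewrite mulrA -/K ler_pdivrMr //.
  have : eps / 2 * (2 * K / eps) = K by field; rewrite gt_eqF.
  have : eps / 2 * (2 * K / eps) <= eps / 2 * (Y + Im w).
    rewrite ler_wpM2l ?divr_ge0 ?(ltW e0) // /Y.
    exact: le_pad.
  by move=> h3 h4; rewrite -[leLHS]h4.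
by rewrite [X in _ <= X](splitr eps) lerD.
Qed.

End HardyCauchy.

(** * The Cauchy formulas of the Hardy space *)

Local Opaque derivable.

Section CauchyFormulas.
Variable R : realType.
Local Notation Re z := (@complex.Re (Real.sort R) z).
Local Notation Im z := (@complex.Im (Real.sort R) z).
Local Notation mu := (@lebesgue_measure R).
Implicit Types (z w c : CC R) (f g : CC R -> CC R).

Lemma derivable_subc z c : derivable (fun u : CC R => u - c) z 1.
Proof. by apply: derivableB; [exact: derivable_id|exact: derivable_cst]. Qed.

Lemma derivable_mul f g z : derivable f z 1 -> derivable g z 1 ->
  derivable (fun u => f u * g u) z 1.
Proof. by move=> df dg; exact: (derivableM df dg). Qed.

Lemma derivable_inv f z : f z != 0 -> derivable f z 1 ->
  derivable (fun u => (f u)^-1) z 1.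
Proof. by move=> f0 df; exact: derivableV. Qed.

Lemma derivable_div f g z : g z != 0 -> derivable f z 1 -> derivable g z 1 ->
  derivable (fun u => f u / g u) z 1.
Proof. by move=> g0 df dg; exact: (derivable_mul df (derivable_inv g0 dg)). Qed.

Lemma derivable_sub f g z : derivable f z 1 -> derivable g z 1 ->
  derivable (fun u => f u - g u) z 1.
Proof. by move=> df dg; exact: (derivableB df dg). Qed.

Lemma derivable_scale f z c : derivable f z 1 -> derivable (fun u => c * f u) z 1.
Proof. by move=> df; exact: (derivable_mul (@derivable_cst _ _ _ c z 1) df). Qed.

Lemma derivable_divB f z c : z != c -> derivable f z 1 ->
  derivable (fun u => f u / (u - c)) z 1.
Proof.
rewrite -subr_eq0 => zc df.
exact: (@derivable_div f (fun u => u - c) z zc df (@derivable_subc z c)).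
Qed.

Variables (F : CC R -> CC R) (M : R).
Hypothesis dF : forall z, 0 <= Im z -> derivable F z 1.
Hypothesis FM : forall y, 0 < y ->
  (\int[mu]_x ((nm (F (x +i* y)) ^+ 2)%:E) <= M%:E)%E.

Lemma upper_neq_conj z w : 0 <= Im z -> 0 < Im w -> z != w^*.
Proof.
move=> z0 w0; apply/eqP => zw; move: z0; rewrite zw cIm_conj oppr_ge0.
by rewrite leNgt w0.
Qed.

Lemma hardy_cauchy_lower w : 0 < Im w ->
  cintegrable setT (fun x => F x%:C / (x%:C - w^*)) /\
  cint setT (fun x => F x%:C / (x%:C - w^*)) = 0.
Proof.
move=> w0; have i0 : 0 < Im ('i : CC R) by rewrite /= ltr01.
have dG z : 0 <= Im z -> derivable (fun u => F u / (u - w^*)) z 1.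
  by move=> z0; exact: (derivable_divB (upper_neq_conj z0 w0) (dF z0)).
apply: (@weighted_cauchy _ F w M w0 dF FM (fun u => F u / (u - w^*)) 'i 1 i0).
- by move=> z z0 _; exact: dG.
- by apply: derivable_ccontinuous; apply: dG; exact: ltW.
- exact: ler01.
- by move=> z z0; rewrite nmM nmV mul1r lerDl invr_ge0 sqr_ge0.
Qed.

(** The value at [w] is a parameter: it is the derivative of [N] there in all uses,
which makes the quotient continuous. *)
Definition diffq (N : CC R -> CC R) w (l : CC R) z : CC R :=
  if z == w then l else N z / (z - w).

Lemma diffq_derivable N w l z : z != w -> derivable N z 1 ->
  derivable (diffq N w l) z 1.
Proof.
move=> zw dN; have d0 : 0 < nm (z - w) by rewrite nm_gt0 subr_eq0.
apply: (@near_derivable _ (fun u => N u / (u - w)) _ _ _ d0).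
  move=> u uz; rewrite /diffq; case: eqVneq => // uw.
  by move: uz; rewrite uw nmBC ltxx.
exact: (derivable_divB zw dN).
Qed.

Lemma diffq_continuous N w l : N w = 0 -> cderiv N w l ->
  {for w, continuous (diffq N w l)}.
Proof.
move=> Nw dN; apply/continuous_nmP => eps e0.
have e20 : 0 < eps / 2 by rewrite divr_gt0.
have [d d0 dP] := dN _ e20; exists d => // u ud.
rewrite /diffq eqxx; case: eqVneq => uw; first by rewrite subrr nm0.
have := dP _ ud; rewrite Nw subr0 => H.
have uw0 : u - w != 0 by rewrite subr_eq0.
have -> : N u / (u - w) - l = (N u - l * (u - w)) / (u - w) by field.
rewrite nmM nmV ltr_pdivrMr ?nm_gt0 //; apply: le_lt_trans H _.
by rewrite ltr_pM2r ?nm_gt0 //; lra.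
Qed.

(** Near its pole the completed quotient is bounded, away from it the kernels
[1 / (z - w)] and [1 / (z - w^* )] are comparable. *)
Lemma diffq_bound N w l (A : CC R -> R) (a : R) : 0 < Im w ->
  N w = 0 -> cderiv N w l -> 0 <= a ->
  (forall z, 0 < Im z -> 0 <= A z) ->
  (forall z, 0 < Im z -> nm (N z) <= A z + a / nm (z - w^*)) ->
  exists2 C : R, 0 <= C & forall z, 0 < Im z ->
    nm (diffq N w l z) <= C * (A z / nm (z - w^*) + (nm (z - w^*) ^+ 2)^-1).
Proof.
move=> w0 Nw dN a0 A0 NA; pose v := 2 * Im w.
have v0 : 0 < v by rewrite mulr_gt0.
have [d d0 dP] := dN _ ltr01.
pose b := nm l + 1; have b0 : 0 <= b by rewrite addr_ge0 // nm_ge0.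
pose K := 1 + v / d; have K0 : 0 <= K by rewrite addr_ge0 // divr_ge0 // ltW.
exists (b * (d + v) ^+ 2 + K + K * a) => [|z z0].
  by apply: addr_ge0; [apply: addr_ge0|]; rewrite // mulr_ge0 // sqr_ge0.
have q0 : 0 < nm (z - w^*) by rewrite nm_gt0 subr_eq0; exact: upper_neq_conj (ltW z0) w0.
have qz : nm (z - w^*) <= nm (z - w) + v.
  have -> : z - w^* = (z - w) + (w - w^*) by rewrite addrA subrK.
  apply: le_trans (nmD _ _) _; rewrite lerD2l.
  apply: le_trans (nm_ReIm _) _; rewrite cReB cImB cIm_conj.
  have -> : Re w^* = Re w by case: (w).
  by rewrite subrr normr0 add0r opprK ger0_norm /v; lra.
set q := nm (z - w^*) in q0 qz *.
have Az := A0 _ z0.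
have p1 : 0 <= A z / q by rewrite divr_ge0 // ltW.
have p2 : 0 <= (q ^+ 2)^-1 by rewrite invr_ge0 sqr_ge0.
have s1 : 0 <= b * (d + v) ^+ 2 by rewrite mulr_ge0 // sqr_ge0.
have s2 : 0 <= K * a by rewrite mulr_ge0.
have [zd|zd] := ltP (nm (z - w)) d.
  have H : nm (diffq N w l z) <= b.
    rewrite /diffq; case: eqVneq => zw; first by rewrite /b lerDl.
    have zw0 : 0 < nm (z - w) by rewrite nm_gt0 subr_eq0.
    rewrite nmM nmV ler_pdivrMr //.
    have := dP _ zd; rewrite Nw subr0 mul1r => H.
    rewrite -[N z](subrK (l * (z - w))) (le_trans (nmD _ _)) //.
    by rewrite nmM /b mulrDl mul1r addrC lerD2l.
  have qd : q <= d + v by apply: le_trans qz _; rewrite lerD2r ltW.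
  have : b * q ^+ 2 <= b * (d + v) ^+ 2.
    by rewrite ler_wpM2l // ler_pXn2r // nnegrE ?ltW // addr_gt0.
  rewrite -ler_pdivlMr ?exprn_gt0 // => H2.
  apply: le_trans H (le_trans H2 _).
  set e := (q ^+ 2)^-1 in p2 *; set r := A z / q in p1 *.
  set s := b * (d + v) ^+ 2 in s1 *; set k := K * a in s2 *.
  have : 0 <= (s + K + k) * r by exact: (mulr_ge0 (addr_ge0 (addr_ge0 s1 K0) s2) p1).
  have : 0 <= (K + k) * e by exact: (mulr_ge0 (addr_ge0 K0 s2) p2).
  rewrite mulrDr !mulrDl; lra.
have zw0 : 0 < nm (z - w) by exact: lt_le_trans zd.
have zw : z != w by rewrite -subr_eq0 -nm_gt0.
have qK : q <= K * nm (z - w).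
  apply: le_trans qz _; rewrite /K mulrDl mul1r lerD2l.
  rewrite -[leLHS]mulr1 -mulrA ler_wpM2l ?(ltW v0) //.
  by rewrite mulrC ler_pdivlMr // mul1r.
have zV : (nm (z - w))^-1 <= K / q.
  by rewrite -[leLHS]mul1r ler_pdivrMr // mulrAC ler_pdivlMr // mul1r.
rewrite /diffq (negbTE zw) nmM nmV.
apply: le_trans (ler_pM (nm_ge0 _) _ (NA _ z0) zV) _; first by rewrite invr_ge0 ltW.
rewrite -/q.
have -> : (A z + a / q) * (K / q) = K * (A z / q) + K * a * (q ^+ 2)^-1.
  by field; rewrite gt_eqF.
set e := (q ^+ 2)^-1 in p2 *; set r := A z / q in p1 *.
set s := b * (d + v) ^+ 2 in s1 *; set k := K * a in s2 *.
have : 0 <= (s + k) * r by exact: (mulr_ge0 (addr_ge0 s1 s2) p1).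
have : 0 <= (s + K) * e by exact: (mulr_ge0 (addr_ge0 s1 K0) p2).
rewrite mulrDr !mulrDl; lra.
Qed.

Lemma conj_sub w : w - w^* = 2 * 'i * (Im w)%:C :> CC R.
Proof.
by case: w => a b; apply/eqP; rewrite eq_complex /=; apply/andP; split; apply/eqP; ring.
Qed.

Lemma mul_sub_conj (x : R) w :
  (x%:C - w^*) * (x%:C - w) = ((x - Re w) ^+ 2 + (Im w) ^+ 2)%:C :> CC R.
Proof.
by case: w => a b; apply/eqP; rewrite eq_complex /=; apply/andP; split; apply/eqP; ring.
Qed.

Lemma pkernelC (x : R) w :
  (pkernel (Re w) (Im w) x)%:C = ((x%:C - w^*) * (x%:C - w))^-1 :> CC R.
Proof. by rewrite mul_sub_conj /pkernel fmorphV. Qed.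

Lemma real_sub_neq0 (x : R) w : Im w != 0 -> x%:C - w != 0 :> CC R.
Proof. by move=> w0; apply: Im_gt0_neq; rewrite /= eq_sym. Qed.

Lemma cintegrable_pkernel (u v : R) : 0 < v -> cintegrable setT (fun x => (pkernel u v x)%:C).
Proof.
move=> v0; split; first exact: pkernel_integrable.
exact: (@integrable0 _ _ _ mu setT).
Qed.

Lemma cint_pkernel (u v : R) : 0 < v -> cint setT (fun x => (pkernel u v x)%:C) = (pi / v)%:C.
Proof.
move=> v0; apply/eqP; rewrite eq_complex /=; apply/andP; split; apply/eqP.
  by rewrite /Rintegral integral_pkernel.
by rewrite /Rintegral integral0.
Qed.

(** Subtracting from [F] the multiple of [1 / (z - conj w)] that has the same value at
[w] leaves a zero at [w]; the quotient by [z - w] then falls under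
[weighted_cauchy], and the subtracted term contributes the integral of the
Poisson kernel. *)
Theorem hardy_cauchy w : 0 < Im w ->
  cintegrable setT (fun x => F x%:C / (x%:C - w)) /\
  cint setT (fun x => F x%:C / (x%:C - w)) = 2 * pi%:C * 'i * F w.
Proof.
move=> w0; have w00 : 0 <= Im w by exact: ltW.
pose N z := F z - F w * (w - w^*) / (z - w^*).
have ww : w - w^* != 0 by rewrite subr_eq0; exact: upper_neq_conj.
have Nw : N w = 0 by rewrite /N mulfK // subrr.
have dN z : 0 <= Im z -> derivable N z 1.
  move=> z0; apply: (@derivable_sub F (fun u => F w * (w - w^*) / (u - w^*)) z (dF z0)).
  exact: (derivable_divB (upper_neq_conj z0 w0) (@derivable_cst _ _ _ _ z 1)).
have [l dl] := (derivable_cderiv N w).1 (dN _ w00).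
have a0 : 0 <= nm (F w * (w - w^*)) by exact: nm_ge0.
have [|C C0 HC] := @diffq_bound N w l (fun z => nm (F z))
    (nm (F w * (w - w^*))) w0 Nw dl a0 (fun z _ => nm_ge0 _).
  by move=> z z0; apply: le_trans (nmB _ _) _; rewrite lerD2l nmM nmV.
have [iG cG] := @weighted_cauchy _ F w M w0 dF FM (diffq N w l) w C w0
  (fun z hz hzw => @diffq_derivable N w l z hzw (dN z hz)) (diffq_continuous Nw dl) C0 HC.
pose k := F w * (w - w^*).
pose P x : CC R := k * (pkernel (Re w) (Im w) x)%:C.
have E x : diffq N w l x%:C + P x = F x%:C / (x%:C - w).
  have xw : x%:C - w != 0 by rewrite real_sub_neq0 // gt_eqF.
  have xwc : x%:C - w^* != 0 by rewrite real_sub_neq0 // cIm_conj oppr_eq0 gt_eqF.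
  rewrite /diffq -subr_eq0 (negbTE xw) /P pkernelC /N /k.
  by field; rewrite xw xwc.
have iP : cintegrable setT P by apply: cintegrableZ => //; exact: cintegrable_pkernel.
have mT : measurable (setT : set (measurableTypeR R)) by [].
split.
  apply: eq_cintegrable (cintegrableD mT iG iP) => // x _; exact: E.
rewrite -(eq_cint (fun x _ => E x)) cintD // cG add0r cintZ //; last first.
  exact: cintegrable_pkernel.
rewrite cint_pkernel // /k conj_sub.
have -> : (pi / Im w)%:C = pi%:C / (Im w)%:C :> CC R by rewrite rmorphM fmorphV.
field.
by rewrite (_ : 0 = 0%:C) // (inj_eq (@complexI R)) gt_eqF.
Qed.

End CauchyFormulas.

(** * The inner function of a Hermite-Biehler function *)

Section Dominated.
Variable R : realType.
Local Notation Re z := (@complex.Re (Real.sort R) z).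
Local Notation Im z := (@complex.Im (Real.sort R) z).
Local Notation mu := (@lebesgue_measure R).
Implicit Types (z w c : CC R) (f g F : CC R -> CC R).

Lemma cintegrable_dom (h : R -> CC R) (u v c : R) : 0 < v ->
  (forall t, lcont h t) -> (forall x, nm (h x) <= c * pkernel u v x) ->
  cintegrable setT h.
Proof.
move=> v0 ch hc.
have ik : mu.-integrable setT (EFin \o (fun x => c * pkernel u v x)).
  by apply: integrableZf => //; exact: pkernel_integrable.
split.
- apply: (le_integrable _ _ _ ik) => //.
    by apply/measurable_EFinP; apply: continuous_measurable_fun => t; exact: lcont_Re.
  move=> x _ /=; rewrite lee_fin (le_trans (Re_nm _)) // (le_trans (hc _)) //.
  exact: ler_norm.
- apply: (le_integrable _ _ _ ik) => //.
    by apply/measurable_EFinP; apply: continuous_measurable_fun => t; exact: lcont_Im.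
  move=> x _ /=; rewrite lee_fin (le_trans (Im_nm _)) // (le_trans (hc _)) //.
  exact: ler_norm.
Qed.

Lemma cint_dom (h : R -> CC R) (u v c : R) : 0 < v ->
  cintegrable setT h -> (forall x, nm (h x) <= c * pkernel u v x) ->
  nm (cint setT h) <= 2 * (c * (pi / v)).
Proof.
move=> v0 ih hc.
have ik := pkernel_integrable u v0.
apply: le_trans (cint_le _ ih (integrableZf c _ ik) (fun x _ => hc x)) _ => //.
by rewrite RintegralZl // /Rintegral integral_pkernel.
Qed.

Lemma derivable_sub2 w t : derivable (fun u : CC R => (u - w) * (u - w)) t 1.
Proof. exact: (derivable_mul (@derivable_subc R t w) (@derivable_subc R t w)). Qed.

Lemma derivable_sub3 w t :
  derivable (fun u : CC R => (u - w) * (u - w) * (u - w)) t 1.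
Proof. exact: (derivable_mul (@derivable_sub2 w t) (@derivable_subc R t w)). Qed.

Lemma real_lcont f (t : R) : derivable f t%:C 1 -> lcont (fun x => f x%:C) t.
Proof.
move=> df; apply: (@lcont_line _ f (fun x => x%:C) _ (fun u v => nm_hline 0 u v)).
exact: derivable_ccontinuous.
Qed.

(** A decay like [1 / z] is integrated against the Poisson kernel. *)
Lemma hardy2_dom F w (C : R) : 0 < Im w ->
  (forall z, 0 < Im z -> derivable F z 1) ->
  (forall z, 0 < Im z -> nm (F z) <= C / nm (z - w^*)) -> hardy2 F.
Proof.
move=> w0 dF FC; split=> //; exists (C ^+ 2 * (pi / Im w)) => y y0.
have yw : 0 < y + Im w by rewrite addr_gt0.
have mk : measurable_fun setT (pkernel (Re w) (y + Im w) : _ -> measurableTypeR R).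
  by apply: continuous_measurable_fun; exact: pkernel_continuous.
apply: (@le_trans _ _ (\int[mu]_x ((C ^+ 2)%:E * (pkernel (Re w) (y + Im w) x)%:E))%E).
  apply: ge0_le_integral => //.
  - by move=> x _; rewrite lee_fin sqr_ge0.
  - apply/measurable_EFinP; apply: measurable_funX.
    apply: continuous_measurable_fun => x; apply: lcont_nm.
    apply: (@lcont_line _ F (fun x => x +i* y) _ (nm_hline _)).
    exact: derivable_ccontinuous (dF (x +i* y) y0).
  - by apply: measurable_funeM; apply/measurable_EFinP.
  move=> x _; rewrite -EFinM lee_fin /pkernel -nm_sub_conj -exprVn -exprMn.
  have H := FC (x +i* y) y0.
  by rewrite ler_pXn2r // nnegrE ?nm_ge0 // (le_trans _ H) // nm_ge0.
rewrite ge0_integralZl_EFin ?sqr_ge0 //; first last.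
- by apply/measurable_EFinP.
- by move=> x _; rewrite lee_fin pkernel_ge0.
rewrite integral_pkernel // -EFinM lee_fin ler_wpM2l ?sqr_ge0 //.
by rewrite ler_wpM2l ?pi_ge0 // lef_pV2 ?posrE // lerDr ltW.
Qed.

End Dominated.

Section HermiteBiehler.
Variable R : realType.
Local Notation Re z := (@complex.Re (Real.sort R) z).
Local Notation Im z := (@complex.Im (Real.sort R) z).
Local Notation mu := (@lebesgue_measure R).
Implicit Types (z w c : CC R) (f g F : CC R -> CC R).
Variable e : CC R -> CC R.
Hypothesis e_HB : hermite_biehler e.
Hypothesis e_real : forall x : R, e x%:C != 0.

Let de z : derivable e z 1. Proof. by case: e_HB. Qed.

Let des z : derivable (sharp e) z 1.
Proof. exact: derivable_sharp. Qed.

Lemma HB_lt z : 0 < Im z -> nm (sharp e z) < nm (e z).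
Proof. by move=> z0; case: e_HB => _ /(_ _ z0); rewrite /sharp nmJ !normE ltcR. Qed.

Lemma real_of_Im0 z : Im z = 0 -> z = (Re z)%:C.
Proof. by case: z => a b /= ->. Qed.

Lemma sharp_real f (x : R) : sharp f x%:C = (f x%:C)^*.
Proof. by rewrite /sharp conjc_real. Qed.

Lemma HB_neq0 z : 0 <= Im z -> e z != 0.
Proof.
rewrite le_eqVlt => /predU1P[z0|z0]; last first.
  by rewrite -nm_gt0; apply: le_lt_trans (HB_lt z0); exact: nm_ge0.
by rewrite (real_of_Im0 (esym z0)).
Qed.

Definition theta z : CC R := sharp e z / e z.

Lemma theta_derivable z : 0 <= Im z -> derivable theta z 1.
Proof. by move=> z0; apply: derivable_div => //; exact: HB_neq0. Qed.

Lemma theta_le1 z : 0 <= Im z -> nm (theta z) <= 1.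
Proof.
move=> z0; have ez := HB_neq0 z0.
rewrite nmM nmV ler_pdivrMr ?nm_gt0 // mul1r.
move: z0; rewrite le_eqVlt => /predU1P[z0|z0]; last exact: ltW (HB_lt z0).
by rewrite (real_of_Im0 (esym z0)) sharp_real nmJ.
Qed.

Let th0 z := theta z / (z - 'i^*).

Let th0_bound (y : R) : 0 < y ->
  (\int[mu]_x ((nm (th0 (x +i* y)) ^+ 2)%:E) <= (pi : R)%:E)%E.
Proof.
move=> y0; have i0 : 0 < Im ('i : CC R) by rewrite /= ltr01.
have y1 : 0 < y + 1 by rewrite addr_gt0.
have mk : measurable_fun setT (pkernel 0 (y + 1) : _ -> measurableTypeR R).
  by apply: continuous_measurable_fun; exact: pkernel_continuous.
apply: (@le_trans _ _ (\int[mu]_x (pkernel 0 (y + 1) x)%:E)%E); last first.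
  rewrite integral_pkernel // lee_fin -[leRHS]divr1 ler_wpM2l ?pi_ge0 //.
  by rewrite lef_pV2 ?posrE // lerDr ltW.
apply: ge0_le_integral => //.
- by move=> x _; rewrite lee_fin sqr_ge0.
- apply/measurable_EFinP; apply: measurable_funX.
  apply: continuous_measurable_fun => x; apply: lcont_nm.
  apply: (@lcont_line _ th0 (fun x => x +i* y) _ (nm_hline _)).
  apply: derivable_ccontinuous; apply: derivable_divB.
    by apply: upper_neq_conj => //; exact: ltW.
  by apply: theta_derivable; exact: ltW.
- by apply/measurable_EFinP.
move=> x _; rewrite lee_fin /th0 nmM nmV exprMn exprVn nm_sub_conj /=.
rewrite -[leRHS]mul1r ler_wpM2r ?pkernel_ge0 //.
by rewrite exprn_ile1 ?nm_ge0 // theta_le1 //= ltW.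
Qed.

Lemma Im_i_gt0 : 0 < Im ('i : CC R). Proof. by rewrite /= ltr01. Qed.

Lemma nm_real_sub x w : nm (x%:C - w : CC R) ^+ 2 = (x - Re w) ^+ 2 + Im w ^+ 2.
Proof. by rewrite nm_sqr; case: w => a b; rewrite /= sub0r sqrrN. Qed.

Lemma nm_real_sub_ge x w : 0 < Im w -> Im w <= nm (x%:C - w : CC R).
Proof.
move=> w0; apply: le_trans (Im_nm _); rewrite cImB /= sub0r normrN.
exact: ler_norm.
Qed.

Lemma theta_real_derivable (x : R) : derivable theta x%:C 1.
Proof. exact: theta_derivable. Qed.

(** Partial fractions: [1 / ((x - z) (x - w))] is a difference of two Cauchy kernels.
The function [theta / (z - conj i)], unlike [theta], is square-integrable on
lines, so the Cauchy formula applies to it. *)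
Lemma theta_diff z w : 0 < Im z -> 0 < Im w ->
  2 * pi%:C * 'i * (theta z - theta w) =
  (z - w) * cint setT (fun x => theta x%:C / ((x%:C - z) * (x%:C - w))).
Proof.
move=> z0 w0.
have dth u : 0 <= Im u -> derivable th0 u 1.
  move=> u0; apply: derivable_divB; last exact: theta_derivable.
  by apply: upper_neq_conj => //; exact: Im_i_gt0.
have [iz cz] := @hardy_cauchy _ th0 pi dth th0_bound z z0.
have [iw cw] := @hardy_cauchy _ th0 pi dth th0_bound w w0.
have zi : z - 'i^* != 0 by rewrite subr_eq0 upper_neq_conj ?Im_i_gt0 // ltW.
have wi : w - 'i^* != 0 by rewrite subr_eq0 upper_neq_conj ?Im_i_gt0 // ltW.
have -> : 2 * pi%:C * 'i * (theta z - theta w) =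
    (z - 'i^*) * (2 * pi%:C * 'i * th0 z) - (w - 'i^*) * (2 * pi%:C * 'i * th0 w).
  by rewrite /th0; field; rewrite zi wi.
have mT : measurable (setT : set (measurableTypeR R)) by [].
rewrite -cz -cw -(cintZ (z - 'i^*) mT iz) -(cintZ (w - 'i^*) mT iw).
rewrite -(cintB mT (cintegrableZ (z - 'i^*) mT iz) (cintegrableZ (w - 'i^*) mT iw)).
have E x : (z - 'i^*) * (th0 x%:C / (x%:C - z)) - (w - 'i^*) * (th0 x%:C / (x%:C - w)) =
   (z - w) * (theta x%:C / ((x%:C - z) * (x%:C - w))).
  have xz : x%:C - z != 0 by rewrite real_sub_neq0 // gt_eqF.
  have xw : x%:C - w != 0 by rewrite real_sub_neq0 // gt_eqF.
  have xi : x%:C - 'i^* != 0 by rewrite real_sub_neq0 // cIm_conj oppr_eq0 gt_eqF ?Im_i_gt0.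
  by rewrite /th0; field; rewrite xz xw xi.
rewrite (eq_cint (fun x _ => E x)) cintZ //.
have [->|zw] := eqVneq z w.
  apply: (@cintegrable_dom _ _ (Re w) (Im w) 1) => // [t|x].
    apply: (@real_lcont _ (fun u => theta u / ((u - w) * (u - w)))).
    apply: derivable_div; last 2 first.
    - exact: theta_real_derivable.
    - exact: derivable_sub2.
    by rewrite mulf_neq0 // real_sub_neq0 // gt_eqF.
  have := theta_le1 (lexx 0 : 0 <= Im x%:C); move: (theta x%:C) => t ht.
  rewrite mul1r nmM nmV nmM -expr2 nm_real_sub -[leRHS]mul1r.
  by rewrite ler_wpM2r ?pkernel_ge0.
have zw0 : z - w != 0 by rewrite subr_eq0.
apply: (@eq_cintegrable _ _ (fun x => (z - w)^-1 * ((z - 'i^*) * (th0 x%:C / (x%:C - z)) -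
    (w - 'i^*) * (th0 x%:C / (x%:C - w))))) => //.
  by move=> x _; rewrite E mulKf.
by apply: cintegrableZ => //; apply: cintegrableB => //; exact: cintegrableZ.
Qed.

(** Expanding [1 / (x - z)] in powers of [z - w] under the integral sign gives
[theta] a Taylor expansion of order two with a cubic remainder. *)
Lemma theta_taylor w : 0 < Im w -> exists c0 c1 : CC R, exists2 C : R, 0 <= C &
  forall z, nm (z - w) < Im w / 2 ->
    nm (theta z - theta w - c0 * (z - w) - c1 * (z - w) ^+ 2) <= C * nm (z - w) ^+ 3.
Proof.
move=> w0; set v := Im w in w0 *; set u := Re w.
have v0 : v != 0 by rewrite gt_eqF.
have mT : measurable (setT : set (measurableTypeR R)) by [].
have xw x : x%:C - w != 0 :> CC R by rewrite real_sub_neq0 // gt_eqF.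
have nmv x : v <= nm (x%:C - w : CC R) by exact: nm_real_sub_ge.
have nm0' x : 0 < nm (x%:C - w : CC R) by exact: lt_le_trans (nmv x).
pose h2 (x : R) : CC R := theta x%:C / ((x%:C - w) * (x%:C - w)).
pose h3 (x : R) : CC R := theta x%:C / ((x%:C - w) * (x%:C - w) * (x%:C - w)).
have i2 : cintegrable setT h2.
  apply: (@cintegrable_dom _ _ u v 1) => // [t|x].
    apply: (@real_lcont _ (fun u => theta u / ((u - w) * (u - w)))).
    apply: derivable_div; last 2 first.
    - exact: theta_real_derivable.
    - exact: derivable_sub2.
    by rewrite mulf_neq0.
  rewrite /h2; have := theta_le1 (lexx 0 : 0 <= Im x%:C); move: (theta x%:C) => t ht.
  rewrite mul1r nmM nmV nmM -expr2 nm_real_sub -[leRHS]mul1r.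
  by rewrite ler_wpM2r ?pkernel_ge0.
have i3 : cintegrable setT h3.
  apply: (@cintegrable_dom _ _ u v v^-1) => // [t|x].
    apply: (@real_lcont _ (fun u => theta u / ((u - w) * (u - w) * (u - w)))).
    apply: derivable_div; last 2 first.
    - exact: theta_real_derivable.
    - exact: derivable_sub3.
    by rewrite !mulf_neq0.
  rewrite /h3; have := theta_le1 (lexx 0 : 0 <= Im x%:C); move: (theta x%:C) => t ht.
  rewrite nmM nmV !nmM -expr2 nm_real_sub invfM mulrA.
  rewrite mulrC; apply: ler_pM.
  - by rewrite invr_ge0 nm_ge0.
  - by apply: mulr_ge0; [exact: nm_ge0|exact: pkernel_ge0].
  - by rewrite lef_pV2 ?posrE.
  - by rewrite -[leRHS]mul1r; apply: ler_wpM2r => //; exact: pkernel_ge0.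
pose k : CC R := (2 * pi%:C * 'i)^-1.
have k0 : 2 * pi%:C * 'i != 0 :> CC R.
  rewrite -nm_gt0 !nmM nmi nm_real mulr1 mulr_gt0 //; last first.
    by rewrite ger0_norm ?pi_ge0 // pi_gt0.
  by rewrite nm_gt0 pnatr_eq0.
exists (k * cint setT h2), (k * cint setT h3).
exists (nm k * (2 * (2 / v ^+ 2 * (pi / v)))).
  by rewrite mulr_ge0 ?nm_ge0 // mulr_ge0 // mulr_ge0 // divr_ge0 ?pi_ge0 ?sqr_ge0 // ltW.
move=> z zw.
have z0 : 0 < Im z.
  have := Im_nm (z - w); rewrite cImB => H.
  have := le_lt_trans H zw; rewrite ltr_norml -/v => /andP[]; lra.
have xz x : x%:C - z != 0 :> CC R by rewrite real_sub_neq0 // gt_eqF.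
pose hz (x : R) : CC R := theta x%:C / ((x%:C - z) * (x%:C - w)).
pose hr (x : R) : CC R :=
  theta x%:C / ((x%:C - z) * ((x%:C - w) * (x%:C - w) * (x%:C - w))).
have hr_le x : nm (hr x) <= 2 / v ^+ 2 * pkernel u v x.
  rewrite /hr; have := theta_le1 (lexx 0 : 0 <= Im x%:C).
  move: (theta x%:C) => t n1; rewrite nmM nmV !nmM.
  set d := nm (x%:C - w); have d0 : 0 < d := nm0' x.
  have dz : d / 2 <= nm (x%:C - z).
    have -> : x%:C - z = (x%:C - w) - (z - w) by rewrite opprB addrA subrK.
    have := nm_dist (x%:C - w) (z - w); rewrite -/d => H.
    have := le_trans (ler_norm _) H; have := nmv x; rewrite -/d; lra.
  have d20 : 0 < d / 2 by rewrite divr_gt0.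
  rewrite /pkernel -nm_real_sub -/d.

  have H : nm t / (nm (x%:C - z) * (d * d * d)) <=
      1 * (d / 2 * (d * d * d))^-1.
    apply: ler_pM => //; first exact: nm_ge0.
      by rewrite invr_ge0 mulr_ge0 ?nm_ge0 // !mulr_ge0 // ltW.
    rewrite lef_pV2 ?posrE; last 2 first.
    - by rewrite mulr_gt0 ?nm_gt0 // !mulr_gt0.
    - by rewrite !mulr_gt0.
    by rewrite ler_wpM2r // !mulr_ge0 // ltW.
  apply: le_trans H _.
  have -> : 1 * (d / 2 * (d * d * d))^-1 = 2 / d ^+ 2 / d ^+ 2.
    by field; rewrite gt_eqF.
  rewrite ler_wpM2r ?invr_ge0 ?sqr_ge0 // ler_wpM2l // lef_pV2 ?posrE ?exprn_gt0 //.
  by rewrite ler_pXn2r ?nnegrE ?nmv // ltW.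
have ir : cintegrable setT hr.
  apply: (@cintegrable_dom _ _ u v (2 / v ^+ 2)) => // t.
  apply: (@real_lcont _ (fun u => theta u / ((u - z) * ((u - w) * (u - w) * (u - w))))).
  apply: derivable_div; last 2 first.
  - exact: theta_real_derivable.
  - exact: (derivable_mul (@derivable_subc R _ z) (@derivable_sub3 _ w _)).
  by rewrite !mulf_neq0.
have E x : hz x = h2 x + (z - w) * h3 x + (z - w) ^+ 2 * hr x.
  by rewrite /hz /h2 /h3 /hr; field; rewrite xw xz.
have Iz : cint setT hz = cint setT h2 + (z - w) * cint setT h3 + (z - w) ^+ 2 * cint setT hr.
  rewrite (eq_cint (fun x _ => E x)).
  rewrite -!cintZ // -cintD // -?cintD //; try exact: cintegrableZ.
  by apply: cintegrableD => //; exact: cintegrableZ.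
have -> : theta z - theta w - k * cint setT h2 * (z - w) - k * cint setT h3 * (z - w) ^+ 2 =
   k * (z - w) ^+ 3 * cint setT hr.
  have -> : theta z - theta w = k * (2 * pi%:C * 'i * (theta z - theta w)).
    by rewrite /k mulKf.
  rewrite theta_diff // -/hz Iz.
  move: (cint setT h2) (cint setT h3) (cint setT hr) k => I2 I3 Ir k.
  by ring.
have n3 : nm ((z - w) ^+ 3) = nm (z - w) ^+ 3 by rewrite !exprS expr0 !nmM Normc.normc1.
rewrite nmM nmM n3 [leRHS]mulrAC; apply: ler_wpM2l.
  by rewrite mulr_ge0 ?exprn_ge0 ?nm_ge0.
exact: cint_dom.
Qed.

End HermiteBiehler.

(** * The reproducing kernel of B(e) *)

Section Kernel.
Variable R : realType.
Local Notation Re z := (@complex.Re (Real.sort R) z).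
Local Notation Im z := (@complex.Im (Real.sort R) z).
Local Notation mu := (@lebesgue_measure R).
Implicit Types (z w c : CC R) (f g F : CC R -> CC R).

Lemma cintegrable_conj (D : set R) (h : R -> CC R) :
  measurable (D : set (measurableTypeR R)) ->
  cintegrable D h -> cintegrable D (fun x => (h x)^*).
Proof.
move=> mD [h1 h2]; split.
- by apply: eq_integrable h1 => // x _ /=; case: (h x).
- apply: eq_integrable (integrableZf (-1) mD h2) => // x _ /=.
  by rewrite mulN1r; case: (h x).
Qed.

(** An expansion of second order of [N] makes its difference quotient differentiable at
the base point, where [diffq_derivable] says nothing. *)
Lemma diffq_taylor (N : CC R -> CC R) w c0 c1 (C r : R) : 0 <= C -> 0 < r ->
  (forall z, nm (z - w) < r ->
    nm (N z - c0 * (z - w) - c1 * (z - w) ^+ 2) <= C * nm (z - w) ^+ 3) ->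
  [/\ N w = 0, cderiv N w c0 & cderiv (diffq N w c0) w c1].
Proof.
move=> C0 r0 H.
have Nw : N w = 0.
  have := H w; rewrite subrr nm0 !expr0n /= !mulr0 !subr0 => /(_ r0) Hw.
  by apply/eqP; rewrite -nm_eq0 eq_le nm_ge0 Hw.
split=> // eps e0.
- pose K := nm c1 + C + 1.
  have K0 : 0 < K by rewrite ltr_wpDl // addr_ge0 // nm_ge0.
  exists (Num.min r (Num.min 1 (eps / K))) => [|u].
    by rewrite !lt_min r0 ltr01 divr_gt0.
  rewrite !lt_min => /and3P[ur u1 ue]; rewrite Nw subr0.
  have := H _ ur; set d := nm (u - w) in ur u1 ue * => Hu.
  have d0 : 0 <= d by exact: nm_ge0.
  have -> : N u - c0 * (u - w) =
    (N u - c0 * (u - w) - c1 * (u - w) ^+ 2) + c1 * (u - w) ^+ 2 by rewrite subrK.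
  apply: le_trans (nmD _ _) _; rewrite nmM.
  have -> : nm ((u - w) ^+ 2) = d ^+ 2 by rewrite expr2 nmM.
  move: ue; rewrite ltr_pdivlMr // => /ltW ue.
  have h3 : C * d ^+ 3 <= C * d * d.
    rewrite -mulrA ler_wpM2l // exprS expr2 mulrA -[leRHS]mulr1.
    by rewrite ler_wpM2l ?mulr_ge0 // ltW.
  have h4 : d * K * d <= eps * d by rewrite ler_wpM2r.
  have h5 : 0 <= d * d by rewrite mulr_ge0.
  move: h4; rewrite /K expr2; lra.
- exists (Num.min r (eps / (C + 1))) => [|u].
    by rewrite lt_min r0 divr_gt0 // ltr_wpDl.
  rewrite lt_min => /andP[ur ue].
  rewrite {2}/diffq eqxx /diffq; case: eqVneq => [->|uw].
    by rewrite !subrr mulr0 subrr nm0 mulr0.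
  have uw0 : u - w != 0 by rewrite subr_eq0.
  have d0 : 0 < nm (u - w) by rewrite nm_gt0.
  have -> : N u / (u - w) - c0 - c1 * (u - w) =
     (N u - c0 * (u - w) - c1 * (u - w) ^+ 2) / (u - w) by field.
  rewrite nmM nmV ler_pdivrMr //; apply: le_trans (H _ ur) _.
  rewrite exprSr expr2 mulrA ler_wpM2r ?(ltW d0) // mulrA ler_wpM2r ?(ltW d0) //.
  move: ue; rewrite ltr_pdivlMr ?ltr_wpDl // mulrDr mulr1 => ue.
  by apply: le_trans (ltW ue); rewrite mulrC lerDl ltW.
Qed.

Lemma near_upper u w : nm (u - w) < Im w -> 0 < Im u.
Proof.
move=> H; have := le_lt_trans (Im_nm (u - w)) H.
by rewrite cImB ltr_norml => /andP[]; lra.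
Qed.

Lemma sharpK f : sharp (sharp f) = f.
Proof. by apply/funext => z; rewrite /sharp !conjcK. Qed.

Lemma entire_sharp f : entire f -> entire (sharp f).
Proof. by move=> ef z; exact: derivable_sharp. Qed.

Lemma in_deBranges_sharp e f : in_deBranges e f -> in_deBranges e (sharp f).
Proof.
move=> [f1 f2 f3]; split; [exact: entire_sharp|exact: f3|].
by rewrite sharpK; exact: f2.
Qed.

Variable e : CC R -> CC R.
Hypothesis e_HB : hermite_biehler e.
Hypothesis e_real : forall x : R, e x%:C != 0.

Let de z : derivable e z 1. Proof. by case: e_HB. Qed.

Let des z : derivable (sharp e) z 1.
Proof. exact: derivable_sharp. Qed.

Let enz z (z0 : 0 <= Im z) : e z != 0 := HB_neq0 e_HB e_real z0.

Variable w : CC R.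
Hypothesis w0 : 0 < Im w.

Let kap : CC R := - 'i / (2 * pi%:C).
Let N z : CC R := kap * (sharp e z * e w - e z * sharp e w).

Lemma pi_neq0 : pi%:C != 0 :> CC R.
Proof. by rewrite -nm_gt0 nm_real ger0_norm ?pi_ge0 // pi_gt0. Qed.

Lemma two_neq0 : 2 != 0 :> CC R.
Proof. by rewrite pnatr_eq0. Qed.

Let dN z : derivable N z 1.
Proof.
apply: (@derivable_scale R (fun z => sharp e z * e w - e z * sharp e w) z kap).
apply: (@derivable_sub R (fun z => sharp e z * e w) (fun z => e z * sharp e w)).
- exact: (@derivable_mul R (sharp e) (fun=> e w) z (@des z) (@derivable_cst _ _ _ (e w) z 1)).
- exact: (@derivable_mul R e (fun=> sharp e w) z (@de z) (@derivable_cst _ _ _ (sharp e w) z 1)).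
Qed.

Let NJ z : (N z^*)^* =
  kap^* * (e z * (e w)^* - sharp e z * (sharp e w)^*).
Proof.
by rewrite /N !numconjE cconjM cconjB !cconjM /sharp !cconjK.
Qed.

Let LJ (L : CC R -> CC R) z : (forall z, z != w -> L z = N z / (z - w)) ->
  z != w^* -> sharp L z =
  kap^* * (e z * (e w)^* - sharp e z * (sharp e w)^*) / (z - w^*).
Proof.
move=> LN zw; have zw' : z^* != w by apply: contra zw => /eqP <-; rewrite conjcK.
by rewrite -NJ {1}/sharp LN // !numconjE cconjM cconjV cconjB cconjK.
Qed.

(** The numerator of the kernel is [e] times an increment of [theta], so that
dividing by [z - w] leaves an entire function. *)
Let Ntheta z : 0 <= Im z -> N z = kap * e w * e z * (theta e z - theta e w).
Proof.
move=> z0; rewrite /N /theta; have ez := enz z0; have ew := enz (ltW w0).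
by field; rewrite ez ew.
Qed.

(** The conjugate of the kernel as a function of the conjugate variable: the
numerator vanishes at [w], so the quotient is entire; near [w] it is
a multiple of [e] times the difference quotient of [theta]. *)
Lemma kernel_aux : exists L : CC R -> CC R,
  [/\ entire L, hardy2 (fun z => L z / e z), hardy2 (fun z => sharp L z / e z) &
      forall z, z != w -> L z = N z / (z - w)].
Proof.
have [c0 [c1 [C C0 HC]]] := theta_taylor e_HB e_real w0.
pose Nt z := theta e z - theta e w.
have v20 : 0 < Im w / 2 by rewrite divr_gt0.
have [Ntw dNt dq] := diffq_taylor C0 v20 HC.
pose L := diffq N w (kap * e w * e w * c0).
have LE z : 0 <= Im z -> kap * e w * e z * diffq Nt w c0 z = L z.
  move=> z0; rewrite /L /diffq; case: eqVneq => [->//|zw].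
  by rewrite Ntheta // mulrA.
have LN z : z != w -> L z = N z / (z - w) by rewrite /L /diffq => /negbTE ->.
have eL : entire L.
  move=> z; have [->|zw] := eqVneq z w; last exact: (@diffq_derivable _ N w _ z zw (@dN z)).
  apply: (@near_derivable _ (fun u => (kap * e w * e u) * diffq Nt w c0 u) _ _ (Im w) w0).
    by move=> u uw; apply: LE; exact: ltW (near_upper uw).
  apply: (@derivable_mul _ (fun u => kap * e w * e u)).
    exact: (@derivable_scale _ e w (kap * e w) (@de w)).
  by apply/derivable_cderiv; exists c1.
have dq_div f z : 0 < Im z -> derivable f z 1 -> derivable (fun u => f u / e u) z 1.
  by move=> z0 df; exact: (derivable_div (enz (ltW z0)) df (@de z)).
have qge z : 0 < Im z -> Im w <= nm (z - w^*).
  move=> z0; apply: le_trans (Im_nm _); rewrite cImB cIm_conj opprK.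
  by apply: le_trans (ler_norm _); rewrite lerDr ltW.
have thle z : 0 <= Im z -> nm (theta e z) <= 1 by exact: theta_le1.
exists L; split; [exact: eL| | |exact: LN].
- have [|C1 C10 HC1] := @diffq_bound _ Nt w c0 (fun=> 2) 0 w0 Ntw dNt (lexx 0)
     (fun _ _ => ltW (ltr0Sn _ 1)).
    move=> z z0; rewrite mul0r addr0; apply: le_trans (nmB _ _) _.
    by rewrite -[2]/(1 + 1); apply: lerD; apply: thle; rewrite // ltW.
  apply: (@hardy2_dom _ _ w (nm (kap * e w) * (C1 * (2 + (Im w)^-1)))) => // z z0.
    exact: dq_div.
  have ez := enz (ltW z0).
  rewrite -LE ?(ltW z0) // (_ : _ / e z = kap * e w * diffq Nt w c0 z); last first.
    by field.
  rewrite nmM -!mulrA; apply: ler_wpM2l; first exact: nm_ge0.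
  apply: le_trans (HC1 _ z0) _; apply: ler_wpM2l => //.
  have q0 : 0 < nm (z - w^*) by exact: lt_le_trans (qge _ z0).
  rewrite [leRHS]mulrDl lerD2l expr2 invfM ler_wpM2r ?invr_ge0 ?nm_ge0 //.
  by rewrite lef_pV2 ?posrE // qge.
- pose K := nm (kap^*) * (nm (e w) + nm (sharp e w)).
  apply: (@hardy2_dom _ _ w K) => // z z0.
    by apply: dq_div => //; exact: entire_sharp.
  have zw : z != w^* by rewrite upper_neq_conj // ltW.
  have ez := enz (ltW z0).
  have zw' : z - w^* != 0 by rewrite subr_eq0.
  have -> : sharp L z / e z =
     kap^* * ((e w)^* - theta e z * (sharp e w)^*) / (z - w^*).
    by rewrite (LJ LN zw) /theta; field; rewrite ez zw'.
  rewrite nmM nmV ler_wpM2r ?invr_ge0 ?nm_ge0 // nmM ler_wpM2l ?nm_ge0 //.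
  apply: le_trans (nmB _ _) _; rewrite nmJ lerD2l nmM nmJ -[leRHS]mul1r.
  by rewrite ler_wpM2r ?nm_ge0 // thle // ltW.
Qed.

Lemma deBranges_hardy f : in_deBranges e f ->
  exists M : R, (forall z, 0 <= Im z -> derivable (fun u => f u / e u) z 1) /\
  forall y, 0 < y -> (\int[mu]_x ((nm (f (x +i* y) / e (x +i* y)) ^+ 2)%:E) <= M%:E)%E.
Proof.
move=> [ef [_ [M HM]] _]; exists M; split; last exact: HM.
by move=> z z0; exact: (derivable_div (enz z0) (ef z) (@de z)).
Qed.

Theorem deBranges_kernel : exists K : CC R -> CC R,
  [/\ in_deBranges e K,
      forall z, 2 * pi%:C * (z - w^*) * K z =
        'i * (e z * (e w)^* - sharp e z * (sharp e w)^*),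
      forall f, in_deBranges e f -> ip_deBranges e K f = f w &
      forall f, in_deBranges e f -> ip_deBranges e (sharp K) f = f w^*].
Proof.
have [L [eL h1 h2 LN]] := kernel_aux.
pose K := sharp L.
have mT : measurable (setT : set (measurableTypeR R)) by [].
have kapJ : kap^* = 'i / (2 * pi%:C).
  have c2 : conjc (2 : CC R) = 2 by exact: conjc_nat.
  have cpi : conjc (pi%:C : CC R) = pi%:C by exact: conjc_real.
  have ci : conjc ('i : CC R) = - 'i by apply/eqP; rewrite eq_complex /= oppr0 !eqxx.
  by rewrite /kap ?numconjE cconjM cconjN cconjV cconjM c2 cpi ci opprK.
have KB : in_deBranges e K.
  by split; [exact: entire_sharp|exact: h2|rewrite /K sharpK; exact: h1].
have main f : in_deBranges e f ->
    cintegrable setT (fun x => (K x%:C)^* * f x%:C / `|e x%:C| ^+ 2) /\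
    ip_deBranges e K f = f w.
  move=> fB; have [M1 [d1 m1]] := deBranges_hardy fB.
  have [M2 [d2 m2]] := deBranges_hardy (in_deBranges_sharp fB).
  have [i1 c1] := hardy_cauchy d1 m1 w0.
  have [i2 c2] := hardy_cauchy_lower d2 m2 w0.
  pose g1 x : CC R := f x%:C / e x%:C / (x%:C - w).
  pose g2 x : CC R := (sharp f x%:C / e x%:C / (x%:C - w^*))^*.
  have i2' : cintegrable setT g2.
    exact: (cintegrable_conj mT i2).
  have E x : (K x%:C)^* * f x%:C / `|e x%:C| ^+ 2 =
      kap * e w * g1 x - kap * sharp e w * g2 x.
    have xw : x%:C - w != 0 by rewrite real_sub_neq0 // gt_eqF.
    have ex := e_real x.
    have exJ : (e x%:C)^* != 0 by rewrite conjc_eq0.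
    have xw' : x%:C != w by rewrite -subr_eq0.
    have cx : conjc (x%:C : CC R) = x%:C by exact: conjc_real.
    have KL : conjc (K x%:C) = L x%:C by rewrite /K sharp_real ?numconjE cconjK.
    rewrite ?numconjE KL LN // /N sqr_normc /g1 /g2 !numconjE.
    rewrite !(cconjM, cconjV, cconjB) !sharp_real ?numconjE !cconjK cx.
    by field; rewrite xw ex exJ.
  have iK1 := cintegrableZ (kap * e w) mT i1.
  have iK2 := cintegrableZ (kap * sharp e w) mT i2'.
  split; first by apply: eq_cintegrable (cintegrableB mT iK1 iK2) => // x _; rewrite E.
  rewrite /ip_deBranges complex_integralE (eq_cint (fun x _ => E x)) (cintB mT iK1 iK2).
  rewrite (cintZ _ mT i1) (cintZ _ mT i2') c1 (cint_conj mT i2) c2 conjc0 mulr0 subr0.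
  have ew := enz (ltW w0); rewrite /kap.
  have i_sqr : 'i * 'i = -1 :> CC R by rewrite -expr2 sqr_i.
  have -> : - 'i / (2 * pi%:C) * e w * (2 * pi%:C * 'i * (f w / e w)) =
    - ('i * 'i) * f w.
    by move: (pi%:C : CC R) pi_neq0 => P P0; field; rewrite ew P0.
  by rewrite i_sqr opprK mul1r.
exists K; split; [exact: KB| | |].
- move=> z; have [->|zw] := eqVneq z w^*.
    rewrite subrr mulr0 mul0r /sharp ?numconjE !cconjK.
    by rewrite (mulrC (conjc (e w))) subrr mulr0.
  have zw0 : z - w^* != 0 by rewrite subr_eq0.
  rewrite /K (LJ LN zw) !numconjE kapJ.
  by move: (pi%:C : CC R) pi_neq0 => P P0; field; rewrite zw0 P0.
- by move=> f /main[].
move=> f fB; have [iK] := main _ (in_deBranges_sharp fB).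
rewrite {2}/sharp => /(congr1 conjc); rewrite ?numconjE cconjK => <-.
rewrite /ip_deBranges !complex_integralE -cint_conj //; apply: eq_cint => x _.
by rewrite !sharp_real expr2 !numconjE !(cconjM, cconjV) !cconjK !normE !conjc_real.
Qed.

End Kernel.

(** * Norms and extension by continuity *)

Section RealNorm.
Variables (R : realType) (V : normedModType R[i]).
Implicit Types u v : V.

(** The norm of a complex normed space has complex values; its real part carries the
same information in a totally ordered field. *)
Definition nv v : R := complex.Re `|v|.

Lemma nvE v : `|v| = (nv v)%:C.
Proof.
rewrite /nv; have := normr_ge0 v; rewrite lecE /= => /andP[/eqP H _].
by case: `|v| H => a b /= ->.
Qed.

Lemma nv_ge0 v : 0 <= nv v.
Proof. by have := normr_ge0 v; rewrite nvE lecR. Qed.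

Lemma nvD u v : nv (u + v) <= nv u + nv v.
Proof. by have := ler_normD u v; rewrite !nvE -rmorphD lecR. Qed.

Lemma nvN u : nv (- u) = nv u.
Proof. by rewrite /nv normrN. Qed.

Lemma nvBC u v : nv (u - v) = nv (v - u).
Proof. by rewrite -nvN opprB. Qed.

Lemma nvZ (a : R[i]) u : nv (a *: u) = nm a * nv u.
Proof. by apply: (@complexI R); rewrite -nvE normrZ nvE rmorphM. Qed.

Lemma nv0 : nv 0 = 0. Proof. by rewrite /nv normr0. Qed.

Lemma nv_eq0 v : nv v = 0 -> v = 0.
Proof. by move=> v0; apply/eqP; rewrite -normr_eq0 nvE v0. Qed.

Lemma nv_small_eq u v : (forall eps : R, 0 < eps -> nv (u - v) <= eps) -> u = v.
Proof.
move=> H; apply/eqP; rewrite -subr_eq0; apply/eqP/nv_eq0/eqP.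
rewrite eq_le nv_ge0 andbT; apply/ler_addgt0Pr => eps e0.
by rewrite add0r H.
Qed.

Lemma nbhs_nv v (P : set V) : (\forall u \near v, P u) <->
  exists2 d : R, 0 < d & forall u, nv (u - v) < d -> P u.
Proof.
split=> [/nbhs_ballP [[d d'] /=]|[d d0 dP]].
  rewrite ltcE /= => /andP[/eqP -> d0 dP].
  exists d => // u ud; apply: dP; rewrite -ball_normE /= distrC nvE.
  by rewrite ltcR.
apply/nbhs_ballP; exists d%:C; rewrite /= ?ltcR // => u.
by rewrite -ball_normE /= distrC nvE ltcR; exact: dP.
Qed.

Lemma dense_nv (S : set V) : dense S ->
  forall v (eps : R), 0 < eps -> exists2 u, S u & nv (v - u) < eps.
Proof.
move=> dS v eps e0.
have e0' : 0 < eps%:C :> R[i] by rewrite ltcR.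
have [u [bu Su]] := dS (ball v eps%:C) (ex_intro _ v (ballxx v e0'))
  (@ball_open _ _ v eps%:C).
by exists u => //; move: bu; rewrite -ball_normE /= nvE ltcR.
Qed.

End RealNorm.

Section Complete.
Variables (R : realType) (V : completeNormedModType R[i]).

Lemma nv_cauchy_cvg (u : nat -> V) :
  (forall eps : R, 0 < eps -> exists N, forall m n, (N <= m)%N -> (N <= n)%N ->
     nv (u m - u n) < eps) ->
  exists l, forall eps : R, 0 < eps -> exists N, forall n, (N <= n)%N ->
     nv (l - u n) < eps.
Proof.
move=> H.
have : cauchy (u @ \oo).
  apply/cauchy_exP => -[e e'] /=; rewrite ltcE /= => /andP[/eqP -> e0].
  have [N HN] := H _ e0; exists (u N); exists N => // n /= Nn.
  by rewrite -ball_normE /= nvE ltcR; apply: HN.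
move=> /cauchy_cvg cu; exists (lim (u @ \oo)) => eps e0.
have /nbhs_nv : nbhs (lim (u @ \oo)) [set v | nv (v - lim (u @ \oo)) < eps].
  by apply/nbhs_nv; exists eps.
have HB : nbhs (lim (u @ \oo)) [set v | nv (lim (u @ \oo) - v) < eps].
  by apply/nbhs_nv; exists eps => // v; rewrite nvBC.
have [N _ HN] := cu _ HB; move=> _; exists N => n Nn; exact: HN.
Qed.

End Complete.

Section Continuity.
Variables (R : realType) (V W : normedModType R[i]).

Lemma continuous_nv (T : V -> W) : continuous T <->
  forall v (eps : R), 0 < eps -> exists2 d : R, 0 < d &
    forall u, nv (u - v) < d -> nv (T u - T v) < eps.
Proof.
split=> [cT v eps e0|H v A].
  have /nbhs_nv[d d0 dP] : nbhs v (T @^-1` [set x | nv (x - T v) < eps]).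
    by apply: cT; apply/nbhs_nv; exists eps.
  by exists d.
move=> /nbhs_nv[eps e0 eA]; apply/nbhs_nv.
by have [d d0 dP] := H v _ e0; exists d => // u /dP /eA.
Qed.

Lemma lipschitz_continuous (T : V -> W) (C : R) :
  (forall u v, nv (T u - T v) <= C * nv (u - v)) -> continuous T.
Proof.
move=> TC; apply/continuous_nv => v eps e0.
have C1 : 0 < `|C| + 1 by rewrite ltr_wpDl.
exists (eps / (`|C| + 1)) => [|u]; first by rewrite divr_gt0.
rewrite ltr_pdivlMr // => H; apply: le_lt_trans (TC _ _) _.
apply: le_lt_trans H; rewrite mulrC; apply: ler_wpM2l; first exact: nv_ge0.
by apply: le_trans (ler_norm _) _; rewrite lerDl.
Qed.

Lemma continuous_dense_eq (B : Type) (j : B -> V) (T1 T2 : V -> W) :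
  dense (range j) -> continuous T1 -> continuous T2 ->
  (forall f, T1 (j f) = T2 (j f)) -> forall v, T1 v = T2 v.
Proof.
move=> dj /continuous_nv c1 /continuous_nv c2 T12 v.
apply: nv_small_eq => eps e0; have e20 : 0 < eps / 2 by rewrite divr_gt0.
have [d1 d10 H1] := c1 v _ e20; have [d2 d20 H2] := c2 v _ e20.
have [|_ [f _ <-] Hf] := dense_nv dj v (eps := Num.min d1 d2).
  by rewrite lt_min d10.
move: Hf; rewrite nvBC lt_min => /andP[/H1 h1 /H2 h2].
have -> : T1 v - T2 v = (T1 v - T1 (j f)) + (T2 (j f) - T2 v).
  by rewrite T12 addrA subrK.
apply: le_trans (nvD _ _) _; rewrite (nvBC (T1 v)); lra.
Qed.

End Continuity.

Section Extension.
Variables (R : realType) (B : lmodType R[i]) (V : normedModType R[i]).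
Variables (W : completeNormedModType R[i]) (j : B -> V) (phi : B -> W) (C : R).
Hypothesis j_lin : linear j.
Hypothesis phi_lin : linear phi.
Hypothesis j_dense : dense (range j).
Hypothesis C0 : 0 <= C.
Hypothesis phi_le : forall f, nv (phi f) <= C * nv (j f).

Let jB f g : j (f - g) = j f - j g.
Proof. by rewrite addrC -scaleN1r j_lin scaleN1r addrC. Qed.

Let phiB f g : phi (f - g) = phi f - phi g.
Proof. by rewrite addrC -scaleN1r phi_lin scaleN1r addrC. Qed.

(** The limit of [phi] along a sequence that approaches [v]; the estimate
determines it, and is more convenient than the limit. *)
Lemma extension_ex v : exists l : W, forall f, nv (l - phi f) <= C * nv (v - j f).
Proof.
have [fs Hfs] : {fs : nat -> B & forall n, nv (v - j (fs n)) < n.+1%:R^-1}.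
  apply: (@choice _ _ (fun n f => nv (v - j f) < n.+1%:R^-1)) => n; have n0 : 0 < n.+1%:R^-1 :> R by rewrite invr_gt0.
  by have [_ [f _ <-] Hf] := dense_nv j_dense v n0; exists f.
have small (eps : R) : 0 < eps -> exists N, forall n, (N <= n)%N -> n.+1%:R^-1 < eps.
  move=> e0; have [N _ HN] := near_infty_natSinv_lt (PosNum e0).
  by exists N => n Nn; exact: HN.
have C1 : 0 < C + 1 by rewrite ltr_wpDl.
have [|l Hl] := @nv_cauchy_cvg _ W (phi \o fs).
  move=> eps e0; have [|N HN] := small (eps / (2 * (C + 1))).
    by rewrite divr_gt0 // mulr_gt0.
  exists N => m n Nm Nn; rewrite /= -phiB.
  apply: le_lt_trans (phi_le _) _; rewrite jB.
  have H : nv (j (fs m) - j (fs n)) <= m.+1%:R^-1 + n.+1%:R^-1.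
    have -> : j (fs m) - j (fs n) = - (v - j (fs m)) + (v - j (fs n)).
      by rewrite opprB addrA subrK.
    by apply: le_trans (nvD _ _) _; rewrite nvN lerD // ltW.
  apply: le_lt_trans (_ : (C + 1) * (m.+1%:R^-1 + n.+1%:R^-1) < eps).
    apply: ler_pM => //; first exact: nv_ge0.
    by rewrite lerDl.
  have hm := HN _ Nm; have hn := HN _ Nn.
  have : m.+1%:R^-1 + n.+1%:R^-1 < eps / (2 * (C + 1)) + eps / (2 * (C + 1)).
    exact: ltrD.
  have -> : eps / (2 * (C + 1)) + eps / (2 * (C + 1)) = eps / (C + 1).
    by field; rewrite gt_eqF.
  by rewrite ltr_pdivlMr // mulrC.
exists l => f; apply/ler_addgt0Pr => eps e0.
have [|N1 HN1] := Hl (eps / 2); first by rewrite divr_gt0.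
have [|N2 HN2] := small (eps / (2 * (C + 1))).
  by rewrite divr_gt0 // mulr_gt0.
pose n := maxn N1 N2.
have h1 := HN1 n (leq_maxl _ _); have h2 := HN2 n (leq_maxr _ _).
have -> : l - phi f = (l - phi (fs n)) + phi (fs n - f) by rewrite phiB addrA subrK.
apply: le_trans (nvD _ _) _.
have h3 : nv (phi (fs n - f)) <= C * nv (v - j f) + C * n.+1%:R^-1.
  apply: le_trans (phi_le _) _; rewrite -mulrDr ler_wpM2l // jB.
  have -> : j (fs n) - j f = (v - j f) - (v - j (fs n)) by rewrite opprB [RHS]addrC addrA subrK.
  by apply: le_trans (nvD _ _) _; rewrite nvN lerD2l ltW.
have h4 : C * n.+1%:R^-1 <= eps / 2.
  apply: le_trans (_ : (C + 1) * (eps / (2 * (C + 1))) <= _).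
    apply: ler_pM => //; last exact: ltW.
    by rewrite lerDl.
  by rewrite le_eqVlt; apply/orP; left; apply/eqP; field; rewrite gt_eqF.
apply: le_trans (lerD (ltW h1) h3) _.
by rewrite addrCA lerD2l [leRHS]splitr lerD2l.
Qed.

(** The values chosen by [extension_ex] are linear and bounded because the estimate
that determines them passes to sums, multiples and limits. *)
Lemma bounded_extension : exists T : V -> W,
  [/\ linear T, continuous T, forall f, T (j f) = phi f &
      forall v, nv (T v) <= C * nv v].
Proof.
have [T HT] := choice extension_ex.
have Tj f : T (j f) = phi f.
  apply/eqP; rewrite -subr_eq0; apply/eqP/nv_eq0/eqP; rewrite eq_le nv_ge0 andbT.
  by apply: le_trans (HT _ f) _; rewrite subrr nv0 mulr0.
have jD a f g : j (a *: f + g) = a *: j f + j g by exact: j_lin.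
have phiD a f g : phi (a *: f + g) = a *: phi f + phi g by exact: phi_lin.
have Tlin : linear T.
  move=> a u v; apply: nv_small_eq => eps e0.
  have na0 : 0 <= nm a by exact: nm_ge0.
  pose K := 2 * (C + 1) * (nm a + 1).
  have K0 : 0 < K by rewrite !mulr_gt0 // ltr_wpDl.
  have d0 : 0 < eps / K by rewrite divr_gt0.
  have [_ [f _ <-] Hf] := dense_nv j_dense u d0.
  have [_ [g _ <-] Hg] := dense_nv j_dense v d0.
  have hu := HT u f; have hv := HT v g; have hw := HT (a *: u + v) (a *: f + g).
  have E (x1 x2 x3 x4 x5 : W) :
      x1 - (x2 + x3) = (x1 - (x4 + x5)) - ((x2 - x4) + (x3 - x5)).
    by rewrite [(x2 - x4) + _]addrACA -opprD opprB addrA subrK.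
  rewrite (E _ _ _ (a *: phi f) (phi g)) -phiD -scalerBr.
  apply: le_trans (nvD _ _) _; rewrite nvN.
  have EV : a *: u + v - j (a *: f + g) = a *: (u - j f) + (v - j g).
    by rewrite jD scalerBr [RHS]addrACA -opprD.
  have h1 : nv (a *: (u - j f) + (v - j g)) <= (nm a + 1) * (eps / K).
    apply: le_trans (nvD _ _) _; rewrite nvZ mulrDl mul1r lerD //; last exact: ltW.
    by rewrite ler_wpM2l // ltW.
  have h2 : nv (a *: (T u - phi f) + (T v - phi g)) <= C * ((nm a + 1) * (eps / K)).
    apply: le_trans (nvD _ _) _; rewrite nvZ [leRHS]mulrC mulrAC -mulrA mulrDl mul1r.
    have cf : C * nv (u - j f) <= C * (eps / K) by rewrite ler_wpM2l // ltW.
    have cg : C * nv (v - j g) <= C * (eps / K) by rewrite ler_wpM2l // ltW.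
    apply: lerD; last exact: le_trans hv cg.
    by rewrite ler_wpM2l // (le_trans hu cf).
  have h3 : C * nv (a *: (u - j f) + (v - j g)) <= C * ((nm a + 1) * (eps / K)).
    by rewrite ler_wpM2l.
  rewrite EV in hw.
  have h4 : 2 * (C * ((nm a + 1) * (eps / K))) <= eps.
    have -> : 2 * (C * ((nm a + 1) * (eps / K))) = eps * (C / (C + 1)).
      by rewrite /K; field; rewrite !gt_eqF // ltr_wpDl.
    rewrite -[leRHS]mulr1 ler_wpM2l ?(ltW e0) // ler_pdivrMr // ?mul1r ?lerDl //.
    by rewrite ltr_wpDl.
  move: hw h2 h3 h4; lra.
have j0 : j 0 = 0 by rewrite -(subrr 0) jB subrr.
have p0 : phi 0 = 0 by rewrite -(subrr 0) phiB subrr.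
have TC v : nv (T v) <= C * nv v by have := HT v 0; rewrite j0 p0 !subr0.
exists T; split => //; apply: (@lipschitz_continuous _ _ _ _ C) => u v.
have -> : T u - T v = T (u - v).
  have -> : u - v = -1 *: v + u by rewrite scaleN1r addrC.
  by rewrite Tlin scaleN1r addrC.
exact: TC.
Qed.

End Extension.

(** * Hilbert space geometry of a de Branges space *)

Section Hilbert.
Variables (R : realType) (B : dBSpace R).
Local Notation ip := (@dB_ip R B).
Local Notation ev := (@dB_ev R B).
Implicit Types (f g h : B) (z w v c : CC R).

Lemma evDZ c f g z : ev (c *: f + g) z = c * ev f z + ev g z.
Proof. exact: dB_ev_linear. Qed.

Lemma ev0 z : ev 0 z = 0.
Proof. by have := evDZ (-1) 0 0 z; rewrite scaler0 addr0 mulN1r addNr. Qed.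

Lemma evZ c f z : ev (c *: f) z = c * ev f z.
Proof. by rewrite -[c *: f]addr0 evDZ ev0 addr0. Qed.

Lemma evD f g z : ev (f + g) z = ev f z + ev g z.
Proof. by rewrite -[f]scale1r evDZ mul1r scale1r. Qed.

Lemma evN f z : ev (- f) z = - ev f z.
Proof. by rewrite -scaleN1r evZ mulN1r. Qed.

Lemma evB f g z : ev (f - g) z = ev f z - ev g z.
Proof. by rewrite evD evN. Qed.

Lemma ipC f g : ip g f = conjc (ip f g).
Proof. exact: dB_ip_conj. Qed.

Lemma ipDZr f c g h : ip f (c *: g + h) = c * ip f g + ip f h.
Proof. exact: dB_ip_linear. Qed.

Lemma ip0r f : ip f 0 = 0.
Proof. by have := ipDZr f (-1) 0 0; rewrite scaler0 addr0 mulN1r addNr. Qed.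

Lemma ipZr f c g : ip f (c *: g) = c * ip f g.
Proof. by rewrite -[c *: g]addr0 ipDZr ip0r addr0. Qed.

Lemma ipDr f g h : ip f (g + h) = ip f g + ip f h.
Proof. by rewrite -[g]scale1r ipDZr mul1r scale1r. Qed.

Lemma ipNr f g : ip f (- g) = - ip f g.
Proof. by rewrite -scaleN1r ipZr mulN1r. Qed.

Lemma ipBr f g h : ip f (g - h) = ip f g - ip f h.
Proof. by rewrite ipDr ipNr. Qed.

Lemma ipZl f c g : ip (c *: f) g = conjc c * ip f g.
Proof. by rewrite ipC ipZr cconjM -ipC. Qed.

Lemma ipDl f g h : ip (f + g) h = ip f h + ip g h.
Proof. by rewrite ipC ipDr cconjD -!ipC. Qed.

Lemma ipNl f g : ip (- f) g = - ip f g.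
Proof. by rewrite ipC ipNr cconjN -ipC. Qed.

Lemma ipBl f g h : ip (f - g) h = ip f h - ip g h.
Proof. by rewrite ipDl ipNl. Qed.

Lemma ip_nv f : ip f f = (nv f ^+ 2)%:C.
Proof. by rewrite dB_ip_norm nvE rmorphXn. Qed.

Lemma ip_eq0 f : ip f f = 0 -> f = 0.
Proof.
rewrite ip_nv => /(congr1 (@complex.Re R)) /= /eqP; rewrite sqrf_eq0 => /eqP.
exact: nv_eq0.
Qed.

Lemma ip_inj f g : (forall h, ip h f = ip h g) -> f = g.
Proof.
move=> H; apply/eqP; rewrite -subr_eq0; apply/eqP/ip_eq0.
by rewrite ipBr !H subrr.
Qed.

Lemma conj_mul_nm z : z * conjc z = (nm z ^+ 2)%:C.
Proof. by rewrite -sqr_normc normE rmorphXn. Qed.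

(** The vector [f - t g] with [t] the coefficient of the projection onto [g]
has nonnegative square norm. *)
Lemma cauchy_schwarz f g : nm (ip f g) <= nv f * nv g.
Proof.
have [->|g0] := eqVneq g 0.
  by rewrite ip0r nm0 nv0 mulr0.
have ng : nv g != 0 by apply: contra g0 => /eqP /nv_eq0 ->.
have ngC : (nv g ^+ 2)%:C != 0 :> R[i].
  by rewrite (_ : 0 = 0%:C) // (inj_eq (@complexI R)) expf_neq0.
pose t : CC R := ip g f / (nv g ^+ 2)%:C.
have tC : conjc t = ip f g / (nv g ^+ 2)%:C.
  by rewrite /t cconjM cconjV -ipC; congr (_ / _); exact: conjc_real.
have E : ip (f - t *: g) (f - t *: g) =
    (nv f ^+ 2)%:C - (nm (ip f g) ^+ 2)%:C / (nv g ^+ 2)%:C.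
  rewrite ipBr !ipBl !ipZl !ipZr !ip_nv tC /t -(conj_mul_nm (ip f g)) -(ipC f g).
  by move: ngC; move: ((nv g ^+ 2)%:C : CC R) (ip f g) (ip g f) => n x y n0; field.
have /(congr1 (@complex.Re R)) := E; rewrite ip_nv -fmorphV -rmorphM -rmorphB /= => H.
have : 0 <= nv f ^+ 2 - nm (ip f g) ^+ 2 / nv g ^+ 2 by rewrite -H sqr_ge0.
rewrite subr_ge0 ler_pdivrMr ?exprn_even_gt0 // -exprMn => H2.
by rewrite -(@ler_pXn2r _ 2) // nnegrE ?nm_ge0 ?mulr_ge0 ?nv_ge0.
Qed.

Lemma ev_kernel f w : ev f w = ip (dB_kernel B w) f.
Proof. exact: dB_reproducing. Qed.

Lemma ip_ker_r f w : ip f (dB_kernel B w) = conjc (ev f w).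
Proof. by rewrite ipC -ev_kernel. Qed.

Lemma ev_continuous f z : {for z, continuous (ev f)}.
Proof. by apply: derivable_ccontinuous; exact: dB_ev_entire. Qed.

Lemma eq_at_limit (f g : CC R -> CC R) z :
  {for z, continuous f} -> {for z, continuous g} ->
  (forall d : R, 0 < d -> exists2 u, nm (u - z) < d & f u = g u) -> f z = g z.
Proof.
move=> /continuous_nmP cf /continuous_nmP cg H.
apply/eqP; rewrite -subr_eq0 -nm_eq0 eq_le nm_ge0 andbT.
apply/ler_addgt0Pr => eps e0; rewrite add0r.
have e20 : 0 < eps / 2 by rewrite divr_gt0.
have [d1 d10 H1] := cf _ e20; have [d2 d20 H2] := cg _ e20.
have [|u] := H (Num.min d1 d2); first by rewrite lt_min d10.
rewrite lt_min => /andP[/H1 h1 /H2 h2] E.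
have -> : f z - g z = (f z - f u) + (g u - g z) by rewrite E addrA subrK.
by apply: le_trans (nmD _ _) _; rewrite (nmBC (f z)); lra.
Qed.

Lemma ev_eq_off v f g : (forall z, z != v -> ev f z = ev g z) -> f = g.
Proof.
move=> H; apply: dB_ev_inj; apply/funext => z.
have [->|/H//] := eqVneq z v.
apply: eq_at_limit; try exact: ev_continuous.
move=> d d0; exists (v + (d / 2)%:C).
  by rewrite addrC addKr nm_real ger0_norm ?ltW ?divr_gt0 //; lra.
apply: H; rewrite -subr_eq0 addrC addKr (_ : 0 = 0%:C) // (inj_eq (@complexI R)).
by rewrite gt_eqF // divr_gt0.
Qed.

End Hilbert.

(** * The functions s_gamma, the kernel formula and the canonical extensions *)

Section SFun.
Variables (R : realType) (e : CC R -> CC R).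
Local Notation Im z := (@complex.Im (Real.sort R) z).
Implicit Types (z w : CC R).
Local Notation a := (s_fun e (pi / 2)).
Local Notation s := (s_fun e 0).

Lemma numiE : @Num.imaginary R[i] = 'i%C. Proof. by []. Qed.

Lemma conj_i : conjc 'i%C = - 'i%C :> CC R.
Proof. by rewrite /conjc /=; apply/eqP; rewrite eq_complex /= oppr0 !eqxx. Qed.

Lemma mul_ii : 'i%C * 'i%C = -1 :> CC R.
Proof. by rewrite -numiE -expr2 sqrCi. Qed.

Lemma conj2 : conjc 2 = 2 :> CC R.
Proof. exact: rmorph_nat. Qed.

Lemma re_im (x y : R) : (x +i* y) = x%:C + 'i%C * y%:C :> CC R.
Proof. by apply/eqP; rewrite eq_complex /=; apply/andP; split; apply/eqP; ring. Qed.

Lemma s_cosE z : a z = - (e z + sharp e z) / 2.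
Proof.
rewrite /s_fun cos_pihalf sin_pihalf (_ : 0 -i* 1 = - 'i%C); last first.
  by rewrite -conj_i.
have -> : 'i%C / 2 * ('i%C * e z - - 'i%C * sharp e z) =
  'i%C * 'i%C * (e z + sharp e z) / 2 :> CC R by ring.
by rewrite mul_ii mulN1r.
Qed.

Lemma s_sinE z : s z = 'i%C / 2 * (e z - sharp e z).
Proof.
by rewrite /s_fun cos0 sin0 oppr0 (_ : 1 +i* 0 = 1) // !mul1r.
Qed.

Lemma s_funE gamma z : s_fun e gamma z = (cos gamma)%:C * s z + (sin gamma)%:C * a z.
Proof.
rewrite s_cosE s_sinE /s_fun (re_im (cos _)) (re_im _ (- sin _)).
have -> : (- sin gamma)%:C = - (sin gamma)%:C :> CC R by exact: rmorphN.
move: (e z) (sharp e z) ((cos gamma)%:C : CC R) ((sin gamma)%:C : CC R) => x y c d.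
have -> : d * (- (x + y) / 2) = 'i%C * 'i%C * d * (x + y) / 2 by rewrite mul_ii; ring.
by ring.
Qed.

Lemma s_cosJ z : a (conjc z) = conjc (a z).
Proof.
rewrite !s_cosE !(conj2, cconjM, cconjN, cconjD, cconjV) /sharp ?numconjE !cconjK.
by rewrite (addrC (e _)).
Qed.

Lemma s_sinJ z : s (conjc z) = conjc (s z).
Proof.
rewrite !s_sinE !(conj2, conj_i, cconjM, cconjB, cconjV) /sharp ?numconjE !cconjK.
by rewrite mulNr mulNr -mulrN opprB.
Qed.

Hypothesis e_HB : hermite_biehler e.

(** The two terms of [s_gamma] have the moduli of [e] and of [sharp e], which differ off
the real line. *)
Lemma s_fun_neq0 gamma w : Im w != 0 -> s_fun e gamma w != 0.
Proof.
suff H w' : Im w' != 0 -> nm (sharp e w') != nm (e w').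
  move=> /H; apply: contra => /eqP; rewrite /s_fun => /eqP.
  rewrite mulf_eq0 mulf_eq0 -nm_eq0 nmi oner_eq0 invr_eq0 (negPf (two_neq0 R)) /=.
  rewrite subr_eq0 => /eqP /(congr1 (@nm R)); rewrite !nmM.
  have nmc (y : R) : y = sin gamma \/ y = - sin gamma -> nm (cos gamma +i* y) = 1.
    move=> Hy; apply/eqP; rewrite -(@eqrXn2 _ 2) ?nm_ge0 // expr1n nm_sqr /=.
    by case: Hy => ->; rewrite ?sqrrN cos2Dsin2.
  by rewrite !nmc; [rewrite !mul1r => ->|right|left].
move=> w0; case: (ltgtP (Im w') 0) w0 => // w0 _.
  have h : 0 < Im (conjc w') by case: (w') w0 => x y /=; rewrite oppr_gt0.
  have := HB_lt e_HB h; rewrite /sharp ?numconjE cconjK !nmJ => H.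
  by rewrite gt_eqF.
by rewrite lt_eqF // HB_lt.
Qed.

End SFun.

Section KernelFormula.
Variables (R : realType) (B : dBSpace R) (e : CC R -> CC R).
Local Notation Im z := (@complex.Im (Real.sort R) z).
Local Notation ip := (@dB_ip R B).
Local Notation ev := (@dB_ev R B).
Local Notation k := (@dB_kernel R B).
Implicit Types (f g h : B) (z w v c : CC R).
Hypothesis e_HB : hermite_biehler e.
Hypothesis e_real : forall x : R, e x%:C != 0.
Hypothesis B_eq : isometric_to_deBranges B e.
Local Notation a := (s_fun e (pi / 2)).
Local Notation s := (s_fun e 0).

Lemma ev_in_deBranges f : in_deBranges e (ev f).
Proof.
case: B_eq => rg _; have : range (dB_ev (d:=B)) (ev f) by exists f.
by rewrite rg.
Qed.

Lemma ip_real_eq f1 f2 g1 g2 :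
  (forall x : R, conjc (ev f1 x%:C) * ev g1 x%:C = conjc (ev f2 x%:C) * ev g2 x%:C) ->
  ip f1 g1 = ip f2 g2.
Proof.
move=> H; case: B_eq => _ E; rewrite !E /ip_deBranges; congr complex_integral.
by apply/funext => x; rewrite ?numconjE H.
Qed.

(** A reproducing function in B(e) is the kernel of [B], since the two spaces are
isometric and the kernel is unique. *)
Lemma kernel_of_reproducing w (K : CC R -> CC R) : in_deBranges e K ->
  (forall F : CC R -> CC R, in_deBranges e F -> ip_deBranges e K F = F w) -> ev (k w) = K.
Proof.
move=> KB HK; case: (B_eq) => rg E.
have : range (dB_ev (d:=B)) K by rewrite rg.
move=> [q _ qK]; rewrite -qK; congr (ev _); apply: ip_inj => h.
rewrite ipC [RHS]ipC -ev_kernel E qK HK //; exact: ev_in_deBranges.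
Qed.

Lemma s_cos_sin_herm z w : 2 * (a z * conjc (s w) - s z * conjc (a w)) =
  'i%C * (e z * conjc (e w) - sharp e z * conjc (sharp e w)).
Proof.
rewrite !s_cosE !s_sinE !(conj2, conj_i, cconjM, cconjN, cconjD, cconjB, cconjV).
by field.
Qed.

(** For [w] in the lower half plane the kernel is obtained from the one at [conj w] by
conjugation. *)
Lemma kernel_formula w z : Im w != 0 ->
  pi%:C * (z - conjc w) * ev (k w) z = a z * conjc (s w) - s z * conjc (a w).
Proof.
move=> w0; apply: (mulfI (two_neq0 R)); rewrite 2!mulrA s_cos_sin_herm.
move: w0; case: ltgtP => // w0 _.
  have h : 0 < Im (conjc w) by case: (w) w0 => x y /=; rewrite oppr_gt0.
  have [K [KB KE _ Kf]] := deBranges_kernel e_HB e_real h.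
  rewrite (@kernel_of_reproducing w (sharp K)); last first.
  - by move=> f /Kf; rewrite ?numconjE cconjK.
  - exact: in_deBranges_sharp.
  have /(congr1 conjc) := KE (conjc z).
  rewrite /sharp ?numconjE !(conj2, conj_i, conjc_real, cconjM, cconjB) !cconjK => ->.
  by rewrite mulNr -mulrN opprB.
have [K [KB KE Kf _]] := deBranges_kernel e_HB e_real w0.
by rewrite (@kernel_of_reproducing w K) // KE.
Qed.

Lemma kernel_formula_conj w z : Im w != 0 ->
  pi%:C * (z - conjc w) * ev (k w) z = a z * s (conjc w) - s z * a (conjc w).
Proof. by rewrite s_cosJ s_sinJ; exact: kernel_formula. Qed.

Lemma kernel_formula_i z :
  pi%:C * (z + 'i%C) * ev (k 'i%C) z = a z * conjc (s 'i%C) - s z * conjc (a 'i%C).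
Proof.
have := @kernel_formula ('i%C : CC R) z (oner_neq0 _).
by rewrite conj_i opprK.
Qed.

Lemma kernel_formula_Ni z :
  pi%:C * (z - 'i%C) * ev (k (- 'i%C)) z = a z * s 'i%C - s z * a 'i%C.
Proof.
have i0 : Im (- 'i%C : CC R) != 0 by rewrite /= oppr_eq0 oner_neq0.
have := kernel_formula_conj z i0.
by rewrite cconjN conj_i !opprK.
Qed.

Lemma sub_conj_neq0 v : Im v != 0 -> v - conjc v != 0.
Proof.
apply: contra => /eqP /(congr1 (@complex.Im R)); rewrite cImB cIm_conj opprK /=.
by rewrite -mulr2n => /eqP; rewrite mulrn_eq0.
Qed.

(** The kernel formula on the diagonal gives a multiple of [|e|^2 - |sharp e|^2]. *)
Lemma kernel_diag_neq0 v : Im v != 0 -> ev (k v) v != 0.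
Proof.
move=> v0; apply/eqP => H.
have := kernel_formula v v0; rewrite H mulr0 => /(congr1 ( *%R 2)).
rewrite mulr0 s_cos_sin_herm => /esym /eqP.
rewrite mulf_eq0 -nm_eq0 nmi oner_eq0 /= !conj_mul_nm -rmorphB -nm_eq0 nm_real.
rewrite normr_eq0 subr_eq0 eqrXn2 ?nm_ge0 // => /eqP E.
have h (u : CC R) : 0 < Im u -> nm (e u) = nm (sharp e u) -> False.
  by move=> /(HB_lt e_HB) + E1; rewrite E1 ltxx.
move: v0; case: ltgtP => // v0 _; last exact: h v0 E.
apply: (h (conjc v)); first by rewrite cIm_conj oppr_gt0.
by move: E; rewrite /sharp ?numconjE cconjK !nmJ.
Qed.

(** The graph of the canonical extension [S_(pi/2)], without a base point. *)
Definition S_pihalf : set (B * B) :=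
  [set p | exists c, forall z, ev p.2 z = z * ev p.1 z + c * a z].

(** The base point disappears: the constant is [f(w) / s_gamma(w)], and conversely
[f] is the second component minus [w] times the first. *)
Lemma can_extP gamma w (p : B * B) : Im w != 0 ->
  can_ext e w gamma p <->
  exists c, forall z, ev p.2 z = z * ev p.1 z + c * s_fun e gamma z.
Proof.
move=> w0; have sw := s_fun_neq0 e_HB gamma w0; split.
  move=> [f [_ E]]; exists (ev f w / s_fun e gamma w) => z.
  by rewrite E; congr (_ + _); rewrite mulrA mulrAC.
move=> [c E]; exists (p.2 - w *: p.1).
have Ew : ev (p.2 - w *: p.1) w = c * s_fun e gamma w.
  by rewrite evB evZ E addrAC subrr add0r.
split=> z; last first.
  by rewrite Ew E; move: (s_fun e gamma w) sw => x x0; congr (_ + _); field.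
rewrite -subr_eq0 => zw; rewrite Ew evB evZ E.
by move: (s_fun e gamma w) sw => x x0; field; rewrite zw x0.
Qed.

Lemma can_ext_pihalf w : Im w != 0 -> can_ext e w (pi / 2) = S_pihalf.
Proof. by move=> w0; apply/seteqP; split=> p; [move/(can_extP _ _ w0)|move=> ?; apply/(can_extP _ _ w0)]. Qed.

Lemma S_pihalf_linear c (g1 h1 g2 h2 : B) : S_pihalf (g1, h1) -> S_pihalf (g2, h2) ->
  S_pihalf (c *: g1 + g2, c *: h1 + h2).
Proof.
move=> [c1 E1] [c2 E2]; exists (c * c1 + c2) => z /=.
by rewrite !evDZ E1 E2 /=; ring.
Qed.

(** At [z = v] the equation determines the constant, and then the function off [v]. *)
Lemma S_pihalf_uniq v (f g1 g2 : B) : Im v != 0 ->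
  S_pihalf (g1, f + v *: g1) -> S_pihalf (g2, f + v *: g2) -> g1 = g2.
Proof.
move=> v0 [c1 E1] [c2 E2]; have av := s_fun_neq0 e_HB (pi / 2) v0.
have E1v := E1 v; have E2v := E2 v; rewrite /= !evD !evZ !(addrC _ (v * _)) in E1v, E2v.
move/addrI: E1v => E1v; move/addrI: E2v => E2v.
have c12 : c1 = c2 by apply: (mulIf av); rewrite -E1v.
apply: (@ev_eq_off _ _ v) => z; rewrite -subr_eq0 => zv.
have {}E1 := E1 z; have {}E2 := E2 z; rewrite /= !evD !evZ in E1, E2.
have F c (g : B) : ev f z + v * ev g z = z * ev g z + c * a z ->
    (z - v) * ev g z = ev f z - c * a z.
  move=> E; have -> : ev f z = z * ev g z + c * a z - v * ev g z by rewrite -E addrK.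
  by ring.
by apply: (mulfI zv); rewrite (F _ _ E1) (F _ _ E2) c12.
Qed.

(** The coefficient makes the terms in [s] of the kernel formulas at [z0] and [conj v]
cancel, so that only a multiple of [a] remains. *)
Lemma S_pihalf_kernel v z0 : Im v != 0 -> Im z0 != 0 -> conjc z0 != v ->
  let g := (conjc z0 - v)^-1 *: (k z0 - (a (conjc z0) / a v) *: k (conjc v)) in
  S_pihalf (g, k z0 + v *: g).
Proof.
move=> v0 z00 zv g; exists (ev (k z0) v / a v) => z /=.
have av := s_fun_neq0 e_HB (pi / 2) v0.
have v0' : Im (conjc v) != 0 by rewrite cIm_conj oppr_eq0.
have zv' : conjc z0 - v != 0 by rewrite subr_eq0.
have Kz := kernel_formula_conj z z00; have Kv := kernel_formula_conj v z00.
have Kvz := kernel_formula_conj z v0'; rewrite cconjK in Kvz.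
rewrite evD evZ /g evZ evB evZ.
apply: (mulfI (pi_neq0 R)).
move: Kz Kv Kvz zv' av.
move: (ev (k z0) z) (ev (k z0) v) (ev (k (conjc v)) z) (pi%:C : CC R).
move: (conjc z0) (a z) (s z) (a (conjc z0)) (s (conjc z0)) (a v) (s v).
move=> z1 az sz a0 s0 av sv X Y Z P KX KY KZ z1v av0.
apply/eqP; rewrite -subr_eq0; apply/eqP.
transitivity ((z1 - v)^-1 * ((P * (z - v) * Z - (az * sv - sz * av)) * a0 / av
  - (P * (z - z1) * X - (az * s0 - sz * a0))
  + (P * (v - z1) * Y - (av * s0 - sv * a0)) * az / av)); last first.
  by rewrite KX KY KZ !(subrr, mul0r, subr0, addr0, mulr0).
by field; rewrite z1v av0.
Qed.

End KernelFormula.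

(** * Resolvents and symmetry *)

Local Opaque s_fun.

Section SelfAdjoint.
Variables (R : realType) (B : dBSpace R) (e : CC R -> CC R).
Local Notation Im z := (@complex.Im (Real.sort R) z).
Local Notation ip := (@dB_ip R B).
Local Notation ev := (@dB_ev R B).
Local Notation k := (@dB_kernel R B).
Implicit Types (f g h : B) (z w v c : CC R).
Hypothesis e_HB : hermite_biehler e.
Hypothesis e_real : forall x : R, e x%:C != 0.
Hypothesis B_eq : isometric_to_deBranges B e.
Local Notation a := (s_fun e (pi / 2)).
Local Notation s := (s_fun e 0).

Lemma divide_zero v f : Im v != 0 -> ev f v = 0 ->
  exists g, forall z, (z - v) * ev g z = ev f z.
Proof.
move=> v0 fv; have [g0 [Hg _]] := dB_move_zero v0 fv.
have vv := sub_conj_neq0 v0.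
exists ((v - conjc v)^-1 *: (g0 - f)) => z; rewrite evZ evB.
have [->|zv] := eqVneq z v; first by rewrite subrr mul0r fv.
rewrite Hg // ?numconjE; move: zv vv; rewrite -subr_eq0.
by move: (conjc v) (ev f z) => v' x zv vv; field; rewrite zv vv.
Qed.

Lemma divide_zero_S_pihalf v f g : (forall z, (z - v) * ev g z = ev f z) ->
  S_pihalf e (g, f + v *: g).
Proof.
move=> H; exists 0 => z /=; rewrite evD evZ -H; ring.
Qed.

Lemma kernel_split v f : Im v != 0 -> exists c f0, f = c *: k v + f0 /\ ev f0 v = 0.
Proof.
move=> v0; have kv := kernel_diag_neq0 e_HB e_real B_eq v0.
exists (ev f v / ev (k v) v), (f - (ev f v / ev (k v) v) *: k v).
split; first by rewrite addrC subrK.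
by rewrite evB evZ divfK // subrr.
Qed.

Lemma conj_neq v : Im v != 0 -> conjc v != v.
Proof. by move=> /sub_conj_neq0; rewrite subr_eq0 eq_sym. Qed.

(** A vector is a multiple of the kernel at [v], for which the resolvent is explicit,
plus a vector vanishing at [v], which can be divided by [z - v]. *)
Lemma S_pihalf_resolvent_ex v f : Im v != 0 -> exists g, S_pihalf e (g, f + v *: g).
Proof.
move=> v0; have [c [f0 [-> f0v]]] := kernel_split f v0.
have [g0 Hg0] := divide_zero v0 f0v.
have /= A1 := S_pihalf_kernel e_HB e_real B_eq v0 v0 (conj_neq v0).
set g1 : B := (_ *: _) in A1.
exists (c *: g1 + g0).
have := S_pihalf_linear c A1 (divide_zero_S_pihalf Hg0).
congr (S_pihalf e (_, _)).
rewrite !scalerDr !scalerA (mulrC v); rewrite addrACA; congr (_ + (_ + _)).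
Qed.

(** Both sides are the value at [z0] of [(f2 - (f2(v) / a(v)) a) / (z - v)]. *)
Lemma S_pihalf_kernel_adj v z0 g1 f2 g2 : Im v != 0 -> Im z0 != 0 -> z0 != v ->
  S_pihalf e (g1, k z0 + conjc v *: g1) -> S_pihalf e (g2, f2 + v *: g2) ->
  ip g1 f2 = ip (k z0) g2.
Proof.
move=> v0 z00 zv A1 [c E].
have v0' : Im (conjc v) != 0 by rewrite cIm_conj oppr_eq0.
have zv' : conjc z0 != conjc v.
  by apply: contra zv => /eqP /(congr1 conjc); rewrite !cconjK => ->.
rewrite (S_pihalf_uniq e_HB v0' A1 (S_pihalf_kernel e_HB e_real B_eq v0' z00 zv')).
have Ja u : conjc (a (conjc u)) = a u by rewrite -s_cosJ cconjK.
rewrite ipZl ipBl ipZl -!ev_kernel !cconjK cconjV cconjB !cconjK (cconjM (a _)) cconjV !Ja.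
have Ez := E z0; have Ev := E v; rewrite /= !evD !evZ in Ez, Ev.
have av := s_fun_neq0 e_HB (pi / 2) v0.
have {}Ev : ev f2 v = c * a v by rewrite -(addrK (v * ev g2 v) (ev f2 v)) Ev addrC addKr.
have {}Ez : ev f2 z0 = z0 * ev g2 z0 + c * a z0 - v * ev g2 z0 by rewrite -Ez addrK.
rewrite Ez Ev; move: zv; rewrite -subr_eq0 => zv.
by move: (a v) (a z0) av => x y x0; field; rewrite zv x0.
Qed.

(** Both vectors are split as in [kernel_split].  For two vectors with zeros, the
integrands of the two inner products coincide on the real line; the other
cases are instances of [S_pihalf_kernel_adj]. *)
Lemma S_pihalf_resolvent_adj v f1 g1 f2 g2 : Im v != 0 ->
  S_pihalf e (g1, f1 + conjc v *: g1) -> S_pihalf e (g2, f2 + v *: g2) -> ip g1 f2 = ip f1 g2.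
Proof.
move=> v0 A1 A2; have v0' : Im (conjc v) != 0 by rewrite cIm_conj oppr_eq0.
have vv := conj_neq v0.
have [c2 [f20 [E2 f20v]]] := kernel_split f2 v0.
have [c1 [f10 [E1 f10v]]] := kernel_split f1 v0'.
have [h1 A1'] := S_pihalf_resolvent_ex (k (conjc v)) v0'.
have [h2 A2'] := S_pihalf_resolvent_ex (k v) v0.
have [g10 H10] := divide_zero v0' f10v.
have [g20 H20] := divide_zero v0 f20v.
have A10 := divide_zero_S_pihalf H10; have A20 := divide_zero_S_pihalf H20.
have lin v' c (x y x' y' : B) : c *: (x + v' *: x') + (y + v' *: y') =
    (c *: x + y) + v' *: (c *: x' + y').
  by rewrite !scalerDr !scalerA (mulrC v') addrACA.
have -> : g1 = c1 *: h1 + g10.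
  apply: (S_pihalf_uniq e_HB v0' A1); have := S_pihalf_linear c1 A1' A10.
  by rewrite lin -E1.
have G2 : g2 = c2 *: h2 + g20.
  apply: (S_pihalf_uniq e_HB v0 A2); have := S_pihalf_linear c2 A2' A20.
  by rewrite lin -E2.
rewrite E1 !ipDl !ipZl -(S_pihalf_kernel_adj v0 v0' vv A1' A2).
congr (_ + _); rewrite E2 G2 !ipDr !ipZr; congr (_ * _ + _); last first.
  apply: (ip_real_eq B_eq) => x; rewrite -H10 -H20 !cconjM cconjB cconjK conjc_real.
  by ring.
rewrite ipC [RHS]ipC.
have A2k : S_pihalf e (h2, k v + conjc (conjc v) *: h2) by rewrite cconjK.
by rewrite (S_pihalf_kernel_adj v0' v0 _ A2k A10) // eq_sym.
Qed.

Lemma S_pihalf_sym g1 h1 g2 h2 : S_pihalf e (g1, h1) -> S_pihalf e (g2, h2) -> ip g1 h2 = ip h1 g2.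
Proof.
move=> A1 A2; have i0 : Im ('i%C : CC R) != 0 by rewrite /= oner_neq0.
have B1 : S_pihalf e (g1, (h1 - conjc 'i%C *: g1) + conjc 'i%C *: g1) by rewrite subrK.
have B2 : S_pihalf e (g2, (h2 - 'i%C *: g2) + 'i%C *: g2) by rewrite subrK.
have := S_pihalf_resolvent_adj i0 B1 B2.
by rewrite ipBr ipBl ipZr ipZl cconjK => /addIr.
Qed.

(** For [v = i] and [v = - i] the cross terms cancel by symmetry. *)
Lemma S_pihalf_norm (g h : B) v : v * v = -1 -> conjc v = - v -> S_pihalf e (g, h) ->
  nv (h + v *: g) ^+ 2 = nv h ^+ 2 + nv g ^+ 2.
Proof.
move=> vv vJ A1; apply: (@complexI R); rewrite -ip_nv rmorphD /= -!ip_nv.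
have E := S_pihalf_sym A1 A1.
rewrite ipDl !ipDr !ipZl !ipZr vJ E.
rewrite mulNr mulrA (mulNr v v) vv opprK mul1r.
by rewrite addrA -(addrA (ip h h)) subrr addr0.
Qed.

End SelfAdjoint.

(** * Density of the domain of multiplication; the dual norms *)

Section App.
Variables (R : realType) (B : dBSpace R) (A : set (B * B)).

Lemma app_unique f g : (forall h, A (f, h) -> h = g) -> A (f, g) -> app A f = g.
Proof.
move=> H fg; apply: H.
exact: (@xgetPex _ 0 [set g | A (f, g)] (ex_intro _ g fg)).
Qed.

End App.

Section Density.
Variables (R : realType) (B : dBSpace R) (e : CC R -> CC R).
Local Notation Im z := (@complex.Im (Real.sort R) z).
Local Notation ip := (@dB_ip R B).
Local Notation ev := (@dB_ev R B).
Local Notation k := (@dB_kernel R B).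
Implicit Types (f g h : B) (z w v c : CC R).
Hypothesis e_HB : hermite_biehler e.
Hypothesis e_real : forall x : R, e x%:C != 0.
Hypothesis B_eq : isometric_to_deBranges B e.
Hypothesis S_dense : dense ((mul_op (B := B)).`1).
Local Notation a := (s_fun e (pi / 2)).
Local Notation s := (s_fun e 0).

Lemma dense_ip_eq0 (D : set B) f : dense D -> (forall u, D u -> ip f u = 0) -> f = 0.
Proof.
move=> dD H; apply: (@nv_small_eq _ _ f 0) => eps e0; rewrite subr0.
have [u Du fu] := dense_nv dD f e0.
have := cauchy_schwarz f (f - u); rewrite ipBr (H u Du) subr0 ip_nv nm_real.
rewrite ger0_norm ?sqr_ge0 // expr2 => H2.
have [->|f0] := eqVneq (nv f) 0; first exact: ltW.
have fp : 0 < nv f by rewrite lt_def f0 nv_ge0.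
by apply: le_trans (ltW fu); rewrite -(ler_pM2l fp).
Qed.

Lemma mul_op_sub_S_pihalf (p : B * B) : mul_op p -> S_pihalf e p.
Proof. by move=> E; exists 0 => z; rewrite E mul0r addr0. Qed.

(** This is where the density of the domain of multiplication enters. *)
Lemma S_adj_fun g h1 h2 : S_adj (g, h1) -> S_adj (g, h2) -> h1 = h2.
Proof.
move=> H1 H2; apply/eqP; rewrite -subr_eq0; apply/eqP.
apply: (dense_ip_eq0 S_dense) => u [u' Hu].
by have := H1 _ Hu; rewrite (H2 _ Hu) /= ipBl => ->; rewrite subrr.
Qed.

Lemma S_adj0 : S_adj (0 : B, 0 : B).
Proof. by move=> q _; rewrite /= [LHS]ipC [RHS]ipC !ip0r. Qed.

Lemma S_adj_linear c g1 h1 g2 h2 : @S_adj R B (g1, h1) -> @S_adj R B (g2, h2) ->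
  @S_adj R B (c *: g1 + g2, c *: h1 + h2).
Proof.
move=> H1 H2 q qS; have := H1 q qS; have := H2 q qS => /= E1 E2.
by rewrite !ipDl !ipZl E1 E2.
Qed.

Lemma S_adj_kernel z : S_adj (k z, conjc z *: k z).
Proof. by move=> q qS /=; rewrite ipZl -!ev_kernel qS cconjK. Qed.

Lemma S_pihalf_sub_S_adj (p : B * B) : S_pihalf e p -> S_adj p.
Proof.
case: p => g h A1 [q1 q2] /mul_op_sub_S_pihalf A2 /=.
exact: (S_pihalf_sym e_HB e_real B_eq A1 A2).
Qed.

Lemma app_S_adj g h : S_adj (g, h) -> app (@S_adj R B) g = h.
Proof. by move=> gh; apply: app_unique => // h' gh'; exact: S_adj_fun gh' gh. Qed.

Lemma app_S_pihalf g h : S_pihalf e (g, h) -> app (@S_pihalf R B e) g = h.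
Proof.
move=> gh; apply: app_unique => // h' gh'.
exact: S_adj_fun (S_pihalf_sub_S_adj gh') (S_pihalf_sub_S_adj gh).
Qed.

Local Notation rsv := (resolvent (@S_pihalf R B e)).

Lemma resolvent_uniq v f g : Im v != 0 -> S_pihalf e (g, f + v *: g) -> rsv v f = g.
Proof.
move=> v0 A1; apply: app_unique => // g' A2.
exact: (S_pihalf_uniq e_HB v0 A2 A1).
Qed.

Lemma resolvent_spec v f : Im v != 0 -> S_pihalf e (rsv v f, f + v *: rsv v f).
Proof.
move=> v0; have [g Hg] := S_pihalf_resolvent_ex e_HB e_real B_eq f v0.
by rewrite (resolvent_uniq v0 Hg).
Qed.

Lemma resolvent_linear v : Im v != 0 -> linear (rsv v).
Proof.
move=> v0 c f g; apply: resolvent_uniq => //.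
have := S_pihalf_linear c (resolvent_spec f v0) (resolvent_spec g v0).
by rewrite !scalerDr !scalerA (mulrC v) addrACA.
Qed.

Lemma Im_i_neq0 : Im ('i%C : CC R) != 0. Proof. by rewrite /= oner_neq0. Qed.
Lemma Im_Ni_neq0 : Im (- 'i%C : CC R) != 0.
Proof. by rewrite /= oppr_eq0 oner_neq0. Qed.

Lemma inv_sqr_add1E f :
  inv_sqr_add1 (@S_pihalf R B e) f = rsv 'i%C (rsv (- 'i%C) f).
Proof.
have Ay := resolvent_spec f Im_Ni_neq0; set y := rsv (- 'i%C) f in Ay *.
have Ax := resolvent_spec y Im_i_neq0; set x := rsv 'i%C y in Ax *.
have iiB (g : B) : 'i%C *: ('i%C *: g) = - g by rewrite scalerA mul_ii scaleN1r.
apply: app_unique => [p2 [g' /= [A1 A2]]|].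
  have A3 := S_pihalf_linear (- 'i%C) A1 A2.
  have E : S_pihalf e (- 'i%C *: p2 + g', f + (- 'i%C) *: (- 'i%C *: p2 + g')).
    move: A3; congr (S_pihalf e (_, _)).
    rewrite scalerDr !scaleNr !scalerN opprK iiB addrCA; congr (_ + _); exact: addrC.
  have yE := S_pihalf_uniq e_HB Im_Ni_neq0 E Ay.
  apply: (S_pihalf_uniq e_HB Im_i_neq0 _ Ax); rewrite -yE scaleNr addrC addrA.
  by rewrite addrN add0r.
exists (y + 'i%C *: x); split=> //=.
have := S_pihalf_linear 'i%C Ax Ay; congr (S_pihalf e (_, _)); first exact: addrC.
by rewrite scalerDr iiB scaleNr (addrC f) addrACA addrN add0r addrC.
Qed.

(** [(A^2 + 1)^-1 = R(i) R(-i)], and [R(i)] is the adjoint of [R(-i)]. *)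
Lemma norm_m2E f : norm_m2 (@S_pihalf R B e) f = `|rsv (- 'i%C) f|.
Proof.
rewrite /norm_m2 inv_sqr_add1E.
have H1 := resolvent_spec f Im_Ni_neq0; rewrite -{2}conj_i in H1.
have H2 := resolvent_spec (rsv (- 'i%C) f) Im_i_neq0.
rewrite -(S_pihalf_resolvent_adj e_HB e_real B_eq Im_i_neq0 H1 H2) dB_ip_norm.
by rewrite sqrCK.
Qed.

(** The graph norm of the adjoint of multiplication at [h], where [h'] is the value at
[h] of that adjoint. *)
Definition graph_norm (h h' : B) : R := Num.sqrt (nv h' ^+ 2 + nv h ^+ 2).

Lemma graph_norm_ge0 h h' : 0 <= graph_norm h h'.
Proof. exact: sqrtr_ge0. Qed.

Definition dual_norm f : R := complex.Re (norm_Fm1 f).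

Lemma ip_F1E h h' : S_adj (h, h') -> ip_F1 h h = (graph_norm h h' ^+ 2)%:C.
Proof.
move=> /app_S_adj E; rewrite /ip_F1 E !ip_nv -rmorphD /= sqr_sqrtr //.
by rewrite addr_ge0 ?sqr_ge0.
Qed.

Lemma graph_norm_ge h h' : nv h <= graph_norm h h' /\ nv h' <= graph_norm h h'.
Proof.
split; rewrite -(@ler_pXn2r _ 2) ?nnegrE ?nv_ge0 ?graph_norm_ge0 //.
  by rewrite sqr_sqrtr ?addr_ge0 ?sqr_ge0 // lerDr sqr_ge0.
by rewrite sqr_sqrtr ?addr_ge0 ?sqr_ge0 // lerDl sqr_ge0.
Qed.

Lemma dual_norm_le f (M : R) :
  (forall h h', S_adj (h, h') -> graph_norm h h' <= 1 -> nm (ip f h) <= M) ->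
  dual_norm f <= M.
Proof.
move=> H; rewrite /dual_norm /=; apply: ge_sup.
  exists (complex.Re `|ip f 0|), 0 => //.
  have A0 := S_adj0.
  split; first by exists 0.
  rewrite (ip_F1E A0) /graph_norm nv0 !expr0n /= addr0 sqrtr0 expr0n.
  by rewrite lecR.
move=> _ [h [[h' hh'] h1] <-]; apply: (H h h') => //.
move: h1; rewrite (ip_F1E hh') (_ : 1 = 1%:C) // lecR.
by rewrite -[leRHS](expr1n R 2) ler_pXn2r ?nnegrE ?graph_norm_ge0 ?ler01.
Qed.

Lemma dual_norm_has_sup f h h' : S_adj (h, h') -> graph_norm h h' <= 1 ->
  nm (ip f h) <= dual_norm f.
Proof.
move=> hh' h1; rewrite /dual_norm /=; apply: ub_le_sup.
  exists (nv f) => _ [g [[g' gg'] g1] <-].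
  apply: le_trans (cauchy_schwarz f g) _; rewrite ler_piMr ?nv_ge0 //.
  move: g1; rewrite (ip_F1E gg') (_ : 1 = 1%:C) // lecR => g1.
  apply: le_trans (graph_norm_ge g g').1 _.
  by rewrite -(@ler_pXn2r _ 2) ?nnegrE ?graph_norm_ge0 // expr1n.
exists h => //; split; first by exists h'.
by rewrite (ip_F1E hh') (_ : 1 = 1%:C) // lecR expr_le1 ?graph_norm_ge0.
Qed.

Lemma dual_norm_ge f h h' : S_adj (h, h') ->
  nm (ip f h) <= dual_norm f * graph_norm h h'.
Proof.
move=> hh'; have [t0|t0] := eqVneq (graph_norm h h') 0.
  rewrite t0 mulr0; have -> : h = 0.
    apply: nv_eq0; apply/eqP; rewrite eq_le nv_ge0 andbT.
    by have [] := graph_norm_ge h h'; rewrite t0.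
  by rewrite ip0r nm0.
have t1 : 0 < graph_norm h h' by rewrite lt_def t0 graph_norm_ge0.
set t := graph_norm h h' in t0 t1 *.
have A0 := S_adj0.
have := S_adj_linear (t^-1)%:C hh' A0; rewrite !addr0 => A1.
have nt : nm ((t^-1)%:C : CC R) = t^-1 by rewrite nm_real ger0_norm // invr_ge0 ltW.
have G : graph_norm ((t^-1)%:C *: h) ((t^-1)%:C *: h') <= 1.
  rewrite /graph_norm !nvZ nt !exprMn -mulrDr sqrtrM ?sqr_ge0 // sqrtr_sqr.
  rewrite ger0_norm ?invr_ge0 ?(ltW t1) // -/(graph_norm h h') -/t.
  by rewrite mulVf.
have := dual_norm_has_sup f A1 G; rewrite ipZr nmM nt.
by rewrite mulrC ler_pdivrMr.
Qed.

(** Moving multiplication to the other side of the inner product: multiplication is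
bounded from [B] to the dual of the graph space. *)
Lemma dual_norm_mul f g : mul_op (f, g) -> dual_norm g <= nv f.
Proof.
move=> fg; apply: dual_norm_le => h h' hh' h1; rewrite ipC nmJ.
have /= -> := hh' _ fg; apply: le_trans (cauchy_schwarz _ _) _.
rewrite ler_piMl ?nv_ge0 //; exact: le_trans (graph_norm_ge h h').2 h1.
Qed.

Lemma graph_norm_resolvent f (h := rsv 'i%C f) : graph_norm h (f + 'i%C *: h) = nv f.
Proof.
have A1 := resolvent_spec f Im_i_neq0; rewrite -/h in A1.
have vv : - 'i%C * - 'i%C = -1 :> CC R by rewrite mulrNN mul_ii.
have vJ : conjc (- 'i%C) = - - 'i%C :> CC R by rewrite cconjN conj_i.
have := S_pihalf_norm e_HB e_real B_eq vv vJ A1.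
rewrite scaleNr addrK => E; rewrite /graph_norm -E sqrtr_sqr ger0_norm //.
exact: nv_ge0.
Qed.

(** Test the functional on [h = R(i) R(-i) f], whose graph norm is the norm of [R(-i) f]. *)
Lemma resolvent_dual_norm f : nv (rsv (- 'i%C) f) <= dual_norm f.
Proof.
have H1 := resolvent_spec f Im_Ni_neq0; rewrite -{2}conj_i in H1.
set y := rsv _ f in H1 *.
have H2 := resolvent_spec y Im_i_neq0.
have := dual_norm_ge f (S_pihalf_sub_S_adj H2).
rewrite graph_norm_resolvent -(S_pihalf_resolvent_adj e_HB e_real B_eq Im_i_neq0 H1 H2).
rewrite ip_nv nm_real ger0_norm ?sqr_ge0 // expr2.
have [-> _|y0] := eqVneq (nv y) 0; last by rewrite ler_pM2r // lt_def y0 nv_ge0.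
have A0 := S_adj0.
have : nm (ip f 0) <= dual_norm f.
  apply: (dual_norm_has_sup f A0).
  by rewrite /graph_norm nv0 !expr0n /= addr0 sqrtr0.
by rewrite ip0r nm0.
Qed.

End Density.

(** * The pairing with the dual of the graph space *)

Section Sequences.
Variables (R : realType).

Lemma linear_funB (U V : lmodType R[i]) (T : U -> V) x y :
  linear T -> T (x - y) = T x - T y.
Proof. by move=> T_lin; rewrite addrC -scaleN1r T_lin scaleN1r addrC. Qed.

Lemma linear_funZ (U V : lmodType R[i]) (T : U -> V) c x :
  linear T -> T (c *: x) = c *: T x.
Proof.
move=> T_lin; have T0 : T 0 = 0 by rewrite -(subrr 0) linear_funB // subrr.
by rewrite -[c *: x]addr0 T_lin T0 addr0.
Qed.

Lemma dense_sequence (V : normedModType R[i]) (D : set V) v : dense D ->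
  exists u : nat -> V, forall n, D (u n) /\ nv (v - u n) < n.+1%:R^-1.
Proof.
move=> dD.
suff [u Hu] : {u : nat -> V & forall n, D (u n) /\ nv (v - u n) < n.+1%:R^-1}.
  by exists u.
apply: (@choice _ _ (fun n x => D x /\ nv (v - x) < n.+1%:R^-1)) => n.
have n0 : 0 < n.+1%:R^-1 :> R by rewrite invr_gt0.
by have [x Dx Hx] := dense_nv dD v n0; exists x.
Qed.

Lemma inv_small (eps : R) : 0 < eps ->
  exists N, forall n, (N <= n)%N -> n.+1%:R^-1 < eps.
Proof.
move=> e0; have [N _ HN] := near_infty_natSinv_lt (PosNum e0).
by exists N => n Nn; exact: HN.
Qed.

(** The differences of [y] are controlled by those of [x], so [y] is a Cauchy sequence
as [x] converges. *)
Lemma transfer_limit (V : normedModType R[i]) (W : completeNormedModType R[i])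
    (v : V) (x : nat -> V) (y : nat -> W) :
  (forall n, nv (v - x n) < n.+1%:R^-1) ->
  (forall m n, nv (y m - y n) <= nv (x m - x n)) ->
  exists l, forall eps : R, 0 < eps -> exists N, forall n, (N <= n)%N ->
    nv (v - x n) < eps /\ nv (l - y n) < eps.
Proof.
move=> xv yx; have [|l Hl] := @nv_cauchy_cvg _ W y.
  move=> eps e0; have [N HN] := inv_small (divr_gt0 e0 (ltr0Sn R 1)).
  exists N => m n Nm Nn; apply: le_lt_trans (yx m n) _.
  have -> : x m - x n = - (v - x m) + (v - x n) by rewrite opprB addrA subrK.
  apply: le_lt_trans (nvD _ _) _; rewrite nvN [ltRHS]splitr.
  by apply: ltrD; [apply: lt_trans (xv m) (HN _ Nm)|apply: lt_trans (xv n) (HN _ Nn)].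
exists l => eps e0; have [N1 H1] := Hl _ e0; have [N2 H2] := inv_small e0.
exists (maxn N1 N2) => n; rewrite geq_max => /andP[n1 n2]; split.
  exact: lt_trans (xv n) (H2 _ n2).
exact: H1.
Qed.

End Sequences.

Section FMinus1.
Variables (R : realType) (B : dBSpace R) (e : CC R -> CC R).
Local Notation Im z := (@complex.Im (Real.sort R) z).
Local Notation ip := (@dB_ip R B).
Local Notation ev := (@dB_ev R B).
Local Notation k := (@dB_kernel R B).
Implicit Types (f g h : B) (z w v c : CC R).
Hypothesis B_nonzero : exists f : B, f != 0.
Hypothesis e_HB : hermite_biehler e.
Hypothesis e_real : forall x : R, e x%:C != 0.
Hypothesis B_eq : isometric_to_deBranges B e.
Hypothesis S_dense : dense ((mul_op (B := B)).`1).
Local Notation a := (s_fun e (pi / 2)).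
Local Notation s := (s_fun e 0).
Local Notation rsv := (resolvent (@S_pihalf R B e)).
Variables (V1 : completeNormedModType R[i]) (j1 : B -> V1).
Hypothesis j1_completion : is_completion (@norm_Fm1 R B) j1.

Let j1_lin : linear j1. Proof. by case: j1_completion. Qed.
Let j1_dense : dense (range j1). Proof. by case: j1_completion. Qed.
Let j1_nv f : nv (j1 f) = dual_norm f.
Proof. by case: j1_completion => _ H _; rewrite /nv H. Qed.

Lemma pairingF_spec h h' : S_adj (h, h') ->
  continuous (fun psi => pairingF j1 psi h) /\
  forall f, pairingF j1 (j1 f) h = ip f h.
Proof.
move=> hh'; apply: (@xgetPex _ _ [set T : V1 -> CC R | continuous T /\
    forall f, T (j1 f) = dB_ip f h]).
have [u u0] := B_nonzero.
have nu : ip u u != 0 by apply: contra u0 => /eqP /ip_eq0 ->.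
have G0 : 0 <= graph_norm h h' by exact: graph_norm_ge0.
have [|||T' [T'lin _ T'j T'C]] :=
  @bounded_extension _ _ _ B j1 (fun f => ip h f *: u) (graph_norm h h' * nv u)
    j1_lin _ j1_dense.
- by move=> c f g; rewrite ipDZr scalerDl -scalerA.
- by rewrite mulr_ge0 // nv_ge0.
- move=> f; rewrite nvZ j1_nv mulrAC ler_wpM2r ?nv_ge0 // ipC nmJ mulrC.
  exact: dual_norm_ge.
(* the pairing is conjugate linear in its first argument, whereas extensions are
   available for linear maps into a Hilbert space: extend [f |-> <h, f> u] and read
   off the coefficient of u *)
exists (fun psi => conjc (ip u (T' psi) / ip u u)); split; last first.
  by move=> f; rewrite T'j ipZr mulfK // -ipC.
apply: (@lipschitz_continuous _ V1 (CC R) _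
  (nv u * (graph_norm h h' * nv u) / nm (ip u u))) => x y.
have -> : conjc (ip u (T' x) / ip u u) - conjc (ip u (T' y) / ip u u) =
    conjc (ip u (T' (x - y)) / ip u u).
  by rewrite -cconjB -mulrBl -ipBr (linear_funB _ _ T'lin).
rewrite -[nv _]/(nm _) nmJ nmM nmV mulrAC.
rewrite ler_wpM2r ?invr_ge0 ?nm_ge0 //.
by apply: le_trans (cauchy_schwarz _ _) _; rewrite -mulrA ler_wpM2l ?nv_ge0.
Qed.

Lemma ip_continuous_l (V : normedModType R[i]) (T : V -> B) f : continuous T ->
  continuous (fun x => ip (T x) f : CC R).
Proof.
move=> /continuous_nv cT; apply/continuous_nv => x eps e0.
have f1 : 0 < nv f + 1 by rewrite ltr_wpDl ?nv_ge0.
have [d d0 Hd] := cT x _ (divr_gt0 e0 f1); exists d => // y /Hd H.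
rewrite -[nv _]/(nm _) -ipBl; apply: le_lt_trans (cauchy_schwarz _ _) _.
move: H; rewrite ltr_pdivlMr //; apply: le_lt_trans.
by rewrite ler_wpM2l ?nv_ge0 // lerDl.
Qed.

Lemma pairingF_linear psi c h1 h1' h2 h2' : S_adj (h1, h1') -> S_adj (h2, h2') ->
  pairingF j1 psi (c *: h1 + h2) = c * pairingF j1 psi h1 + pairingF j1 psi h2.
Proof.
move=> A1 A2; have [c1 E1] := pairingF_spec A1; have [c2 E2] := pairingF_spec A2.
have [c3 E3] := pairingF_spec (S_adj_linear c A1 A2).
apply: (@continuous_dense_eq _ V1 (CC R) B j1 _
  (fun psi => c * pairingF j1 psi h1 + pairingF j1 psi h2) j1_dense c3).
  move=> x; apply: (@cvgD _ (CC R)); last exact: c2.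
  by apply: (@cvgZr _ (CC R)); exact: c1.
by move=> f; rewrite E1 E2 E3 ipDZr.
Qed.

Lemma pairingF_add psi f h h' : S_adj (h, h') ->
  pairingF j1 (j1 f + psi) h = ip f h + pairingF j1 psi h.
Proof.
move=> A1; have [/continuous_nv c1 E1] := pairingF_spec A1.
apply: (@continuous_dense_eq _ V1 (CC R) B j1
  (fun psi => pairingF j1 (j1 f + psi) h)
  (fun psi => ip f h + pairingF j1 psi h) j1_dense).
- apply/continuous_nv => x eps e0; have [d d0 H] := c1 (j1 f + x) _ e0.
  by exists d => // y yd; apply: H; rewrite opprD addrACA addrN add0r.
- apply/continuous_nv => x eps e0; have [d d0 H] := c1 x _ e0.
  by exists d => // y yd; rewrite opprD addrACA addrN add0r; exact: H.
- move=> g; have -> : j1 f + j1 g = j1 (f + g).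
    by rewrite -[f]scale1r j1_lin !scale1r.
  by rewrite !E1 ipDl.
Qed.

(** When [v_n] in the domain of multiplication [S] tends to [v], the vectors [S v_n]
form a Cauchy sequence for the dual norm ([dual_norm_mul]), and their limit is the
required functional. *)
Lemma pairingF_adjoint_ex (v : B) : exists psi, forall h h', S_adj (h, h') ->
  pairingF j1 psi h = ip v h'.
Proof.
have [u Hu] := dense_sequence v S_dense.
have Hu1 n : exists y, mul_op (u n, y) by have [[y Hy] _] := Hu n; exists y.
have [y Hy] := choice Hu1.
have [||psi Hpsi] := @transfer_limit R B V1 v u (j1 \o y).
- by move=> n; have [] := Hu n.
- move=> m n /=; rewrite -(linear_funB _ _ j1_lin) j1_nv.
  apply: (dual_norm_mul S_dense) => z.
 by rewrite /= !evB Hy Hy /= mulrBr.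
exists psi => h h' A1; have [/continuous_nv cT ET] := pairingF_spec A1.
apply: (@nv_small_eq _ (CC R)) => eps e0.
have e2 : 0 < eps / 2 by rewrite divr_gt0.
have n1 : 0 < nv h' + 1 by rewrite ltr_wpDl ?nv_ge0.
have [d d0 Hd] := cT psi _ e2.
have [|N HN] := Hpsi (Num.min d (eps / 2 / (nv h' + 1))).
  by rewrite lt_min d0 divr_gt0.
have [] := HN N (leqnn _); rewrite !lt_min => /andP[_ H1] /andP[H2 _].
have -> : pairingF j1 psi h - ip v h' =
    (pairingF j1 psi h - pairingF j1 (j1 (y N)) h) + ip (u N - v) h'.
  have <- : ip (u N) h' = pairingF j1 (j1 (y N)) h.
    by rewrite ET ipC [RHS]ipC; congr conjc; rewrite -(A1 _ (Hy N)).
  by rewrite ipBl addrA subrK.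
rewrite [leRHS]splitr; apply: le_trans (nmD _ _) _; apply: lerD.
  by rewrite nmBC; apply/ltW/Hd; rewrite nvBC.
apply: le_trans (cauchy_schwarz _ _) _; rewrite nvBC.
apply: le_trans (_ : nv (v - u N) * (nv h' + 1) <= _).
  by rewrite ler_wpM2l ?nv_ge0 // lerDl.
by rewrite -ler_pdivlMr // ltW.
Qed.

End FMinus1.

(** * The function s_0 as an element of the dual *)

Section Associated.
Variables (R : realType) (B : dBSpace R) (e : CC R -> CC R).
Local Notation Im z := (@complex.Im (Real.sort R) z).
Local Notation ip := (@dB_ip R B).
Local Notation ev := (@dB_ev R B).
Local Notation k := (@dB_kernel R B).
Implicit Types (f g h : B) (z w v c : CC R).
Hypothesis B_nonzero : exists f : B, f != 0.
Hypothesis e_HB : hermite_biehler e.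
Hypothesis e_real : forall x : R, e x%:C != 0.
Hypothesis B_eq : isometric_to_deBranges B e.
Hypothesis S_dense : dense ((mul_op (B := B)).`1).
Local Notation a := (s_fun e (pi / 2)).
Local Notation s := (s_fun e 0).
Local Notation rsv := (resolvent (@S_pihalf R B e)).
Variables (V1 : completeNormedModType R[i]) (j1 : B -> V1).
Hypothesis j1_completion : is_completion (@norm_Fm1 R B) j1.

Local Notation I := ('i%C : CC R).

Let ai : a I != 0. Proof. exact: (s_fun_neq0 e_HB _ (Im_i_neq0 R)). Qed.
Let aiJ : a (- I) = conjc (a I). Proof. by rewrite -s_cosJ conj_i. Qed.
Let siJ : s (- I) = conjc (s I). Proof. by rewrite -s_sinJ conj_i. Qed.
Let aiJ0 : conjc (a I) != 0. Proof. by rewrite conjc_eq0. Qed.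

Let Ki := kernel_formula_i e_HB e_real B_eq.
Let KNi := kernel_formula_Ni e_HB e_real B_eq.

Lemma eq_off_nonreal v f g : Im v != 0 ->
  (forall z, Im z != 0 -> z != v -> ev f z = ev g z) -> f = g.
Proof.
move=> v0 H; apply: dB_ev_inj; apply/funext => z.
(* first the point v is recovered by continuity along a horizontal line, then the
   real line by continuity along vertical lines *)
have nonreal u : Im u != 0 -> ev f u = ev g u.
  move=> u0; have [uv|/(H _ u0)//] := eqVneq u v.
  apply: eq_at_limit; try exact: ev_continuous.
  move=> d d0; have d2 : 0 < d / 2 by rewrite divr_gt0.
  exists (u + (d / 2)%:C).
    by rewrite addrC addKr nm_real ger0_norm ?ltW //; lra.
  apply: H; first by rewrite cImD /= addr0.
  rewrite uv -subr_eq0 addrC addKr (_ : 0 = 0%:C) // (inj_eq (@complexI R)).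
  by rewrite gt_eqF.
have [z0|/nonreal//] := eqVneq (Im z) 0.
apply: eq_at_limit; try exact: ev_continuous.
move=> d d0; have d2 : 0 < d / 2 by rewrite divr_gt0.
exists (z + I * (d / 2)%:C).
  by rewrite addrC addKr nmM nmi mul1r nm_real ger0_norm ?ltW //; lra.
apply: nonreal; rewrite cImD cImM z0 /= mul0r mul1r !add0r.
by rewrite gt_eqF.
Qed.

(** Eliminating [a(z)] between the kernel formulas at [i] and [-i] leaves [s(z)]. *)
Lemma s_sin_assoc : exists u v : B, forall z, s z = ev u z + z * ev v z.
Proof.
set D := a I * conjc (s I) - s I * conjc (a I).
have D0 : D != 0.
  have := Ki I; rewrite -/D => <-; rewrite !mulf_neq0 ?pi_neq0 //.
    by rewrite -mulr2n -mulr_natl mulf_neq0 ?two_neq0 // -nm_eq0 nmi oner_neq0.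
  exact: (kernel_diag_neq0 e_HB e_real B_eq (Im_i_neq0 R)).
exists ((pi%:C / D * I) *: (s I *: k I + conjc (s I) *: k (- I))).
exists ((pi%:C / D) *: (s I *: k I - conjc (s I) *: k (- I))) => z.
rewrite !evZ evD evB !evZ; apply: (mulIf D0).
have -> : (pi%:C / D * I * (s I * ev (k I) z + conjc (s I) * ev (k (- I)) z) +
   z * (pi%:C / D * (s I * ev (k I) z - conjc (s I) * ev (k (- I)) z))) * D =
   s I * (pi%:C * (z + I) * ev (k I) z) - conjc (s I) * (pi%:C * (z - I) * ev (k (- I)) z).
  by move: (pi%:C : CC R) (conjc (s I)) (s I) D D0 => P sJ s0 E E0; field.
by rewrite Ki KNi /D; ring.
Qed.

(** The writing [s = u + z v] exhibits the element: [u] is in [B], and [z v] corresponds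
to the functional of [pairingF_adjoint_ex]. *)
Lemma assoc_eltP z : s z = conjc (pairingF j1 (assoc_elt j1 s) (k z)).
Proof.
suff [psi H] : exists psi, forall z, s z = conjc (pairingF j1 psi (k z)).
  exact: (@xgetPex _ 0 [set psi | forall z, s z = conjc (pairingF j1 psi (k z))]
    (ex_intro _ psi H)).
have [u [v E]] := s_sin_assoc.
have [psi H] := pairingF_adjoint_ex B_nonzero S_dense j1_completion v.
exists (j1 u + psi) => t.
rewrite (pairingF_add B_nonzero S_dense j1_completion psi u (S_adj_kernel t)).
rewrite (H _ _ (S_adj_kernel t)) ipZr cconjD cconjM cconjK.
by rewrite !ip_ker_r !cconjK E.
Qed.

(** By density the pairing of any [psi] with a vector of the form [R(i) f] is the inner
product of [f] with the extension of [R(-i)] at [psi].  For [f = k_z] the vector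
[R(i) f] is a combination of [k_z] and [k_(-i)], on which the pairing with [s] is
known; so the extension of [R(-i)] at [s] is known off the real line, except at [-i], and
continuity gives the rest. *)
Lemma pairingF_s_resolvent f :
  pairingF j1 (assoc_elt j1 s) (rsv I f) = ip (- (pi%:C / conjc (a I)) *: k I) f.
Proof.
set psi := assoc_elt j1 s.
have [j1_lin j1_nm j1_dense] := j1_completion.
have [||That [Tlin Tcont Tj _]] :=
  @bounded_extension _ _ _ B j1 (rsv (- I)) 1 j1_lin
    (resolvent_linear e_HB e_real B_eq (Im_Ni_neq0 R)) j1_dense.
- by [].
- by move=> g; rewrite mul1r /nv j1_nm; exact: resolvent_dual_norm.
have adj chi g : pairingF j1 chi (rsv I g) = ip (That chi) g.
  have A2 := resolvent_spec e_HB e_real B_eq g (Im_i_neq0 R).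
  have [c1 E1] := pairingF_spec B_nonzero S_dense j1_completion
    (S_pihalf_sub_S_adj e_HB e_real B_eq A2).
  have cT := @ip_continuous_l R B V1 That g Tcont.
  apply: (@continuous_dense_eq _ V1 (CC R) B j1 (fun psi => pairingF j1 psi (rsv I g))
    (fun psi => ip (That psi) g) j1_dense c1 cT _ chi).
  move=> g'; rewrite E1 Tj.
  have A1 := resolvent_spec e_HB e_real B_eq g' (Im_Ni_neq0 R).
  rewrite -{2}conj_i in A1.
  by rewrite (S_pihalf_resolvent_adj e_HB e_real B_eq (Im_i_neq0 R) A1 A2).
rewrite adj; congr (ip _ f).
apply: (@eq_off_nonreal (- I)); first exact: Im_Ni_neq0.
move=> z z0 zi.
have zi' : conjc z != I.
  by apply: contra zi => /eqP /(congr1 conjc); rewrite cconjK conj_i => ->.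
have := S_pihalf_kernel e_HB e_real B_eq (Im_i_neq0 R) z0 zi'.
set g := (_ *: _) => /= A1.
have gE : rsv I (k z) = g by exact: (resolvent_uniq e_HB (Im_i_neq0 R) A1).
have kzE : k z = (conjc z - I) *: g + (a (conjc z) / a I) *: k (- I).
  rewrite /g scalerA mulfV ?subr_eq0 // scale1r conj_i subrK.
  done.
have Ag := S_pihalf_sub_S_adj e_HB e_real B_eq A1.
have Ak := S_adj_linear (a (conjc z) / a I) (S_adj_kernel (- I)) (@S_adj0 R B).
rewrite !addr0 in Ak.
have lin := pairingF_linear B_nonzero S_dense j1_completion psi.
have p0 : pairingF j1 psi 0 = 0.
  have := lin (-1) _ _ _ _ (@S_adj0 R B) (@S_adj0 R B).
  by rewrite scaler0 addr0 mulN1r addNr.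
have lin' := lin (a (conjc z) / a I) _ _ _ _ (S_adj_kernel (- I)) (@S_adj0 R B).
rewrite addr0 p0 addr0 in lin'.
have Ep : pairingF j1 psi (k z) = (conjc z - I) * conjc (ev (That psi) z) +
    a (conjc z) / a I * pairingF j1 psi (k (- I)).
  by rewrite {1}kzE (lin _ _ _ _ _ Ag Ak) lin' -gE adj ip_ker_r.
have := assoc_eltP z; rewrite -/psi Ep cconjD (cconjM (_ - I)) cconjB !cconjK conj_i.
rewrite (cconjM (_ / _)) (cconjM (a _)) cconjV -assoc_eltP -s_cosJ cconjK opprK siJ => Es.
have zI : z + I != 0 by rewrite -[I]opprK subr_eq0.
apply: (mulfI zI); rewrite evZ.
have {}Es : (z + I) * ev (That psi) z = s z - a z / conjc (a I) * conjc (s I).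
  by rewrite Es addrK.
rewrite Es; have := Ki z; move: aiJ0 (pi_neq0 R).
move: (conjc (a I)) (conjc (s I)) (ev (k I) z) (pi%:C : CC R) (a z) (s z) => a' s' X P az sz a0 P0 E.
have -> : (z + I) * (- (P / a') * X) = - (P * (z + I) * X) / a' by field.
by rewrite E; field.
Qed.

End Associated.

(** * The completion for the minus-two norm *)

Section Minus2.
Variables (R : realType) (B : dBSpace R) (e : CC R -> CC R).
Local Notation Im z := (@complex.Im (Real.sort R) z).
Local Notation ip := (@dB_ip R B).
Local Notation ev := (@dB_ev R B).
Local Notation k := (@dB_kernel R B).
Implicit Types (f g h : B) (z w v c : CC R).
Hypothesis e_HB : hermite_biehler e.
Hypothesis e_real : forall x : R, e x%:C != 0.
Hypothesis B_eq : isometric_to_deBranges B e.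
Hypothesis S_dense : dense ((mul_op (B := B)).`1).
Local Notation a := (s_fun e (pi / 2)).
Local Notation s := (s_fun e 0).
Local Notation rsv := (resolvent (@S_pihalf R B e)).
Local Notation I := ('i%C : CC R).
Variables (V2 : completeNormedModType R[i]) (j2 : B -> V2).
Hypothesis j2_completion : is_completion (norm_m2 (@S_pihalf R B e)) j2.
Local Notation hat := (resolvent_hat (@S_pihalf R B e) j2).

Let j2_lin : linear j2. Proof. by case: j2_completion. Qed.
Let j2_dense : dense (range j2). Proof. by case: j2_completion. Qed.
Let j2_nv f : nv (j2 f) = nv (rsv (- I) f).
Proof.
by case: j2_completion => _ H _; rewrite /nv H (norm_m2E e_HB e_real B_eq).
Qed.

Lemma resolvent_hat_uniq w (T : V2 -> B) : linear T -> continuous T ->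
  (forall f, T (j2 f) = rsv w f) -> forall phi, hat w phi = T phi.
Proof.
move=> Tlin Tcont Tj.
have [_ c1 E1] : [/\ linear (hat w), continuous (hat w) & forall f, hat w (j2 f) = rsv w f].
  by apply: (@xgetPex _ (fun=> 0) [set T : V2 -> B | [/\ linear T, continuous T &
    forall f, T (j2 f) = rsv w f]]); exists T.
by apply: (continuous_dense_eq j2_dense c1 Tcont) => f; rewrite E1 Tj.
Qed.

Lemma resolvent_hat_Ni : linear (hat (- I)) /\ (forall f, hat (- I) (j2 f) = rsv (- I) f) /\
  forall phi, nv (hat (- I) phi) <= nv phi.
Proof.
have [||T [Tlin Tcont Tj TC]] :=
  @bounded_extension _ _ _ B j2 (rsv (- I)) 1 j2_lin
    (resolvent_linear e_HB e_real B_eq (Im_Ni_neq0 R)) j2_dense.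
- by [].
- by move=> g; rewrite mul1r j2_nv.
have E := resolvent_hat_uniq Tlin Tcont Tj.
split; first by move=> c x y; rewrite !E Tlin.
split=> [f|phi]; first by rewrite E Tj.
by rewrite E -[leRHS]mul1r.
Qed.

(** The resolvent identity persists on the completion. *)
Lemma resolvent_hat_i phi :
  hat I phi = hat (- I) phi + (2 * I) *: rsv I (hat (- I) phi).
Proof.
have [hlin [hj hnv]] := resolvent_hat_Ni.
have rlin := resolvent_linear e_HB e_real B_eq (Im_i_neq0 R).
(* R(i) = U R(-i) with U = 1 + 2 i R(i), the inverse Cayley transform *)
pose U (g : B) := g + (2 * I) *: rsv I g.
have Ulin : linear U.
  move=> c x y; rewrite /U rlin !scalerDr !scalerA (mulrC c) -!addrA.
  by congr (_ + _); rewrite addrCA.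
have Unv g : nv (U g) <= 3 * nv g.
  apply: le_trans (nvD _ _) _; rewrite nvZ nmM nmi mulr1.
  have -> : nm (2 : CC R) = 2 by rewrite -[2 in LHS](rmorph_nat (real_complex R)) nm_real ger0_norm.
  have : nv (rsv I g) <= nv g.
    rewrite -(graph_norm_resolvent e_HB e_real B_eq g).
    by have [] := graph_norm_ge (rsv I g) (g + I *: rsv I g).
  lra.
apply: (@resolvent_hat_uniq I (fun phi => U (hat (- I) phi))).
- by move=> c x y; rewrite hlin Ulin.
- apply: (@lipschitz_continuous _ V2 B _ 3) => x y.
  rewrite -(linear_funB _ _ Ulin) -(linear_funB _ _ hlin).
  by apply: le_trans (Unv _) _; rewrite ler_pM2l.
- move=> f; rewrite hj; apply/esym; apply: (resolvent_uniq e_HB (Im_i_neq0 R)).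
  have A1 := resolvent_spec e_HB e_real B_eq f (Im_Ni_neq0 R).
  set y := rsv (- I) f in A1 *.
  have A2 := resolvent_spec e_HB e_real B_eq y (Im_i_neq0 R).
  rewrite /U; set x := rsv I y in A2 *.
  have := S_pihalf_linear (2 * I) A2 A1; congr (S_pihalf e (_, _)); first exact: addrC.
  rewrite !scalerDr !scalerA addrC -!addrA; congr (_ + _).
  by rewrite addrA -scalerDl (mulrCA I) mulrA; congr (_ *: _ + _ *: _); ring.
Qed.

Lemma S_pihalf_dom_dense : dense ((@S_pihalf R B e).`1).
Proof.
move=> U U0 oU; have [x [Ux [y xy]]] := S_dense U0 oU.
by exists x; split=> //; exists y; exact: mul_op_sub_S_pihalf.
Qed.

(** For the minus-two norm [R(-i)] is isometric, and its range, the domain of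
[S_(pi/2)], is dense. *)
Lemma resolvent_hat_surj g : exists phi, hat (- I) phi = g.
Proof.
have [hlin [hj hnv]] := resolvent_hat_Ni.
have [u Hu] := dense_sequence g S_pihalf_dom_dense.
have Hf n : exists f, rsv (- I) f = u n.
  have [[y Hy] _] := Hu n; exists (y - (- I) *: u n).
  by apply: (resolvent_uniq e_HB (Im_Ni_neq0 R)); rewrite subrK.
have [f fE] := choice Hf.
have [||phi Hphi] := @transfer_limit R B V2 g u (j2 \o f).
- by move=> n; have [] := Hu n.
- move=> m n /=; rewrite -(linear_funB _ _ j2_lin) j2_nv.
  rewrite (linear_funB _ _ (resolvent_linear e_HB e_real B_eq (Im_Ni_neq0 R))).
  by rewrite !fE.
exists phi; apply: nv_small_eq => eps e0.
have [|N HN] := Hphi (eps / 2); first by rewrite divr_gt0.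
have [h1 h2] := HN N (leqnn _).
have -> : hat (- I) phi - g = hat (- I) (phi - j2 (f N)) + (u N - g).
  by rewrite (linear_funB _ _ hlin) hj fE addrA subrK.
rewrite [leRHS]splitr; apply: le_trans (nvD _ _) _; apply: lerD.
  exact: le_trans (hnv _) (ltW h2).
by rewrite nvBC ltW.
Qed.

End Minus2.

(** * The domain of a canonical extension *)

Section Domain.
Variables (R : realType) (B : dBSpace R) (e : CC R -> CC R).
Local Notation Im z := (@complex.Im (Real.sort R) z).
Local Notation Re z := (@complex.Re (Real.sort R) z).
Local Notation ip := (@dB_ip R B).
Local Notation ev := (@dB_ev R B).
Local Notation k := (@dB_kernel R B).
Implicit Types (f g h : B) (z w v c : CC R).
Hypothesis B_nonzero : exists f : B, f != 0.
Hypothesis e_HB : hermite_biehler e.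
Hypothesis e_real : forall x : R, e x%:C != 0.
Hypothesis B_eq : isometric_to_deBranges B e.
Hypothesis S_dense : dense ((mul_op (B := B)).`1).
Local Notation a := (s_fun e (pi / 2)).
Local Notation s := (s_fun e 0).
Local Notation A := (@S_pihalf R B e).
Local Notation rsv := (resolvent A).
Local Notation I := ('i%C : CC R).
Variables (V1 : completeNormedModType R[i]) (j1 : B -> V1).
Hypothesis j1_completion : is_completion (@norm_Fm1 R B) j1.
Variables (V2 : completeNormedModType R[i]) (j2 : B -> V2).
Hypothesis j2_completion : is_completion (norm_m2 A) j2.
Local Notation hat := (resolvent_hat A j2).

Let ai : a I != 0. Proof. exact: (s_fun_neq0 e_HB _ (Im_i_neq0 R)). Qed.
Let aiJ : a (- I) = conjc (a I). Proof. by rewrite -s_cosJ conj_i. Qed.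
Let aiJ0 : conjc (a I) != 0. Proof. by rewrite conjc_eq0. Qed.

Local Notation s2 := (assoc_m2 j1 A j2 s).

Lemma pairing2E phi h h' : A (h, h') ->
  pairing2 A j2 phi h = ip (hat (- I) phi) (h' - I *: h).
Proof. by move=> hh'; rewrite /pairing2 (app_S_pihalf e_HB e_real B_eq S_dense hh'). Qed.

(** A vector [h = R(i) f] of the domain satisfies [A h - i h = f]; so the equality of the
two pairings at all [h] says that both sides have the same inner products
with all [f]. *)
Lemma resolvent_hat_s : hat (- I) s2 = - (pi%:C / conjc (a I)) *: k I.
Proof.
set q := _ *: _.
pose P phi := forall h, A.`1 h -> pairing2 A j2 phi h = pairingF j1 (assoc_elt j1 s) h.
have PE phi h h' : A (h, h') -> pairing2 A j2 phi h = ip (hat (- I) phi) (h' - I *: h) /\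
    pairingF j1 (assoc_elt j1 s) h = ip q (h' - I *: h).
  move=> hh'; split; first exact: pairing2E.
  rewrite -(pairingF_s_resolvent B_nonzero e_HB e_real B_eq S_dense j1_completion).
  by rewrite (@resolvent_uniq R B e e_HB I (h' - I *: h) h (Im_i_neq0 R)) // subrK.
have [phi phiE] := resolvent_hat_surj e_HB e_real B_eq S_dense j2_completion q.
have Pphi : P phi.
  by move=> h [h' hh']; have [-> ->] := PE phi _ _ hh'; rewrite phiE.
have Ps : P s2.
  exact: (@xgetPex _ 0 [set phi | P phi] (ex_intro _ phi Pphi)).
have E f : ip (hat (- I) s2) f = ip q f.
  have A1 := resolvent_spec e_HB e_real B_eq f (Im_i_neq0 R).
  have [] := PE s2 _ _ A1; rewrite addrK => <- <-.
  by apply: Ps; exists (f + I *: rsv I f).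
by apply: ip_inj => f; rewrite ipC E -ipC.
Qed.

(** The vector [m] of the theorem, in terms of kernels. *)
Definition deficiency_vec : B :=
  (- (pi%:C / 2)) *: ((a I)^-1 *: k (- I) + (conjc (a I))^-1 *: k I).

(** The adjoint of multiplication at [m], each kernel being an eigenvector of it. *)
Definition deficiency_val : B :=
  (- (pi%:C / 2)) *: ((I / a I) *: k (- I) - (I / conjc (a I)) *: k I).

Let Ki := kernel_formula_i e_HB e_real B_eq.
Let KNi := kernel_formula_Ni e_HB e_real B_eq.

Let i2_neq0 : I + I != 0.
Proof. by rewrite -mulr2n -mulr_natl mulf_neq0 ?two_neq0 // -nm_eq0 nmi oner_neq0. Qed.

Lemma app_resolvent_s : app A (rsv (- I) (hat I s2)) = deficiency_vec.
Proof.
have iNi : conjc I != I by rewrite conj_i eq_sym -subr_eq0 opprK.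
have Nii : conjc (- I) != - I by rewrite cconjN conj_i opprK -subr_eq0 opprK.
have := S_pihalf_kernel e_HB e_real B_eq (Im_i_neq0 R) (Im_i_neq0 R) iNi.
rewrite conj_i aiJ; cbv zeta; set g1 := (_ *: _) => A1.
have := S_pihalf_kernel e_HB e_real B_eq (Im_Ni_neq0 R) (Im_Ni_neq0 R) Nii.
rewrite cconjN conj_i !opprK aiJ; cbv zeta; set g2 := (_ *: _) => A2.
have h2 : hat I s2 = - (pi%:C / a I) *: k (- I).
  rewrite (resolvent_hat_i e_HB e_real B_eq j2_completion) resolvent_hat_s.
  rewrite (linear_funZ _ _ (resolvent_linear e_HB e_real B_eq (Im_i_neq0 R))).
  rewrite (resolvent_uniq e_HB (Im_i_neq0 R) A1) /g1.
  apply: dB_ev_inj; apply/funext => z; rewrite !(evD, evN, evZ).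
  have ii0 : - I - I != 0 by rewrite -opprD oppr_eq0.
  move: (ev (k I) z) (ev (k (- I)) z) (a I) (conjc (a I)) (pi%:C : CC R) ai aiJ0 ii0.
  move: I i2_neq0 => i ii0 x y a0 a' P a00 a'0 Nii0.
  by field; rewrite a00 a'0 Nii0.
rewrite h2 (linear_funZ _ _ (resolvent_linear e_HB e_real B_eq (Im_Ni_neq0 R))).
rewrite (resolvent_uniq e_HB (Im_Ni_neq0 R) A2).
have A0 : A (0, 0) by exists 0 => z; rewrite /= !ev0 mulr0 mul0r addr0.
have := S_pihalf_linear (- (pi%:C / a I)) A2 A0; rewrite !addr0 => A3.
rewrite (app_S_pihalf e_HB e_real B_eq S_dense A3).
apply: dB_ev_inj; apply/funext => z; rewrite /g2 /deficiency_vec !(evD, evN, evZ).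
move: (ev (k I) z) (ev (k (- I)) z) (a I) (conjc (a I)) (pi%:C : CC R) ai aiJ0.
move: I i2_neq0 => i ii0 x y a0 a' P a00 a'0.
by field; rewrite a00 a'0.
Qed.

Local Notation rho := (Re (s I / a I))%:C.

Lemma add_conj_Re z : z + conjc z = 2 * (Re z)%:C.
Proof.
by case: z => x y; apply/eqP; rewrite eq_complex /=; apply/andP; split; apply/eqP; ring.
Qed.

(** The kernel formulas at [i] and [-i] eliminate the kernels. *)
Lemma deficiency_eq z :
  ev deficiency_val z = z * ev deficiency_vec z + (rho * a z - s z).
Proof.
have E : rho = (s I / a I + conjc (s I) / conjc (a I)) / 2.
  rewrite -cconjV -cconjM add_conj_Re; move: (rho : CC R) => r.
  by field.
rewrite E /deficiency_vec /deficiency_val !(evD, evN, evZ).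
have := Ki z; have := KNi z.
move: (ev (k I) z) (ev (k (- I)) z) (a I) (conjc (a I)) (pi%:C : CC R) ai aiJ0.
move: (s I) (conjc (s I)) (a z) (s z).
move: I => i s0 s' az sz x y a0 a' P a00 a'0 E1 E2.
transitivity (z * (- (P / 2) * (a0^-1 * y + a'^-1 * x)) +
   (P * (z - i) * y / a0 + P * (z + i) * x / a') / 2).
  by field; rewrite a00 a'0.
by rewrite E1 E2; field; rewrite a00 a'0.
Qed.

Lemma pairing2_s h h' c : (forall z, ev h' z = z * ev h z + c * a z) ->
  pairing2 A j2 s2 h = - (pi%:C * c).
Proof.
move=> E; rewrite (@pairing2E _ _ h') ?resolvent_hat_s; last by exists c.
rewrite ipZl -ev_kernel evB evZ E addrC addKr.
rewrite cconjN cconjM cconjV cconjK conjc_real.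
by move: (pi%:C : CC R) (a I) ai => P a0 a00; field.
Qed.

Lemma cos_neq0_of_ne_pihalf (gamma : R) :
  0 <= gamma -> gamma < pi -> gamma != pi / 2 -> cos gamma != 0.
Proof.
move=> g0 g1; apply: contra => /eqP cg; apply/eqP.
apply: cos_inj; rewrite ?in_itv /= ?g0 ?(ltW g1) //.
  by rewrite divr_ge0 ?pi_ge0 //= ler_pdivrMr // ler_peMr ?pi_ge0 // ler1n.
by rewrite cg cos_pihalf.
Qed.

Lemma can_ext_dom w gamma g : Im w != 0 -> cos gamma != 0 ->
  (can_ext e w gamma).`1 g <->
  exists h b, [/\ A.`1 h,
    pairing2 A j2 s2 h = pi%:C * b * (tan gamma + Re (s I / a I))%:C &
    g = h + b *: app A (rsv (- I) (hat I s2))].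
Proof.
move=> w0 cg; rewrite app_resolvent_s.
have cgC : (cos gamma)%:C != 0 :> CC R by rewrite (_ : 0 = 0%:C) // (inj_eq (@complexI R)).
have tanC : (tan gamma + Re (s I / a I))%:C =
    (sin gamma)%:C / (cos gamma)%:C + rho :> CC R.
  by rewrite rmorphD /= /tan fmorph_div.
rewrite tanC; move: deficiency_vec deficiency_val deficiency_eq => m m' mE; split.
- move=> [k' /(can_extP e_HB _ _ w0)[d /= E]].
  (* b cancels the coefficient of s in k' - z g *)
  set b := - (d * (cos gamma)%:C).
  pose h := g - b *: m; pose h' := k' - b *: m'.
  have H z : ev h' z = z * ev h z +
      (- (b * ((sin gamma)%:C / (cos gamma)%:C + rho))) * a z.
    rewrite /h' /h !evB !evZ E mE (s_funE e gamma) /b.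
    move: (rho : CC R) => r.
    by field.
  exists h, b; split; first by exists h'; eexists; exact: H.
    by rewrite (pairing2_s H) mulrN opprK mulrA.
  by rewrite subrK.
- move=> [h [b [[h' [c Eh]] Hb ->]]].
  rewrite (pairing2_s Eh) in Hb.
  exists (h' + b *: m'); apply/(can_extP e_HB _ _ w0).
  exists (- b / (cos gamma)%:C) => z /=.
  have cE : c = - (b * ((sin gamma)%:C / (cos gamma)%:C + rho)).
    apply: (mulfI (pi_neq0 R)); apply: oppr_inj.
    by rewrite Hb mulrN opprK mulrA.
  rewrite !evD !evZ Eh mE (s_funE e gamma) cE /=.
  by move: (rho : CC R) => r; field.
Qed.

End Domain.

Theorem theorem4p7 (R : realType) (B : dBSpace R) (e : CC R -> CC R)
    (B_nonzero : exists f : B, f != 0)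
    (e_HB : hermite_biehler e)
    (e_no_real_zero : forall x : R, e x%:C != 0)
    (B_eq : isometric_to_deBranges B e)
    (S_dense : dense ((mul_op (B := B)).`1))
    (w : CC R) (w_nonreal : complex.Im w != 0)
    (Fm1 : completeNormedModType R[i]) (j1 : B -> Fm1)
    (Fm1_completion : is_completion (@norm_Fm1 R B) j1)
    (Bm2 : completeNormedModType R[i]) (j2 : B -> Bm2)
    (Bm2_completion : is_completion (norm_m2 (can_ext (B := B) e w (pi / 2))) j2)
    (gamma : R) (gamma_ge0 : 0 <= gamma) (gamma_ltpi : gamma < pi)
    (gamma_neq : gamma != pi / 2) :
  let Sh : set (B * B) := can_ext e w (pi / 2) in
  let s0 : Bm2 := assoc_m2 j1 Sh j2 (s_fun e 0) in
  (can_ext (B := B) e w gamma).`1 =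
  [set g : B | exists (h : B) (b : R[i]),
     [/\ Sh.`1 h,
         pairing2 Sh j2 s0 h =
           pi%:C * b *
           (tan gamma + complex.Re (s_fun e 0 'i%C / s_fun e (pi / 2) 'i%C))%:C &
         g = h + b *: app Sh (resolvent Sh (- 'i%C) (resolvent_hat Sh j2 'i%C s0))]].
Proof.
have ShE : can_ext (B := B) e w (pi / 2) = S_pihalf e by exact: (can_ext_pihalf B e_HB).
rewrite ShE in Bm2_completion; cbv zeta; rewrite ShE.
apply/seteqP; split=> g /=.
all: have Hg := can_ext_dom B_nonzero e_HB e_no_real_zero B_eq S_dense
  Fm1_completion Bm2_completion g w_nonreal
  (cos_neq0_of_ne_pihalf gamma_ge0 gamma_ltpi gamma_neq).
  by move=> /Hg.
by move=> /Hg.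
Qed.
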